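(* For every $F\in K_0^{\mathbb T}(\mathbb P^{n-1})_{\mathbb C}$ one has $$\theta(F)=\mathcal S^o(q)\,\mathrm B(F),$$ where $\mathrm B\colon K_0^{\mathbb T}(\mathbb P^{n-1})_{\mathbb C}\to H^\Omega_{\mathbb T}(\mathbb P^{n-1})$ is $$\mathrm B(F):=\widehat\Gamma^+_{\mathbb P^{n-1}}\cdot\exp\left(\pi\sqrt{-1}\,c_1(\mathbb P^{n-1})\right)\cdot \mathrm{Ch}_{\mathbb T}(F).$$ That is, the triangle formed by $\theta\colon K_0^{\mathbb T}(\mathbb P^{n-1})_{\mathbb C}\to\mathscr S_n$, $\mathrm B$ and $\mathcal S^o\colon H^\Omega_{\mathbb T}(\mathbb P^{n-1})\to\mathscr S_n$ commutes, $\mathscr S_n$ being the $\mathcal O_\Omega$-module of solutions of the quantum differential equation that are holomorphic in $z\in\Omega$. Equivalently, if the functions $h_{j}(z)$, $j=1,\dots,n$, are defined by $\theta(F)=\sum_{j=1}^n h_j(z)\,\Psi_{\mathrm{top},j}$ with $\Psi_{\mathrm{top},j}:=\mathcal S^o(q)x_{j-1}$, then $\mathrm B(F)=\sum_{j=1}^n h_j(z)\,x_{j-1}$.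
   Context: **Cohomology.** Fix $n\ge 2$. The torus $\mathbb T=(\mathbb C^* )^n$ acts diagonally on $\mathbb C^n$, hence on $\mathbb P^{n-1}$. $H^\bullet_{\mathbb T}(\mathbb P^{n-1},\mathbb C)\cong\mathbb C[x,z]/\langle\prod_{i=1}^n(x-z_i)\rangle$, where $z=(z_1,\dots,z_n)$ are the equivariant parameters and $x$ is the equivariant first Chern class of the tautological bundle $\mathcal O(-1)$. Let $y_1,\dots,y_{n-1}$ be the equivariant Chern roots of the quotient bundle (fibre $\mathbb C^n/F$ over the line $F$), so $(u-x)\prod_j(u-y_j)=\prod_a(u-z_a)$. Put $x_\alpha=x^\alpha$, $0\le\alpha\le n-1$. $\Omega\subset\mathbb C^n$ is the complement of all hyperplanes $z_i-z_j=m$, $i\ne j$, $m\in\mathbb Z$; $\mathcal O_\Omega$ is the ring of holomorphic functions on $\Omega$; $H^\Omega_{\mathbb T}(\mathbb P^{n-1})=H^\bullet_{\mathbb T}(\mathbb P^{n-1},\mathbb C)\otimes_{\mathbb C[z]}\mathcal O_\Omega$. Elements of $H^\Omega_{\mathbb T}$ are determined by their restrictions to the fixed points $pt_I$ (substitution $x=z_I$, $\{y_j\}=\{z_a\}_{a\ne I}$). **qDE.** $x*_{q,z}$ is the $\mathbb C[z]$-linear operator of small quantum multiplication: $x*_{q,z}x_j=x_{j+1}$ for $0\le j\le n-2$ and $x*_{q,z}x_{n-1}=q+\sum_{i=1}^n(-1)^{i-1}s_i(z)x_{n-i}$, with $s_i$ the elementary symmetric polynomials. The quantum differential equation (qDE)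 is $q\frac{d}{dq}I=x*_{q,z}I$ for cohomology-valued $I(q,z)$, $q$ in the universal cover $\widetilde{\mathbb C^*}$ of $\mathbb C^*$. **The map $\mathcal S^o$.** For $z\in\Omega$, $\mathcal S^o(q)$ is the unique operator on cohomology whose matrix in the basis $(x_\alpha)$ is a solution of the qDE of the form $\big(1+\sum_{j\ge1}\Phi_j(z)q^j\big)q^{A_1(z)}$, where $A_1(z)$ is the matrix of classical multiplication by $x$. It is extended $\mathcal O_\Omega$-linearly to $H^\Omega_{\mathbb T}(\mathbb P^{n-1})\to\mathscr S_n$, $\alpha\mapsto\mathcal S^o(q)\alpha$ (topological-enumerative morphism restricted to the small quantum locus). **The map $\theta$.** Let $$\Phi(t,q,z)=e^{\pi\sqrt{-1}\sum_i z_i}\big(e^{-\pi\sqrt{-1}n}q\big)^t\prod_{a=1}^n\Gamma(z_a-t),\qquad W(t,y)=\prod_{j=1}^{n-1}(y_j-t),$$ $$\Psi_J=-\sum_{r=0}^\infty\operatorname{Res}_{t=z_J+r}\Phi(t,q,z)W(t,y),\qquad \Psi^m=\sum_{J=1}^n e^{2\pi\sqrt{-1}mz_J}\Psi_J .$$ These are solutions of the qDE. One has $K_0^{\mathbb T}(\mathbb P^{n-1})_{\mathbb C}\cong\mathbb C[X^{\pm1},Z_1^{\pm1},\dots,Z_n^{\pm1}]/\langle\prod_j(X-Z_j)\rangle$ with $X=[\mathcal O(-1)]$; $\theta$ is the (well defined) map with $\theta(X^m)=\Psi^m$, $m\in\mathbb Z$, linear over $\mathbb C[Z^{\pm1}]$,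 where $Z_j$ acts on solutions as multiplication by $e^{2\pi\sqrt{-1}z_j}$. **Characteristic classes.** For an equivariant bundle $V$ with equivariant Chern roots $\xi_j$, $\mathrm{Ch}_{\mathbb T}(V)=\sum_j e^{2\pi\sqrt{-1}\xi_j}$ (extended linearly to $K$-theory; a factor $Q(Z)$ becomes $Q(e^{2\pi\sqrt{-1}z_1},\dots,e^{2\pi\sqrt{-1}z_n})$). $\widehat\Gamma^+_{\mathbb P^{n-1}}=\prod_{a=1}^{n-1}\Gamma(1+y_a-x)$, and $c_1(\mathbb P^{n-1})=\sum_i z_i-nx$ is the equivariant first Chern class of the tangent bundle. *)

(* Defs.v *)
From HB Require Import structures.
From mathcomp Require Import all_boot all_order all_algebra.
From mathcomp Require Import finmap.
From mathcomp Require Import all_classical all_reals all_analysis.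
From mathcomp Require Import complex.
From mathcomp Require Import ring.
(* The notations of monalg clash with those of mathcomp-analysis. *)
From mathcomp Require monalg.

Set Implicit Arguments.
Unset Strict Implicit.
Unset Printing Implicit Defensive.

Import Order.TTheory GRing.Theory Num.Theory.
Import numFieldNormedType.Exports.
Import (canonicals, coercions) monalg.

Local Open Scope fset_scope.
Local Open Scope classical_set_scope.
Local Open Scope ring_scope.
Local Open Scope complex_scope.
Local Open Scope quotient_scope.

(* As numFieldNormedType does for abstract fields: R[i] is a normed module over
   itself. *)
#[non_forgetful_inheritance]
HB.instance Definition _ (R : realType) := PseudoPointedMetric.copy R[i] R[i]^o.
#[non_forgetful_inheritance]
HB.instance Definition _ (R : realType) := GRing.ComAlgebra.copy R[i] R[i]^o.
#[non_forgetful_inheritance]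
HB.instance Definition _ (R : realType) := Vector.copy R[i] R[i]^o.
#[non_forgetful_inheritance]
HB.instance Definition _ (R : realType) := NormedModule.copy R[i] R[i]^o.
#[non_forgetful_inheritance]
HB.instance Definition _ (R : realType) := Num.ClosedField.on R[i].

Section ComplexAnalysis.
Variable R : realType.
Local Notation C := R[i].

Definition expC (w : C) : C :=
  (expR (complex.Re w))%:C * (cos (complex.Im w) +i* sin (complex.Im w)).

(* the complex number pi * sqrt(-1) *)
Definition piI : C := 0 +i* pi.

(* Euler-Gauss limit  N! N^s / (s (s+1) ... (s+N)). *)
Definition Gamma (s : C) : C :=
  limn (fun N : nat => N`!%:R * expC (s * (ln (N%:R : R))%:C)
                       / \prod_(k < N.+1) (s + k%:R)).

(* Counterclockwise integral of f over the circle |t - a| = e. *)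
Definition circle_integral (f : C -> C) (a : C) (e : R) : C :=
  let g (phi : R) : C :=
    let w := e%:C * expC (0 +i* phi) in f (a + w) * (0 +i* 1) * w in
  Rintegral lebesgue_measure `[0, pi *+ 2] (fun phi => complex.Re (g phi))
  +i* Rintegral lebesgue_measure `[0, pi *+ 2] (fun phi => complex.Im (g phi)).

(* At an isolated singularity a of f the circle integral does not depend on the
   radius once the radius is small, so that the limit is this common value. *)
Definition residue (f : C -> C) (a : C) : C :=
  lim ((piI *+ 2)^-1 * circle_integral f a e @[e --> 0^'+]).

Definition expmx (n : nat) (A : 'M[C]_n) : 'M[C]_n :=
  limn (series (fun k : nat => (k`!%:R)^-1 *: A ^+ k)).

(* Holomorphy on a subset U of C^n: complex (Frechet) differentiability at the
   points of U; used for open U only. *)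
Definition holomorphic_on (n : nat) (U : set 'rV[C]_n) (f : 'rV[C]_n -> C) :=
  forall z, U z -> differentiable f z.

Lemma expC0 : expC 0 = 1.
Proof. by rewrite /expC /= expR0 cos0 sin0 mul1r. Qed.

Lemma expCD (v w : C) : expC (v + w) = expC v * expC w.
Proof.
case: v => a b; case: w => c d; rewrite /expC /= expRD cosD sinD.
by apply/eqP; rewrite eq_complex /=; apply/andP; split; apply/eqP; ring.
Qed.

Lemma expC_neq0 (w : C) : expC w != 0.
Proof.
apply/eqP => w0; have := expCD w (- w).
by rewrite subrr expC0 w0 mul0r => /eqP; rewrite oner_eq0.
Qed.

End ComplexAnalysis.

(* The Laurent polynomial ring C[X^{+-1}, Z_1^{+-1}, ..., Z_n^{+-1}] is the group
   algebra of Z x Z^n: the exponent (m, k) stands for X^m Z_1^{k_1}...Z_n^{k_n}.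
   (The library's product on malg requires a monoid without nontrivial units, so
   that the product is defined here.) *)
Section Laurent.
Variables (R : realType) (n : nat).
Local Notation C := R[i].

Definition expo : Type := (int * {ffun 'I_n -> int})%type.
HB.instance Definition _ := GRing.Zmodule.on expo.
HB.instance Definition _ := Choice.on expo.

Definition laurent : Type := monalg.malg expo C.
HB.instance Definition _ := GRing.Lmodule.on laurent.

Definition lmono (k : expo) (c : C) : laurent := monalg.mkmalgU k c.
Definition lcoeff (k : expo) (P : laurent) : C := monalg.mcoeff k P.
Definition lsupp (P : laurent) : {fset expo} := monalg.msupp P.

(* Linear extension of a function on monomials. *)
Definition lext (V : lmodType C) (f : expo -> V) (P : laurent) : V :=
  \sum_(k <- lsupp P) lcoeff k P *: f k.

Definition lmul (P Q : laurent) : laurent :=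
  \sum_(k <- lsupp P) \sum_(l <- lsupp Q)
     lmono (k + l) (lcoeff k P * lcoeff l Q).

Definition lone : laurent := lmono 0 1.

Lemma lextw (V : lmodType C) (f : expo -> V) (d : {fset expo}) P :
  (lsupp P `<=` d)%fset -> lext f P = \sum_(k <- d) lcoeff k P *: f k.
Proof.
move=> le; rewrite /lext (big_fset_incl _ le) //= => k _.
by move=> /monalg.mcoeff_outdom; rewrite /lcoeff => ->; rewrite scale0r.
Qed.

Lemma lextD V f P Q : @lext V f (P + Q) = lext f P + lext f Q.
Proof.
rewrite (@lextw V f (lsupp P `|` lsupp Q)%fset P) ?fsubsetUl//.
rewrite (@lextw V f (lsupp P `|` lsupp Q)%fset Q) ?fsubsetUr//.
rewrite (@lextw V f (lsupp P `|` lsupp Q)%fset (P + Q)) ?monalg.msuppD_le//.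
rewrite -big_split /=; apply: eq_bigr => k _.
by rewrite /lcoeff monalg.mcoeffD scalerDl.
Qed.

Lemma lextU V f k c : @lext V f (lmono k c) = c *: f k.
Proof.
rewrite (@lextw V f [fset k]%fset) ?monalg.msuppU_le// big_seq_fset1.
by rewrite /lcoeff monalg.mcoeffUU.
Qed.

Lemma lext0 V f : @lext V f 0 = 0.
Proof. by rewrite /lext /lsupp monalg.msupp0 big_seq_fset0. Qed.

Lemma lextN V f P : @lext V f (- P) = - lext f P.
Proof. by apply/eqP; rewrite -addr_eq0 -lextD addNr lext0. Qed.

Lemma lextB V f P Q : @lext V f (P - Q) = lext f P - lext f Q.
Proof. by rewrite lextD lextN. Qed.

Lemma lext_sum V f (I : Type) (r : seq I) (F : I -> laurent) :
  @lext V f (\sum_(i <- r) F i) = \sum_(i <- r) lext f (F i).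
Proof. by apply: big_morph; [exact: lextD | exact: lext0]. Qed.

Lemma laurentE (P : laurent) : P = \sum_(k <- lsupp P) lmono k (lcoeff k P).
Proof. exact: monalg.monalgE. Qed.

Lemma lmono_sum k (I : Type) (r : seq I) (F : I -> C) :
  lmono k (\sum_(i <- r) F i) = \sum_(i <- r) lmono k (F i).
Proof. exact: raddf_sum. Qed.

Lemma lmulE P Q : lmul P Q = lext (fun k => lext (fun l => lmono (k + l) 1) Q) P.
Proof.
apply: eq_bigr => k _; rewrite scaler_sumr; apply: eq_bigr => l _.
rewrite scalerA; apply/monalg.malgP => m.
by rewrite monalg.mcoeffZ !monalg.mcoeffU mulrnAr mulr1.
Qed.

Lemma lext_addf (V : lmodType C) (f g : expo -> V) P :
  lext (fun k => f k + g k) P = lext f P + lext g P.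
Proof. by rewrite -big_split; apply: eq_bigr => k _; rewrite scalerDr. Qed.

Lemma eq_lext (V : lmodType C) (f g : expo -> V) P : f =1 g -> lext f P = lext g P.
Proof. by move=> fg; apply: eq_bigr => k _; rewrite fg. Qed.

Fact lmulDl : left_distributive lmul +%R.
Proof. by move=> P Q S; rewrite !lmulE lextD. Qed.

Fact lmulDr : right_distributive lmul +%R.
Proof.
move=> P Q S; rewrite !lmulE -lext_addf.
by apply: eq_lext => k; rewrite lextD.
Qed.

Fact lmulC : commutative lmul.
Proof.
move=> P Q; rewrite /lmul exchange_big /=.
by apply: eq_bigr => k _; apply: eq_bigr => l _; rewrite addrC mulrC.
Qed.

Lemma lmulUU k l c d : lmul (lmono k c) (lmono l d) = lmono (k + l) (c * d).
Proof.
rewrite lmulE !lextU scalerA; apply/monalg.malgP => m.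
by rewrite monalg.mcoeffZ !monalg.mcoeffU mulrnAr mulr1.
Qed.

Lemma lmul0l P : lmul 0 P = 0. Proof. by rewrite lmulE lext0. Qed.

Lemma lmul_suml (I : Type) (r : seq I) (F : I -> laurent) P :
  lmul (\sum_(i <- r) F i) P = \sum_(i <- r) lmul (F i) P.
Proof. by apply: (big_morph (lmul^~ P)); [move=> x y; exact: lmulDl | exact: lmul0l]. Qed.

Lemma lmul_sumr (I : Type) (r : seq I) (F : I -> laurent) P :
  lmul P (\sum_(i <- r) F i) = \sum_(i <- r) lmul P (F i).
Proof. by rewrite lmulC lmul_suml; apply: eq_bigr => i _; exact: lmulC. Qed.

Fact lmulA : associative lmul.
Proof.
move=> P Q S; rewrite (laurentE P) !lmul_suml; apply: eq_bigr => k _.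
rewrite (laurentE Q) lmul_suml !lmul_sumr lmul_suml; apply: eq_bigr => l _.
rewrite (laurentE S) !lmul_sumr; apply: eq_bigr => m _.
by rewrite !lmulUU addrA mulrA.
Qed.

Fact lmul1l : left_id lone lmul.
Proof.
move=> P; rewrite [in LHS](laurentE P) [in RHS](laurentE P) lmul_sumr.
by apply: eq_bigr => k _; rewrite lmulUU add0r mul1r.
Qed.

Fact lone_neq0 : lone != 0.
Proof.
apply/eqP => /monalg.malgP /(_ 0).
by rewrite /lone /lmono monalg.mcoeffUU monalg.mcoeff0 => /eqP; rewrite oner_eq0.
Qed.

HB.instance Definition _ := GRing.Zmodule_isComNzRing.Build laurent
  lmulA lmulC lmul1l lmulDl lone_neq0.

Lemma lextM (chi : expo -> C) :
  (forall k l, chi (k + l) = chi k * chi l) ->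
  forall P Q : laurent, lext chi (P * Q) = lext chi P * lext chi Q.
Proof.
have lextE P : lext chi P = \sum_(k <- lsupp P) lcoeff k P * chi k by [].
move=> chiD P Q; rewrite [P * Q]/(lmul P Q) lext_sum !lextE mulr_suml.
apply: eq_bigr => k _; rewrite lext_sum mulr_sumr; apply: eq_bigr => l _.
by rewrite lextU chiD /GRing.scale /= mulrACA.
Qed.

Definition lX : laurent := lmono (1, 0) 1.
Definition lZ (j : 'I_n) : laurent := lmono (0, [ffun i => (i == j)%:R]) 1.

(* The principal ideal < prod_j (X - Z_j) >. *)
Definition K_ideal : {pred laurent} :=
  [pred P : laurent | `[< exists G : laurent, P = G * \prod_j (lX - lZ j) >]].

Fact K_ideal_closed : zmod_closed K_ideal.
Proof.
split; first by rewrite inE /=; exists 0; rewrite mul0r.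
move=> P Q; rewrite !inE /= => -[G ->] [H ->].
by exists (G - H); rewrite mulrBl.
Qed.
HB.instance Definition _ := GRing.isZmodClosed.Build laurent K_ideal K_ideal_closed.

(* K_0^T(P^{n-1}) with complex coefficients. *)
Definition K0 := {ideal_quot K_ideal}.
HB.instance Definition _ := GRing.Zmodule.on K0.
Definition K0class (P : laurent) : K0 := \pi_(K0) P.

Lemma K0_lext (chi : expo -> C) :
  (forall k l, chi (k + l) = chi k * chi l) ->
  (exists j : 'I_n, chi (1, 0) = chi (0, [ffun i => (i == j)%:R])) ->
  forall P : laurent, lext chi (repr (K0class P)) = lext chi P.
Proof.
move=> chiD [j chij] P; apply/eqP; rewrite -subr_eq0 -lextB.
have : repr (K0class P) - P \in K_ideal.
  by rewrite Quotient.idealrBE reprK.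
rewrite inE /= => -[G ->].
by rewrite lextM// (bigD1 j)//= lextM// lextB !lextU chij subrr mul0r mulr0.
Qed.

End Laurent.

Arguments K0class {R n}.

Section EquivariantProjectiveSpace.
Variables (R : realType) (n : nat).
Local Notation C := R[i].

(* A point of the universal cover of C^* is given by its logarithm tau: the point
   q = e^tau, with q^t = e^{t tau} and q d/dq = d/dtau. *)

Definition Omega : set 'rV[C]_n :=
  [set z | forall i j : 'I_n, i != j -> forall m : int, z 0 i - z 0 j != m%:~R].

(* Fix z in Omega. A cohomology class is represented by the column vector of its
   coordinates in the basis x_0, ..., x_{n-1}; its restriction to the fixed point
   pt_I is the value of the polynomial at x = z_I. *)
Definition restriction (z : 'rV[C]_n) (I : 'I_n) (alpha : 'cV[C]_n) : C :=
  \sum_(a < n) alpha a 0 * z 0 I ^+ a.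

(* The class of a function f(x; y_1, ..., y_{n-1}) symmetric in the Chern roots y
   of the quotient bundle: its restriction to pt_I is f(z_I; (z_a)_{a != I}). *)
Definition coh_class (z : 'rV[C]_n) (f : C -> seq C -> C) : 'cV[C]_n :=
  invmx (Vandermonde n z)^T
  *m \col_(I < n) f (z 0 I) [seq z 0 a | a <- enum 'I_n & a != I].

Definition x_class (j : 'I_n) : 'cV[C]_n := delta_mx j 0.

Lemma restriction_coh_class z f I : Omega z ->
  restriction z I (coh_class z f)
  = f (z 0 I) [seq z 0 a | a <- enum 'I_n & a != I].
Proof.
move=> zO.
have Vu : (Vandermonde n z)^T \in unitmx.
  rewrite unitmxE det_tr det_Vandermonde unitfE.
  apply/prodf_neq0 => i _; apply/prodf_neq0 => j ij.
  by apply: (zO j i _ 0); rewrite -val_eqE /= gtn_eqF.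
have -> : restriction z I (coh_class z f)
        = ((Vandermonde n z)^T *m coh_class z f) I 0.
  by rewrite mxE; apply: eq_bigr => a _; rewrite !mxE mulrC.
by rewrite mulKVmx// mxE.
Qed.

Definition esym (z : 'rV[C]_n) (k : nat) : C :=
  \sum_(A : {set 'I_n} | #|A| == k) \prod_(a in A) z 0 a.

(* The matrix of x *_{q,z} in the basis x_0, ..., x_{n-1}; column j is the image of
   x_j, and the term x_{n-i} of the last column sits in row n-i. *)
Definition qmul (z : 'rV[C]_n) (q : C) : 'M[C]_n :=
  \matrix_(a, j) if (j.+1 < n)%N then (a == j.+1 :> nat)%:R
                 else q *+ (a == 0 :> nat)
                      + (-1) ^+ (n - a).-1 * esym z (n - a).

(* I solves the quantum differential equation at z. *)
Definition solves_qDE (m : nat) (z : 'rV[C]_n) (I : C -> 'M[C]_(n, m)) : Prop :=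
  forall tau : C, is_derive tau (1 : C) I (qmul z (expC tau) *m I tau).

Definition H_Omega (alpha : 'rV[C]_n -> 'cV[C]_n) : Prop :=
  forall a : 'I_n, holomorphic_on Omega (fun z => alpha z a 0).

Definition sol_space (I : C -> 'rV[C]_n -> 'cV[C]_n) : Prop :=
  (forall z, Omega z -> solves_qDE z (I^~ z)) /\
  (forall tau, H_Omega (I tau)).

Definition is_So (z : 'rV[C]_n) (S : C -> 'M[C]_n) : Prop :=
  solves_qDE z S /\
  exists Phi : nat -> 'M[C]_n, Phi 0%N = 1%:M /\
  exists P : C -> 'M[C]_n, forall tau,
    (series (fun j : nat => expC (tau *+ j) *: Phi j) @ \oo --> P tau) /\
    S tau = P tau *m expmx (tau *: qmul z 0).

Definition So_mx (z : 'rV[C]_n) : C -> 'M[C]_n := get (is_So z).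

Definition So (alpha : 'rV[C]_n -> 'cV[C]_n) : C -> 'rV[C]_n -> 'cV[C]_n :=
  fun tau z => So_mx z tau *m alpha z.

Definition Psi_top (j : 'I_n) : C -> 'rV[C]_n -> 'cV[C]_n :=
  So (fun=> x_class j).

(* e^{-pi sqrt(-1) n} q is the point of the universal cover with logarithm
   tau - pi sqrt(-1) n. *)
Definition master (t tau : C) (z : 'rV[C]_n) : C :=
  expC (piI R * \sum_i z 0 i) * expC (t * (tau - piI R *+ n))
  * \prod_a Gamma (z 0 a - t).

Definition weight (t : C) (z : 'rV[C]_n) : 'cV[C]_n :=
  coh_class z (fun _ ys => \prod_(y <- ys) (y - t)).

Definition Psi_res (J : 'I_n) (tau : C) (z : 'rV[C]_n) : 'cV[C]_n :=
  \col_(a < n) - limn (series (fun r : nat =>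
     residue (fun t => master t tau z * weight t z a 0) (z 0 J + r%:R))).

Definition Psi_pow (m : int) (tau : C) (z : 'rV[C]_n) : 'cV[C]_n :=
  \sum_J expC (piI R *+ 2 * m%:~R * z 0 J) *: Psi_res J tau z.

(* The value e^{2 pi sqrt(-1) <k, z>} of Z_1^{k_1} ... Z_n^{k_n}. *)
Definition Zval (k : {ffun 'I_n -> int}) (z : 'rV[C]_n) : C :=
  expC (piI R *+ 2 * \sum_i (k i)%:~R * z 0 i).

(* theta and Ch_T on Laurent polynomials: the maps determined by linearity from
   X^m Z^k |-> e^{2 pi sqrt(-1) <k, z>} Psi^m, resp.
   X^m Z^k |-> e^{2 pi sqrt(-1) (m x + <k, z>)}. *)
Definition theta_laurent (P : laurent R n) (tau : C) (z : 'rV[C]_n) : 'cV[C]_n :=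
  lext (fun k : expo n => Zval k.2 z *: Psi_pow k.1 tau z) P.

Definition Ch_laurent (P : laurent R n) (z : 'rV[C]_n) (x : C) : C :=
  lext (fun k : expo n => expC (piI R *+ 2 * k.1%:~R * x) * Zval k.2 z) P.

(* Both maps factor through the quotient K0: see theta_class and B_class. *)
Definition theta (F : K0 R n) : C -> 'rV[C]_n -> 'cV[C]_n :=
  theta_laurent (repr F).

Definition B_laurent (P : laurent R n) (z : 'rV[C]_n) : 'cV[C]_n :=
  coh_class z (fun x ys =>
    \prod_(y <- ys) Gamma (1 + y - x)
    * expC (piI R * (\sum_i z 0 i - x *+ n))
    * Ch_laurent P z x).

Definition B (F : K0 R n) : 'rV[C]_n -> 'cV[C]_n := B_laurent (repr F).

Lemma Ch_class (P : laurent R n) z (J : 'I_n) :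
  Ch_laurent (repr (K0class P)) z (z 0 J) = Ch_laurent P z (z 0 J).
Proof.
apply: K0_lext => [[m k] [m' k']|] /=.
  rewrite /Zval /= -!expCD; congr expC.
  under eq_bigr do rewrite ffunE rmorphD mulrDl.
  by rewrite big_split /= rmorphD; ring.
exists J; rewrite /Zval /= -!expCD; congr expC.
rewrite big1 => [|i _]; last by rewrite ffunE mul0r.
rewrite (bigD1 J)//= big1 => [|i iJ]; last by rewrite ffunE (negbTE iJ) mul0r.
by rewrite ffunE eqxx /= mulr0z mulr1z; ring.
Qed.

Lemma theta_laurentE (P : laurent R n) tau z :
  theta_laurent P tau z = \sum_J Ch_laurent P z (z 0 J) *: Psi_res J tau z.
Proof.
rewrite /theta_laurent /Ch_laurent /lext.
under [RHS]eq_bigr do rewrite scaler_suml.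
rewrite [RHS]exchange_big /=; apply: eq_bigr => k _.
rewrite /Psi_pow !scaler_sumr; apply: eq_bigr => J _.
by rewrite !scalerA /GRing.scale /=; congr (_ *: _); ring.
Qed.

Lemma theta_class (P : laurent R n) : theta (K0class P) = theta_laurent P.
Proof.
apply/funext => tau; apply/funext => z; rewrite /theta !theta_laurentE.
by apply: eq_bigr => J _; rewrite Ch_class.
Qed.

Lemma theta_X (m : int) : theta (K0class (lmono (m, 0) 1)) = Psi_pow m.
Proof.
apply/funext => tau; apply/funext => z.
rewrite theta_class /theta_laurent lextU scale1r /Zval big1 ?mulr0 ?expC0 ?scale1r//.
by move=> i _; rewrite ffunE mulr0z mul0r.
Qed.

Lemma theta_Z (k : {ffun 'I_n -> int}) (c : R[i]) (P : laurent R n) tau z :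
  theta (K0class (lmono (0, k) c * P)) tau z
  = (c * Zval k z) *: theta (K0class P) tau z.
Proof.
rewrite !theta_class !theta_laurentE scaler_sumr; apply: eq_bigr => J _.
rewrite scalerA; congr (_ *: _); rewrite /Ch_laurent lextM => [|[m l] [m' l']].
  by rewrite lextU /= mulr0z mulr0 mul0r expC0 mul1r.
rewrite /Zval /= -!expCD; congr expC.
under eq_bigr do rewrite ffunE rmorphD mulrDl.
by rewrite big_split /= rmorphD; ring.
Qed.

Lemma theta_add (F G : K0 R n) tau z :
  theta (F + G) tau z = theta F tau z + theta G tau z.
Proof.
have ex (H : K0 R n) : exists P, H = K0class P.
  by exists (repr H); rewrite /K0class reprK.
have [P ->] := ex F; have [Q ->] := ex G.
have -> : K0class P + K0class Q = K0class (P + Q).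
  by symmetry; exact: raddfD.
by rewrite !theta_class; exact: lextD.
Qed.

Lemma B_class (P : laurent R n) : B (K0class P) = B_laurent P.
Proof.
apply/funext => z; congr (_ *m _); apply/colP => J.
by rewrite !mxE Ch_class.
Qed.

End EquivariantProjectiveSpace.

(* Main.v *)
From HB Require Import structures.
Require Import Defs.
From mathcomp Require Import all_boot all_order all_algebra.
From mathcomp Require Import all_classical all_reals all_analysis.
From mathcomp Require Import complex ring lra.

(** The proof computes everything in the basis of fixed points. For z in Omega the
    restriction matrix [restr_mx z], a Vandermonde matrix, diagonalizes classical
    multiplication by x with eigenvalues z_1, ..., z_n. In this basis a solution of
    the form (1 + sum_j Phi_j q^j) q^(A_1) is a power series in q with matrix
    coefficients, followed by the diagonal matrix of the q^(z_J), and the quantum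
    differential equation becomes a two-term recursion ([Sol_qDE]) whose leading
    factor z_J + r - z_I does not vanish on Omega for r > 0. Hence the recursion has
    at most one solution with given constant term, and the map S^o is known as soon
    as one solution of the recursion starting with the identity is exhibited
    ([So_mxE]).

    The residues provide that solution. At t = z_J + r the master function has a
    simple pole, coming from Gamma (z_J - t); by the functional equation of Gamma its
    residue is a constant depending on J only, namely the restriction of B(1) to
    pt_J, times q^(z_J + r) times an explicit rational function of z
    ([residue_master]). These rational functions [mcoef] start with the identity for
    r = 0 and satisfy the recursion ([mcoef0], [mcoef_rec]). Therefore Psi_J is S^o
    applied to the restriction of B(1) at pt_J times the class of pt_J
    ([Psi_resE]), and summing over J with the weights Ch(F) restricted to pt_J
    gives theta(F) = S^o B(F). The statement on coordinates follows since S^o is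
    invertible for q close to 0 ([Sol_unit]).

    The analytic part is the holomorphy in z of S^o and of the Gamma class, and the
    convergence of the Gauss product that defines Gamma. Both are limits of
    explicit functions, and holomorphy of the limit is obtained without Cauchy
    integrals: functions on a ball with a linear part at the centre and a quadratic
    remainder form a Banach algebra ([jet], [jetM], [jet_series]), closed under
    exponentials and inverses, whose elements are differentiable at the centre.
    Bounding the explicit factors in this algebra gives [Gamma_differentiable] and
    [psum_mcoef_differentiable]. *)

Set Implicit Arguments.
Unset Strict Implicit.
Unset Printing Implicit Defensive.

Import Order.TTheory GRing.Theory Num.Theory.
Import numFieldNormedType.Exports.

Local Open Scope classical_set_scope.
Local Open Scope ring_scope.
Local Open Scope complex_scope.

(** * Real-valued norms *)

Section RealNorm.
Variable R : realType.
Local Notation C := R[i].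

(** Norms of complex normed modules take values in the complex numbers, whose
    order is partial. Estimates are made with this real version. *)
Definition rnorm (V : normedModType C) (v : V) : R := complex.Re `|v|.

Section Module.
Variable V : normedModType C.
Implicit Types v w : V.

Lemma rnormE v : `|v| = (rnorm v)%:C.
Proof. by rewrite /rnorm RRe_real// ger0_real. Qed.

Lemma rnorm_ge0 v : 0 <= rnorm v.
Proof. by have := normr_ge0 v; rewrite rnormE ler0c. Qed.

Lemma rnorm0 : rnorm (0 : V) = 0.
Proof. by rewrite /rnorm normr0. Qed.

Lemma rnormN v : rnorm (- v) = rnorm v.
Proof. by rewrite /rnorm normrN. Qed.

Lemma rnormB v w : rnorm (v - w) = rnorm (w - v).
Proof. by rewrite /rnorm distrC. Qed.

Lemma ler_rnormD v w : rnorm (v + w) <= rnorm v + rnorm w.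
Proof. by rewrite -lecR rmorphD /= -!rnormE ler_normD. Qed.

Lemma rnorm_eq0 v : (rnorm v == 0) = (v == 0).
Proof.
by rewrite -(normr_eq0 v) rnormE; apply/eqP/eqP => [->//|[]].
Qed.

Lemma ler_rnorm_sum I (r : seq I) (F : I -> V) :
  rnorm (\sum_(i <- r) F i) <= \sum_(i <- r) rnorm (F i).
Proof.
elim: r => [|i r IH]; first by rewrite !big_nil rnorm0.
by rewrite !big_cons (le_trans (ler_rnormD _ _))// lerD2l.
Qed.

Lemma ler_rnormB v w : rnorm v - rnorm w <= rnorm (v - w).
Proof. by rewrite lerBlDr (le_trans _ (ler_rnormD _ _))// subrK. Qed.

Lemma rnormZ (a : C) v : rnorm (a *: v) = rnorm (a : C^o) * rnorm v.
Proof. by apply: complexI; rewrite rmorphM /= -!rnormE normrZ. Qed.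

End Module.

Lemma rnormM (a b : C) : rnorm (a * b) = rnorm a * rnorm b.
Proof. by apply: complexI; rewrite rmorphM /= -!rnormE normrM. Qed.

Lemma rnorm1 : rnorm (1 : C) = 1.
Proof. by apply: complexI; rewrite -rnormE normr1. Qed.

Lemma rnormX (a : C) k : rnorm (a ^+ k) = rnorm a ^+ k.
Proof. by apply: complexI; rewrite rmorphXn /= -!rnormE normrX. Qed.

Lemma rnormV (a : C) : rnorm a^-1 = (rnorm a)^-1.
Proof. by apply: complexI; rewrite fmorphV /= -!rnormE normfV. Qed.

Lemma rnorm_real (x : R) : rnorm (x%:C : C) = `|x|.
Proof. by rewrite /rnorm normc_def /= expr0n /= addr0 sqrtr_sqr. Qed.

Lemma rnorm_natr k : rnorm (k%:R : C) = k%:R.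
Proof. by apply: complexI; rewrite -rnormE normr_nat rmorph_nat. Qed.

Lemma rnorm_Re (a : C) : `|complex.Re a| <= rnorm a.
Proof. by rewrite -lecR -rnormE normc_ge_Re. Qed.

Lemma rnorm_Im (a : C) : `|complex.Im a| <= rnorm a.
Proof.
case: a => a b /=; rewrite /rnorm normc_def /= -sqrtr_sqr ler_wsqrtr//.
by rewrite lerDr sqr_ge0.
Qed.

Lemma rnorm_ReIm (a : C) : rnorm a <= `|complex.Re a| + `|complex.Im a|.
Proof.
case: a => a b; rewrite /rnorm normc_def /=.
rewrite -[leRHS]ger0_norm ?addr_ge0// -sqrtr_sqr ler_wsqrtr// sqrrD.
by rewrite !real_normK ?num_real// lerD2r lerDl mulrn_wge0// mulr_ge0.
Qed.

Lemma cvg_rnormP (V : normedModType C) (T : Type) (F : set_system T) (f : T -> V) (l : V) :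
  Filter F -> f @ F --> l <-> rnorm (f x - l) @[x --> F] --> (0 : R).
Proof.
move=> FF; split.
  move=> /cvgrPdist_lt fl; apply/cvgrPdist_lt => e e0.
  have := fl e%:C; rewrite ltcR => /(_ e0); apply: filterS => x.
  by rewrite sub0r normrN ger0_norm ?rnorm_ge0// rnormE ltcR rnormB.
move=> /cvgrPdist_lt fl; apply/cvgrPdist_lt => e e0.
have er : e = (complex.Re e)%:C by rewrite RRe_real// ger0_real// ltW.
have := fl (complex.Re e); rewrite -ltcR -er => /(_ e0); apply: filterS => x.
by rewrite sub0r normrN ger0_norm ?rnorm_ge0// rnormB er -ltcR -rnormE.
Qed.

Lemma cvg_complexP (T : Type) (F : set_system T) (f : T -> C) (l : C) :
  Filter F -> f @ F --> l <->
  (complex.Re (f x) @[x --> F] --> complex.Re l) /\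
  (complex.Im (f x) @[x --> F] --> complex.Im l).
Proof.
move=> FF; split.
  move=> /cvg_rnormP/cvgrPdist_lt fl; split; apply/cvgrPdist_lt => e e0;
  have := fl e e0; apply: filterS => x;
  rewrite sub0r normrN ger0_norm ?rnorm_ge0//; apply: le_lt_trans.
    by rewrite distrC -raddfB rnorm_Re.
  by rewrite distrC -raddfB rnorm_Im.
move=> [fr fi]; apply/cvg_rnormP.
apply: (@squeeze_cvgr _ _ _ _ (cst 0)
  (fun x => `|complex.Re (f x) - complex.Re l| + `|complex.Im (f x) - complex.Im l|) _ _ 0).
- by near=> x; rewrite rnorm_ge0/= -!raddfB rnorm_ReIm.
- exact: cvg_cst.
- rewrite -[X in _ --> X](addr0 (0 : R)); apply: cvgD.
    rewrite -(normr0 R); apply: cvg_norm; rewrite -(subrr (complex.Re l)).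
    by apply: cvgB fr _; exact: cvg_cst.
  rewrite -(normr0 R); apply: cvg_norm; rewrite -(subrr (complex.Im l)).
  by apply: cvgB fi _; exact: cvg_cst.
Unshelve. all: by end_near. Qed.

(** Completeness of the complex numbers enters only through this comparison
    test, which reduces to the real one on real and imaginary parts. *)
Lemma series_summable (u : nat -> C) (M : nat -> R) (B : R) :
  (forall k, rnorm (u k) <= M k) -> (forall N, \sum_(0 <= k < N) M k <= B) ->
  cvgn (series u).
Proof.
move=> uM MB.
have cvgr (v : nat -> R) : (forall k, `|v k| <= M k) -> cvgn (series v).
  move=> vM; apply: normed_cvg; apply: nondecreasing_is_cvgn.
    by apply: nondecreasing_series => k _ _; rewrite normr_ge0.
  exists B => _ [N _ <-]; apply: le_trans (MB N).
  by apply: ler_sum => k _; exact: vM.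
have cr := cvgr (fun k => complex.Re (u k)) (fun k => le_trans (rnorm_Re _) (uM k)).
have ci := cvgr (fun k => complex.Im (u k)) (fun k => le_trans (rnorm_Im _) (uM k)).
apply/cvg_ex; exists (limn (series (fun k => complex.Re (u k))) +i*
                      limn (series (fun k => complex.Im (u k)))).
apply/cvg_complexP; split => /=.
  under eq_cvg => N do rewrite /series/= raddf_sum; exact: cr.
under eq_cvg => N do rewrite /series/= raddf_sum; exact: ci.
Qed.

Lemma cvg_rnorm_le (V : normedModType C) (u : nat -> V) (l : V) (B : R) :
  u @ \oo --> l -> (forall N, rnorm (u N) <= B) -> rnorm l <= B.
Proof.
move=> /cvg_rnormP/cvgrPdist_lt ul uB; rewrite leNgt; apply/negP => Bl.
have /ul /filter_ex[N] : 0 < rnorm l - B by rewrite subr_gt0.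
rewrite sub0r normrN ger0_norm ?rnorm_ge0// => h.
have := ler_rnormB l (u N); rewrite rnormB; have := uB N; lra.
Qed.

End RealNorm.

(** * The exponential series *)

Section ExpSeries.
Variable R : realType.
Local Notation C := R[i].

(** Both phi - f and phi + f vanish at 0 and have a nonnegative derivative. *)
Lemma real_mean_value_ineq (f df phi dphi : R -> R) :
  f 0 = 0 -> phi 0 = 0 ->
  (forall t : R, is_derive t (1:R) f (df t)) -> (forall t : R, is_derive t (1:R) phi (dphi t)) ->
  forall t, 0 <= t -> (forall s, 0 <= s <= t -> `|df s| <= dphi s) ->
  `|f t| <= phi t.
Proof.
move=> f0 phi0 fd phid t t0 dfphi.
have key (g dg : R -> R) : g 0 = 0 -> (forall t : R, is_derive t (1:R) g (dg t)) ->
    (forall s, 0 <= s <= t -> 0 <= dg s) -> 0 <= g t.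
  move=> g0 gd dg0.
  have [|c] := @MVT_segment _ g dg 0 t t0 (fun x _ => gd x).
    apply: derivable_within_continuous => x _; exact: (@ex_derive _ _ _ _ _ _ _ (gd x)).
  rewrite in_itv/= g0 subr0 => /andP[c0 ct] ->.
  by rewrite subr0 mulr_ge0// dg0// c0 ct.
rewrite ler_norml -subr_ge0 opprK; apply/andP; split.
  apply: (key (fun s => f s + phi s) (fun s => df s + dphi s)).
  - by rewrite f0 phi0 addr0.
  - by move=> s s0; have := dfphi s s0; rewrite ler_norml -subr_ge0 opprK => /andP[].
rewrite -subr_ge0.
apply: (key (fun s => phi s - f s) (fun s => dphi s - df s)).
- by rewrite f0 phi0 subr0.
- by move=> s s0; have := dfphi s s0; rewrite ler_norml subr_ge0 => /andP[].
Qed.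

Definition exp_poly (m : nat) (w : C) : C := \sum_(0 <= k < m) w ^+ k / k`!%:R.

Lemma rnorm_expC (w : C) : rnorm (expC w) = expR (complex.Re w).
Proof.
rewrite rnormM rnorm_real ger0_norm ?expR_ge0//.
by rewrite /rnorm normc_def/= cos2Dsin2 sqrtr1 mulr1.
Qed.

Lemma Re_realM (x : R) (w : C) : complex.Re (x%:C * w) = x * complex.Re w.
Proof. by case: w => a b /=; rewrite mul0r subr0. Qed.
Lemma Im_realM (x : R) (w : C) : complex.Im (x%:C * w) = x * complex.Im w.
Proof. by case: w => a b /=; rewrite mul0r addr0. Qed.

Lemma expC_derive_Re (w : C) (t : R) :
  is_derive t (1:R) (fun s => complex.Re (expC (s%:C * w))) (complex.Re (w * expC (t%:C * w))).
Proof.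
case: w => a b.
have -> : (fun s : R => complex.Re (expC (s%:C * (a +i* b)))) =
   (fun s => expR (s * a) * cos (s * b)).
  by apply/funext => s; rewrite /expC Re_realM/= !mul0r subr0 addr0.
apply: is_derive_eq; rewrite /expC Re_realM/= !mul0r !subr0 !addr0 /GRing.scale /=.
ring.
Qed.

Lemma expC_derive_Im (w : C) (t : R) :
  is_derive t (1:R) (fun s => complex.Im (expC (s%:C * w))) (complex.Im (w * expC (t%:C * w))).
Proof.
case: w => a b.
have -> : (fun s : R => complex.Im (expC (s%:C * (a +i* b)))) =
   (fun s => expR (s * a) * sin (s * b)).
  by apply/funext => s; rewrite /expC Re_realM/= !mul0r !addr0.
apply: is_derive_eq; rewrite /expC Re_realM/= !mul0r !subr0 !addr0 /GRing.scale /=.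
ring.
Qed.

Lemma exp_poly_term (w : C) (s : R) k :
  (s%:C * w) ^+ k / k`!%:R = (s ^+ k)%:C * (w ^+ k / k`!%:R).
Proof. by rewrite exprMn rmorphXn mulrA. Qed.

Section Component.
Variable l : {additive C -> R}.
Hypothesis lM : forall (x : R) (w : C), l (x%:C * w) = x * l w.
Hypothesis l_exp : forall w (t : R),
  is_derive t (1:R) (fun s => l (expC (s%:C * w))) (l (w * expC (t%:C * w))).

(** Stated for a real-linear functional l, so that the real and the imaginary
    part are differentiated by the same computation. *)
Lemma exp_poly_derive m (w : C) (t : R) :
  is_derive t (1:R) (fun s => l (exp_poly m (s%:C * w))) (l (w * exp_poly m.-1 (t%:C * w))).
Proof.
elim: m => [|m IH].
  rewrite /exp_poly big_geq// mulr0 raddf0.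
  have -> : (fun s : R => l (\sum_(0 <= k < 0) (s%:C * w) ^+ k / k`!%:R)) = cst 0.
    by apply/funext => s; rewrite big_geq// raddf0.
  exact: is_derive_cst.
set c := l (w ^+ m / m`!%:R).
have -> : (fun s : R => l (exp_poly m.+1 (s%:C * w))) =
   (fun s : R => l (exp_poly m (s%:C * w))) + c \*: (id ^+ m : R -> R).
  apply/funext => s; rewrite /exp_poly big_nat_recr//= raddfD/= exp_poly_term lM.
  by rewrite !fctE /= [_ * l _]mulrC.
apply: is_derive_eq; rewrite /GRing.scale /= mulr1.
case: m {IH} @c => [|m] c.
  by rewrite /= !mul0r mulr0 addr0.
rewrite /= /exp_poly big_nat_recr//= mulrDr raddfD; congr (_ + _).
have -> : w * ((t%:C * w) ^+ m / m`!%:R) =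
    (m.+1%:R * t ^+ m)%:C * (w ^+ m.+1 / m.+1`!%:R).
  rewrite exp_poly_term rmorphM rmorph_nat exprS factS natrM invfM.
  have : (m.+1%:R : C) != 0 by rewrite pnatr_eq0.
  have : (m`!%:R : C) != 0 by rewrite pnatr_eq0 -lt0n fact_gt0.
  by move=> ? ?; field; apply/andP.
by rewrite lM -/c; ring.
Qed.

End Component.

(** Along the ray s w the error of order m + 1 has derivative w times the error
    of order m, so that the bound follows by induction and integration. Real and
    imaginary parts are integrated separately, whence the factor 2 ^ m. For
    m = 2 this is the second-order expansion of the exponential, and letting m
    tend to infinity gives its power series. *)
Lemma expC_exp_poly_bound (w : C) m (t : R) : 0 <= t ->
  rnorm (expC (t%:C * w) - exp_poly m (t%:C * w)) <=
  expR (t * rnorm w) * ((2 * rnorm w) ^+ m * t ^+ m / m`!%:R).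
Proof.
elim: m t => [|m IH] t t0.
  rewrite /exp_poly big_geq// subr0 rnorm_expC !expr0 divr1 !mulr1 ler_expR Re_realM.
  by rewrite ler_wpM2l// (le_trans (ler_norm _))// rnorm_Re.
set K := expR (t * rnorm w).
pose phi (s : R) := K * (2 ^+ m * rnorm w ^+ m.+1 * s ^+ m.+1 / m.+1`!%:R).
pose dphi (s : R) := K * (2 ^+ m * rnorm w ^+ m.+1 * s ^+ m / m`!%:R).
have phid (s : R) : is_derive s (1:R) phi (dphi s).
  have -> : phi = (K * (2 ^+ m * rnorm w ^+ m.+1 / m.+1`!%:R)) \*: (id ^+ m.+1 : R -> R).
    by apply/funext => x; rewrite !fctE /phi /= /GRing.scale /=; ring.
  apply: is_derive_eq; rewrite /GRing.scale /= mulr1 /dphi factS natrM.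
  have : (m.+1%:R : R) != 0 by rewrite pnatr_eq0.
  have : (m`!%:R : R) != 0 by rewrite pnatr_eq0 -lt0n fact_gt0.
  by move=> ? ?; rewrite invfM; field; apply/andP.
have key (l : {additive C -> R}) : (forall (x : R) (w : C), l (x%:C * w) = x * l w) ->
   (forall w, `|l w| <= rnorm w) ->
   (forall t : R,
   is_derive t (1:R) (fun s => l (expC (s%:C * w))) (l (w * expC (t%:C * w)))) ->
   `|l (expC (t%:C * w) - exp_poly m.+1 (t%:C * w))| <= phi t.
  move=> lM l_rnorm l_exp.

  apply: (@real_mean_value_ineq
    (fun s => l (expC (s%:C * w) - exp_poly m.+1 (s%:C * w)))
    (fun s => l (w * (expC (s%:C * w) - exp_poly m (s%:C * w)))) phi dphi) => //.
  - by rewrite rmorph0 mul0r expC0 /exp_poly big_nat_recl// big1 ?fact0 ?divr1 ?addr0 ?subrr ?raddf0//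
      => i _; rewrite exprS !mul0r.
  - by rewrite /phi expr0n mulr0 mul0r mulr0.
  - move=> s.
    have -> : (fun s : R => l (expC (s%:C * w) - exp_poly m.+1 (s%:C * w))) =
      (fun s : R => l (expC (s%:C * w))) - (fun s : R => l (exp_poly m.+1 (s%:C * w))).
      by apply/funext => x; rewrite !fctE raddfB.
    rewrite mulrBr raddfB; apply: is_deriveB.
    exact: (exp_poly_derive lM m.+1).
  - move=> s /andP[s0 st]; apply: (le_trans (l_rnorm _)); rewrite rnormM.
    apply: (le_trans (ler_wpM2l (rnorm_ge0 w) (IH s s0))).
    rewrite /dphi mulrCA.
    have -> : 2 ^+ m * rnorm w ^+ m.+1 * s ^+ m / m`!%:R =
       rnorm w * ((2 * rnorm w) ^+ m * s ^+ m / m`!%:R) by rewrite exprMn exprS; ring.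
    rewrite ler_wpM2r//.
      by rewrite !mulr_ge0 ?exprn_ge0 ?mulr_ge0 ?rnorm_ge0 ?invr_ge0 ?ler0n.
    by rewrite ler_expR ler_wpM2r ?rnorm_ge0.
apply: (le_trans (rnorm_ReIm _)).
have -> : K * ((2 * rnorm w) ^+ m.+1 * t ^+ m.+1 / (m.+1)`!%:R) = phi t + phi t.
  by rewrite /phi exprMn (exprS 2); ring.
apply: lerD.
  apply: (key (@complex.Re R)) => //; [exact: Re_realM|exact: rnorm_Re|exact: expC_derive_Re].
apply: (key (@complex.Im R)) => //; [exact: Im_realM|exact: rnorm_Im|exact: expC_derive_Im].
Qed.

(** The powers of the matrix of classical multiplication give this series, and
    it makes the exponential available to the calculus of jets. *)
Lemma expC_series (w : C) :
  series (fun k => w ^+ k / k`!%:R) @ \oo --> expC w.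
Proof.
apply/cvg_rnormP.
apply: (@squeeze_cvgr _ _ _ _ (cst 0)
  (fun m => expR (rnorm w) * exp_coeff (2 * rnorm w) m) _ _ 0).
- near=> m; rewrite rnorm_ge0/= rnormB.
  have := @expC_exp_poly_bound w m 1 ler01.
  by rewrite !mul1r expr1n mulr1.
- exact: cvg_cst.
- rewrite -[X in _ --> X](mulr0 (expR (rnorm w))).
  by apply: cvgM; [exact: cvg_cst|exact: cvg_exp_coeff].
Unshelve. all: by end_near. Qed.

Lemma sum_exp_le (x : R) N : 0 <= x -> \sum_(0 <= k < N) x ^+ k / k`!%:R <= expR x.
Proof.
move=> x0; apply: (nondecreasing_cvgn_le _ (@is_cvg_series_exp_coeff R x)).
by apply: nondecreasing_series => k _ _; exact: exp_coeff_ge0.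
Qed.

End ExpSeries.

(** * Second-order jets: a substitute for Cauchy estimates *)

Section Jets.
Variable R : realType.
Local Notation C := R[i].
Variable V : normedModType C.
Implicit Types (f g L : V -> C) (M N B : R).

Definition clinear L := forall (a : C) (u v : V), L (a *: u + v) = a * L u + L v.

(** A jet of size M on the unit ball: value at 0, linear part and quadratic
    remainder are bounded by a, b, c with a + b + c <= M. The least such M
    is a Banach algebra norm, and every function with a jet is differentiable at
    0. A normally convergent series of functions with jets therefore has a
    differentiable sum, which replaces the theorem of Weierstrass on limits of
    holomorphic functions; no contour integral is needed. *)
Definition jet g L M := clinear L /\ exists a b c : R,
  [/\ 0 <= b, 0 <= c & a + b + c <= M] /\
  [/\ rnorm (g 0) <= a,
      (forall h, rnorm (L h) <= b * rnorm h) &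
      (forall h, rnorm h <= 1 -> rnorm (g h - g 0 - L h) <= c * rnorm h ^+ 2)].

Definition has_jet g M := exists L, jet g L M.

Lemma jet_le M M' g L : M <= M' -> jet g L M -> jet g L M'.
Proof.
move=> MM' [Ll [a [b [c [[? ? ?] H]]]]]; split=> //; exists a, b, c; split=> //; split=> //.
exact: le_trans MM'.
Qed.

Lemma jet_ext g g' L M : (forall h, rnorm h <= 1 -> g h = g' h) -> jet g L M -> jet g' L M.
Proof.
move=> gg' [Ll [a [b [c [H [ga ? gc]]]]]]; split=> //; exists a, b, c.
have g0 : g 0 = g' 0 by rewrite gg'// rnorm0.
by split=> //; split=> //; [rewrite -g0|move=> h h1; rewrite -gg'// -g0 gc].
Qed.

Lemma jet_ge0 g L M : jet g L M -> 0 <= M.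
Proof.
move=> [_ [a [b [c [[b0 c0 abc] [ga _ _]]]]]].
by apply: le_trans abc; rewrite !addr_ge0// (le_trans (rnorm_ge0 _) ga).
Qed.

Lemma jet_bound g L M h : rnorm h <= 1 -> jet g L M -> rnorm (g h) <= M.
Proof.
move=> h1 [_ [a [b [c [[b0 c0 abc] [ga gb gc]]]]]].
have -> : g h = g 0 + L h + (g h - g 0 - L h) by ring.
apply: le_trans abc; rewrite (le_trans (ler_rnormD _ _))// lerD//.
  rewrite (le_trans (ler_rnormD _ _))// lerD// (le_trans (gb _))//.
  by rewrite ler_piMr.
by rewrite (le_trans (gc _ h1))// ler_piMr// exprn_ile1 ?rnorm_ge0.
Qed.

Lemma clinear0 : clinear (fun=> 0).
Proof. by move=> a u v; rewrite mulr0 addr0. Qed.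

Lemma clinear_at0 L : clinear L -> L 0 = 0.
Proof. by move=> Ll; have := Ll (-1) 0 0; rewrite scaler0 addr0 mulN1r addNr. Qed.

Lemma jet_cst c : jet (fun=> c) (fun=> 0) (rnorm c).
Proof.
split; first exact: clinear0.
exists (rnorm c), 0, 0; split; split=> //; first by rewrite !addr0.
  by move=> h; rewrite rnorm0 mul0r.
by move=> h; rewrite !subrr rnorm0 mul0r.
Qed.

Lemma jet_lin L b : clinear L -> 0 <= b -> (forall h, rnorm (L h) <= b * rnorm h) -> jet L L b.
Proof.
move=> Ll b0 Lb; split=> //; exists 0, b, 0; have L0 := clinear_at0 Ll.
split; split=> //; first by rewrite addr0 add0r.
- by rewrite L0 rnorm0.
- move=> h _; have -> : L h - L 0 - L h = 0 by rewrite L0; ring.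
  by rewrite rnorm0 mul0r.
Qed.

Lemma jetD f Lf M g Lg N : jet f Lf M -> jet g Lg N ->
  jet (fun h => f h + g h) (fun h => Lf h + Lg h) (M + N).
Proof.
move=> [Lfl [a [b [c [[b0 c0 abc] [fa fb fc]]]]]].
move=> [Lgl [a' [b' [c' [[b0' c0' abc'] [ga gb gc]]]]]].
split; first by move=> x u v; rewrite Lfl Lgl; ring.
exists (a + a'), (b + b'), (c + c'); split; split; rewrite ?addr_ge0//.
- lra.
- by rewrite (le_trans (ler_rnormD _ _))// lerD.
- by move=> h; rewrite (le_trans (ler_rnormD _ _))// mulrDl lerD.
- move=> h h1.
  have -> : f h + g h - (f 0 + g 0) - (Lf h + Lg h) =
     (f h - f 0 - Lf h) + (g h - g 0 - Lg h) by ring.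
  by rewrite (le_trans (ler_rnormD _ _))// mulrDl lerD ?fc ?gc.
Qed.

(** Submultiplicativity: on the unit ball the third and fourth powers of the norm
    are dominated by its square, so that all products of remainders are
    quadratic. *)
Lemma jetM f Lf M g Lg N : jet f Lf M -> jet g Lg N ->
  jet (fun h => f h * g h) (fun h => f 0 * Lg h + g 0 * Lf h) (M * N).
Proof.
move=> [Lfl [a [b [c [[b0 c0 abc] [fa fb fc]]]]]].
move=> [Lgl [a' [b' [c' [[b0' c0' abc'] [ga gb gc]]]]]].
have a0 : 0 <= a := le_trans (rnorm_ge0 _) fa.
have a0' : 0 <= a' := le_trans (rnorm_ge0 _) ga.
split; first by move=> x u v; rewrite Lfl Lgl; ring.
exists (a * a'), (a * b' + a' * b), (a * c' + a' * c + b * b' + b * c' + c * b' + c * c').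
split; split; rewrite ?addr_ge0 ?mulr_ge0//.
- have : (a + b + c) * (a' + b' + c') <= M * N by rewrite ler_pM ?addr_ge0.
  by apply: le_trans; rewrite le_eqVlt; apply/orP; left; apply/eqP; ring.
- by rewrite rnormM ler_pM ?rnorm_ge0.
- move=> h; rewrite (le_trans (ler_rnormD _ _))// mulrDl lerD// rnormM -mulrA ler_pM ?rnorm_ge0//.
- move=> h h1; set x := rnorm h; have x0 : 0 <= x := rnorm_ge0 _.
  set rf := f h - f 0 - Lf h; set rg := g h - g 0 - Lg h.
  have -> : f h * g h - f 0 * g 0 - (f 0 * Lg h + g 0 * Lf h) =
    f 0 * rg + g 0 * rf + Lf h * Lg h + Lf h * rg + rf * Lg h + rf * rg.
    by rewrite /rf /rg; ring.
  have rfc : rnorm rf <= c * x ^+ 2 := fc _ h1.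
  have rgc : rnorm rg <= c' * x ^+ 2 := gc _ h1.
  have x2 : 0 <= x ^+ 2 by rewrite exprn_ge0.
  have shrink (y : R) : 0 <= y -> y * x ^+ 2 * x <= y * x ^+ 2.
    by move=> y0; rewrite ler_piMr// mulr_ge0.
  have -> : (a * c' + a' * c + b * b' + b * c' + c * b' + c * c') * x ^+ 2 =
    a * c' * x ^+ 2 + a' * c * x ^+ 2 + b * b' * x ^+ 2 + b * c' * x ^+ 2
    + c * b' * x ^+ 2 + c * c' * x ^+ 2 by ring.
  rewrite (le_trans (ler_rnormD _ _))// lerD//; last first.
    rewrite rnormM (@le_trans _ _ ((c * x ^+ 2) * (c' * x ^+ 2)))//.
      by rewrite ler_pM ?rnorm_ge0.
    have -> : c * x ^+ 2 * (c' * x ^+ 2) = c * c' * x ^+ 2 * x * x by ring.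
    rewrite (@le_trans _ _ (c * c' * x ^+ 2 * x))// ?shrink ?mulr_ge0//.
    by rewrite ler_piMr// !mulr_ge0.
  rewrite (le_trans (ler_rnormD _ _))// lerD//; last first.
    rewrite rnormM (@le_trans _ _ ((c * x ^+ 2) * (b' * x)))//.
      by rewrite ler_pM ?rnorm_ge0.
    have -> : c * x ^+ 2 * (b' * x) = c * b' * x ^+ 2 * x by ring.
    by rewrite shrink ?mulr_ge0.
  rewrite (le_trans (ler_rnormD _ _))// lerD//; last first.
    rewrite rnormM (@le_trans _ _ ((b * x) * (c' * x ^+ 2)))//.
      by rewrite ler_pM ?rnorm_ge0.
    have -> : b * x * (c' * x ^+ 2) = b * c' * x ^+ 2 * x by ring.
    by rewrite shrink ?mulr_ge0.
  rewrite (le_trans (ler_rnormD _ _))// lerD//; last first.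
    have -> : b * b' * x ^+ 2 = (b * x) * (b' * x) by ring.
    by rewrite rnormM ler_pM ?rnorm_ge0.
  by rewrite (le_trans (ler_rnormD _ _))// lerD// rnormM -mulrA ler_pM ?rnorm_ge0.
Qed.

(** The three bounds of each term have convergent sums, and the defining
    inequalities pass to the limit of the partial sums. *)
Lemma jet_series (g L : nat -> V -> C) (M : nat -> R) (S : V -> C) B :
  (forall k, jet (g k) (L k) (M k)) -> (forall m, \sum_(0 <= k < m) M k <= B) ->
  (forall h, rnorm h <= 1 -> series (fun k => g k h) @ \oo --> S h) ->
  jet S (fun h => limn (series (fun k => L k h))) B /\
  (forall h, cvgn (series (fun k => L k h))).
Proof.
move=> gL MB gS.
have Ll k : clinear (L k) by case: (gL k).
have /choice[abc] : forall k, exists p : R * R * R,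
  [/\ [/\ 0 <= p.1.2, 0 <= p.2, p.1.1 + p.1.2 + p.2 <= M k &
      rnorm (g k 0) <= p.1.1],
      (forall h, rnorm (L k h) <= p.1.2 * rnorm h) &
      (forall h, rnorm h <= 1 -> rnorm (g k h - g k 0 - L k h) <= p.2 * rnorm h ^+ 2)].
  by move=> k; have [_ [a [b [c [[? ? ?] [? ? ?]]]]]] := gL k; exists (a, b, c).
pose a k := (abc k).1.1; pose b k := (abc k).1.2; pose c k := (abc k).2.
move=> H.
have a0 k : 0 <= a k by have [[_ _ _ h] _ _] := H k; exact: le_trans (rnorm_ge0 _) h.
have b0 k : 0 <= b k by have [[]] := H k.
have c0 k : 0 <= c k by have [[]] := H k.
have abcM k : a k + b k + c k <= M k by have [[]] := H k.
have sumB m : \sum_(0 <= k < m) a k + \sum_(0 <= k < m) b k + \sum_(0 <= k < m) c k <= B.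
  by apply: le_trans (MB m); rewrite -!big_split /=; apply: ler_sum.
have ncvg (u : nat -> R) : (forall k, 0 <= u k) -> (forall m, \sum_(0 <= k < m) u k <= B) ->
    cvgn (series u).
  move=> u0 uB; apply: nondecreasing_is_cvgn; first by apply: nondecreasing_series.
  by exists B => _ [m _ <-]; exact: uB.
have sge0 (u : nat -> R) m : (forall k, 0 <= u k) -> 0 <= \sum_(0 <= k < m) u k.
  by move=> u0; apply: sumr_ge0.
have ca : cvgn (series a).
  by apply: ncvg => // m; have := sumB m; have := sge0 _ m b0; have := sge0 _ m c0; lra.
have cb : cvgn (series b).
  by apply: ncvg => // m; have := sumB m; have := sge0 _ m a0; have := sge0 _ m c0; lra.
have cc : cvgn (series c).
  by apply: ncvg => // m; have := sumB m; have := sge0 _ m a0; have := sge0 _ m b0; lra.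
have sle (u : nat -> R) m : (forall k, 0 <= u k) -> cvgn (series u) ->
    \sum_(0 <= k < m) u k <= limn (series u).
  by move=> u0 cu; apply: (nondecreasing_cvgn_le _ cu); apply: nondecreasing_series.
have cL h : cvgn (series (fun k => L k h)).
  apply: (@series_summable _ _ (fun k => b k * rnorm h) (limn (series b) * rnorm h)).
    by move=> k; have [] := H k.
  by move=> m; rewrite -mulr_suml ler_wpM2r ?rnorm_ge0// sle.
split=> //; split.
  move=> x u v.
  apply: cvg_lim; first exact: norm_hausdorff.
  have -> : series (fun k => L k (x *: u + v)) =
      (fun m => x * series (fun k => L k u) m + series (fun k => L k v) m).
    apply/funext => m; rewrite /series/= mulr_sumr -big_split/=.
    by apply: eq_bigr => k _; rewrite Ll.
  apply: cvgD; last exact: cL.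
  by apply: cvgM; [exact: cvg_cst|exact: cL].
exists (limn (series a)), (limn (series b)), (limn (series c)); split; split.
- by apply: le_trans (sle b 0%N b0 cb); rewrite big_geq.
- by apply: le_trans (sle c 0%N c0 cc); rewrite big_geq.
- rewrite -!limD//; last exact: is_cvgD.
  apply: limr_le; first by apply: is_cvgD => //; exact: is_cvgD.
  by near=> m; exact: sumB.
- apply: (cvg_rnorm_le (gS 0 _)); rewrite ?rnorm0// => m.
  rewrite (le_trans (ler_rnorm_sum _ _))//; apply: le_trans (sle a m a0 ca).
  by apply: ler_sum => k _; have [[]] := H k.
- move=> h; apply: (cvg_rnorm_le (cL h)) => m.
  rewrite (le_trans (ler_rnorm_sum _ _))//.
  apply: le_trans (ler_wpM2r (rnorm_ge0 h) (sle b m b0 cb)).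
  by rewrite mulr_suml; apply: ler_sum => k _; have [] := H k.
- move=> h h1.
  apply: (@cvg_rnorm_le _ _ (fun m => series (fun k => g k h) m - series (fun k => g k 0) m
     - series (fun k => L k h) m)).
    apply: cvgB; last exact: cL.
    by apply: cvgB; apply: gS => //; rewrite rnorm0.
  move=> m; rewrite /series /= -!sumrB.
  rewrite (le_trans (ler_rnorm_sum _ _))//.
  apply: le_trans (ler_wpM2r (exprn_ge0 2 (rnorm_ge0 h)) (sle c m c0 cc)).
  by rewrite mulr_suml; apply: ler_sum => k _; have [_ _] := H k; apply.
Unshelve. all: by end_near. Qed.

Lemma quad_differentiable (f : V -> C) (z : V) (L : V -> C) (b c rho : R) :
  clinear L -> 0 < rho -> 0 <= b -> 0 <= c -> (forall h, rnorm (L h) <= b * rnorm h) ->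
  (forall h, rnorm h <= rho -> rnorm (f (z + h) - f z - L h) <= c * rnorm h ^+ 2) ->
  differentiable f z /\ forall v, is_derive z v f (L v).
Proof.
move=> Ll rho0 b0 c0 Lb Lc.
pose LM := GRing.isLinear.Build C V C _ L Ll.
pose LL : {linear V -> C} := HB.pack L LM.
have LLc : continuous LL.
  move=> x; apply/cvg_rnormP.
  apply: (@squeeze_cvgr _ _ _ _ (cst 0) (fun y => b * rnorm (y - x)) _ _ 0).
  - near=> y; rewrite rnorm_ge0/=.
    by have -> : LL y - LL x = L (y - x) by rewrite -[L]/(LL : V -> C) raddfB.
  - exact: cvg_cst.
  - rewrite -[X in _ --> X](mulr0 b); apply: cvgM; first exact: cvg_cst.
    by apply/cvg_rnormP; exact: cvg_id.
have fLL : f \o shift z = cst (f z) + LL +o_ 0 id.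
  apply/eqaddoP => e e0.
  have er : e = (complex.Re e)%:C by rewrite RRe_real// ger0_real// ltW.
  have er0 : 0 < complex.Re e by rewrite -ltcR -er.
  have d0 : 0 < Num.min rho (complex.Re e / (c + 1)).
    by rewrite lt_min rho0 divr_gt0// ltr_wpDl.
  have d0C : (0 : C) < (Num.min rho (complex.Re e / (c + 1)))%:C by rewrite ltcR.
  near=> h.
  have : `|h| <= (Num.min rho (complex.Re e / (c + 1)))%:C.
    by near: h; exact: nbhs0_le.
  rewrite rnormE lecR le_min => /andP[h1 h2].
  rewrite rnormE er -rmorphM lecR.
  have -> : (f \o shift z - (cst (f z) + LL)) h = f (z + h) - f z - L h.
    by rewrite !fctE /= addrC (addrC h); ring.
  apply: (le_trans (Lc h h1)).
  rewrite expr2 mulrA ler_wpM2r ?rnorm_ge0//.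
  move: h2; rewrite ler_pdivlMr ?ltr_wpDl// => h2; apply: le_trans h2.
  by rewrite mulrC ler_wpM2l ?rnorm_ge0// lerDl.
have dE : 'd f z = LL :> (V -> C) := diff_unique LLc fLL.
have df : differentiable f z by apply/diff_locallyP; rewrite dE.
split=> // v; apply: DeriveDef; first exact: diff_derivable.
by rewrite deriveE// dE.
Unshelve. all: by end_near. Qed.

(** Jets are used on small balls, rescaled to radius 1 by rho. *)
Lemma jet_differentiable (f : V -> C) (z : V) (L : V -> C) (rho M : R) :
  0 < rho -> jet (fun h => f (z + rho%:C *: h)) L M ->
  differentiable f z /\ forall v, is_derive z v f (rho%:C^-1 * L v).
Proof.
move=> rho0 [Ll [a [b [c [[b0 c0 abc] [fa fb fc]]]]]].
have rn0 : rho%:C != 0 :> C by rewrite -(rmorph0 (real_complex R)) (inj_eq (@complexI _)) gt_eqF.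
apply: (@quad_differentiable _ _ (fun v => rho%:C^-1 * L v) (rho^-1 * b) (c / rho ^+ 2) rho) => //.
- by move=> x u v; rewrite Ll; ring.
- by rewrite mulr_ge0// invr_ge0 ltW.
- by rewrite divr_ge0// exprn_ge0// ltW.
- move=> h; rewrite rnormM rnormV rnorm_real gtr0_norm// -mulrA ler_wpM2l//.
  by rewrite invr_ge0 ltW.
- move=> h hr.
  have nh : rnorm (rho%:C^-1 *: h) = rnorm h / rho.
    by rewrite rnormZ rnormV rnorm_real gtr0_norm// mulrC.
  have := fc (rho%:C^-1 *: h); rewrite nh ler_pdivrMr// mul1r => /(_ hr).
  rewrite scaler0 addr0 scalerA divff// scale1r.
  have -> : L (rho%:C^-1 *: h) = rho%:C^-1 * L h.
    by have := Ll rho%:C^-1 h 0; rewrite (clinear_at0 Ll) !addr0.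
  by rewrite expr_div_n mulrA mulrAC.
Qed.

Lemma has_jet_le M M' g : M <= M' -> has_jet g M -> has_jet g M'.
Proof. by move=> MM' [L j]; exists L; exact: jet_le j. Qed.

Lemma has_jet_ext g g' M : (forall h, rnorm h <= 1 -> g h = g' h) -> has_jet g M -> has_jet g' M.
Proof. by move=> gg [L j]; exists L; exact: jet_ext j. Qed.

Lemma has_jet_ge0 g M : has_jet g M -> 0 <= M.
Proof. by move=> [L j]; exact: jet_ge0 j. Qed.

Lemma has_jet_bound g M h : rnorm h <= 1 -> has_jet g M -> rnorm (g h) <= M.
Proof. by move=> h1 [L j]; exact: jet_bound j. Qed.

Lemma has_jet_cst (c : C) : has_jet (fun=> c) (rnorm c).
Proof. by eexists; exact: jet_cst. Qed.

Lemma has_jetD f M g N : has_jet f M -> has_jet g N -> has_jet (fun h => f h + g h) (M + N).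
Proof. by move=> [L j] [L' j']; eexists; exact: jetD j j'. Qed.

Lemma has_jetM f M g N : has_jet f M -> has_jet g N -> has_jet (fun h => f h * g h) (M * N).
Proof. by move=> [L j] [L' j']; eexists; exact: jetM j j'. Qed.

Lemma has_jetZ (c : C) g N : has_jet g N -> has_jet (fun h => c * g h) (rnorm c * N).
Proof. exact: has_jetM (has_jet_cst c). Qed.

Lemma has_jetN g N : has_jet g N -> has_jet (fun h => - g h) N.
Proof.
move=> /(has_jetZ (-1)); rewrite rnormN rnorm1 mul1r.
by apply: has_jet_ext => h _; rewrite mulN1r.
Qed.

Lemma has_jetB f M g N : has_jet f M -> has_jet g N -> has_jet (fun h => f h - g h) (M + N).
Proof. by move=> j /has_jetN; exact: has_jetD. Qed.

Lemma has_jetX g N k : has_jet g N -> has_jet (fun h => g h ^+ k) (N ^+ k).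
Proof.
move=> j; elim: k => [|k IH].
  by rewrite expr0 -rnorm1; exact: has_jet_cst.
rewrite exprS; apply: has_jet_ext (has_jetM j IH) => h _.
by rewrite exprS.
Qed.

Lemma has_jet_prod (I : Type) (r : seq I) (P : pred I) (g : I -> V -> C) (M : I -> R) :
  (forall i, P i -> has_jet (g i) (M i)) ->
  has_jet (fun h => \prod_(i <- r | P i) g i h) (\prod_(i <- r | P i) M i).
Proof.
move=> gM; elim: r => [|i r IH].
  rewrite big_nil -rnorm1; apply: has_jet_ext (has_jet_cst 1) => h _.
  by rewrite big_nil.
rewrite big_cons; case: ifPn => Pi.
  apply: has_jet_ext (has_jetM (gM i Pi) IH) => h _.
  by rewrite big_cons Pi.
by apply: has_jet_ext IH => h _; rewrite big_cons (negPf Pi).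
Qed.

Lemma has_jet_series (g : nat -> V -> C) (M : nat -> R) (S : V -> C) B :
  (forall k, has_jet (g k) (M k)) -> (forall m, \sum_(0 <= k < m) M k <= B) ->
  (forall h, rnorm h <= 1 -> series (fun k => g k h) @ \oo --> S h) ->
  has_jet S B.
Proof.
move=> /choice[L gL] MB gS; eexists.
by have [j _] := jet_series gL MB gS; exact: j.
Qed.

(** The remainder is the tail of the exponential series, which is a series of
    jets with sum at most M ^ p exp M because (k + p)! >= k!. *)
Lemma has_jet_exp_poly (f : V -> C) M p : has_jet f M ->
  has_jet (fun h => expC (f h) - exp_poly p (f h)) (M ^+ p * expR M).
Proof.
move=> j; have M0 := has_jet_ge0 j.
apply: (@has_jet_series (fun k h => f h ^+ (k + p) / (k + p)`!%:R)
   (fun k => M ^+ p * (M ^+ k / k`!%:R))).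
- move=> k; have fk := has_jetX (k + p) j.
  have := has_jetZ ((k + p)`!%:R^-1) fk.
  rewrite rnormV rnorm_natr => /(@has_jet_le _ (M ^+ p * (M ^+ k / k`!%:R))) h.
  apply: has_jet_ext (h _) => [x _|]; first by rewrite mulrC.
  rewrite mulrC exprD mulrA [M ^+ k * _]mulrC ler_wpM2l ?mulr_ge0 ?exprn_ge0//.
  rewrite lef_pV2 ?posrE ?ltr0n ?fact_gt0// ler_nat.
  by rewrite leq_fact ?leq_addr.
- move=> m; rewrite -mulr_sumr ler_wpM2l ?exprn_ge0//; exact: sum_exp_le.
- move=> h h1.
  have -> : series (fun k => f h ^+ (k + p) / (k + p)`!%:R) =
     (fun m => series (fun k => f h ^+ k / k`!%:R) (m + p)%N - exp_poly p (f h)).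
    apply/funext => m; rewrite /series/= /exp_poly.
    rewrite [in RHS](big_cat_nat (n := p))/= ?leq_addl//. rewrite addrAC subrr add0r.
    by rewrite -[in RHS](add0n p) big_addn addnK.
  apply: cvgB; last exact: cvg_cst.
  have := @expC_series R (f h); rewrite -(cvg_shiftn p); exact.
Qed.

Lemma has_jet_exp (f : V -> C) M : has_jet f M -> has_jet (fun h => expC (f h)) (expR M).
Proof.
move=> /(has_jet_exp_poly 0); rewrite expr0 mul1r.
by apply: has_jet_ext => h _; rewrite /exp_poly big_geq// subr0.
Qed.

(** Neumann series. *)
Lemma has_jet_inv (A : C) (f : V -> C) M : has_jet f M -> M < rnorm A ->
  has_jet (fun h => (A + f h)^-1) (rnorm A - M)^-1.
Proof.
move=> j MA; have M0 := has_jet_ge0 j.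
have A0 : 0 < rnorm A := le_lt_trans M0 MA.
have An0 : A != 0 by rewrite -rnorm_eq0 gt_eqF.
pose q := M / rnorm A; have q0 : 0 <= q by rewrite divr_ge0// ltW.
have q1 : q < 1 by rewrite ltr_pdivrMr// mul1r.
apply: (@has_jet_series (fun k h => A^-1 * (- A^-1 * f h) ^+ k)
   (fun k => (rnorm A)^-1 * q ^+ k)).
- move=> k; rewrite -rnormV; apply: has_jetZ; apply: has_jetX.
  by rewrite /q mulrC -rnormV -(rnormN A^-1); exact: has_jetZ.
- move=> m; rewrite -mulr_sumr.
  have -> : (rnorm A - M)^-1 = (rnorm A)^-1 * (1 - q)^-1.
    by rewrite -invfM mulrBr mulr1 /q mulrCA divff ?mulr1 ?gt_eqF.
  rewrite ler_wpM2l ?invr_ge0 ?rnorm_ge0//.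
  rewrite -[leRHS]mul1r; case: (ltrP 0 q) => q00.
    have := geometric_le_lim m ler01 q00; rewrite ger0_norm// => /(_ q1).
    rewrite /series /geometric /=; apply: le_trans.
    by rewrite le_eqVlt; apply/orP; left; apply/eqP; apply: eq_bigr => i _; rewrite mul1r.
  have -> : q = 0 by apply/le_anti; rewrite q0 q00.
  rewrite subr0 invr1 mulr1; case: m => [|m]; first by rewrite big_geq.
  by rewrite big_nat_recl// expr0 big1 ?addr0// => i _; rewrite exprS mul0r.
- move=> h h1; set w := - A^-1 * f h.
  have w1 : rnorm w < 1.
    rewrite rnormM rnormN rnormV mulrC ltr_pdivrMr// mul1r.
    exact: le_lt_trans (has_jet_bound h1 j) MA.
  have wn1 : w != 1 by apply/eqP => we; move: w1; rewrite we rnorm1 ltxx.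
  have -> : (A + f h)^-1 = A^-1 * (1 - 0) / (1 - w).
    by rewrite subr0 mulr1 /w -invfM mulrBr mulNr mulrN mulr1 opprK mulrA divff// mul1r.
  rewrite (_ : series _ = series (geometric A^-1 w)) // geometric_seriesE//=.
  apply: cvgM; last exact: cvg_cst.
  apply: cvgM; first exact: cvg_cst.
  apply: cvgB; first exact: cvg_cst.
  apply/cvg_rnormP; rewrite (_ : (fun _ => _) = geometric 1 (rnorm w)); last first.
    by apply/funext => k; rewrite subr0 rnormX /= mul1r.
  by apply: cvg_geometric; rewrite ger0_norm ?rnorm_ge0.
Qed.

End Jets.

(** * The Gauss product *)

Section GammaFunction.
Variable R : realType.
Local Notation C := R[i].

Lemma pos_lower_bound (a : nat -> R) N0 :
  (forall k, 0 < a k) -> (forall k, (N0 <= k)%N -> 1 <= a k) ->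
  exists2 d : R, 0 < d & forall k, d <= a k.
Proof.
move=> a0 a1.
suff [d d0 dk] : exists2 d : R, 0 < d & forall k, (k < N0)%N -> d <= a k.
  exists (Num.min d 1); first by rewrite lt_min d0 ltr01.
  move=> k; rewrite ge_min; case: (ltnP k N0) => [/dk->//|/a1 ->]; exact: orbT.
elim: N0 {a1} => [|N [d d0 dk]]; first by exists 1.
exists (Num.min d (a N)); first by rewrite lt_min d0 a0.
move=> k; rewrite ltnS leq_eqVlt ge_min => /predU1P[->|/dk ->//].
by rewrite lexx orbT.
Qed.

(** The sequence whose limit defines Gamma. *)
Definition gauss_seq (N : nat) (s : C) : C :=
  N`!%:R * expC (s * (ln (N%:R : R))%:C) / \prod_(k < N.+1) (s + k%:R).

Definition nonpole (s : C) := forall k : nat, s + k%:R != 0.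

Lemma nonpole_dist (s : C) : nonpole s ->
  exists2 d : R, 0 < d & forall k : nat, d <= rnorm (s + k%:R).
Proof.
move=> sn; apply: (@pos_lower_bound _ (Num.truncn (rnorm s + 1)).+1).
  by move=> k; rewrite lt_neqAle rnorm_ge0 eq_sym rnorm_eq0 sn.
move=> k Nk; have := ler_rnormB (k%:R : C) (- s); rewrite opprK rnormN rnorm_natr addrC.
have : rnorm s + 1 < k%:R.
  by apply: lt_le_trans (truncnS_gt _) _; rewrite ler_nat.
by rewrite [k%:R + s]addrC; lra.
Qed.

(** Successive terms differ by the factor 1 + u with u = O(1 / k ^ 2). The three
    groups of summands of u are arranged so that each is visibly of that order,
    lam being 1 / k up to O(1 / k ^ 2). *)
Lemma gauss_step (k : nat) (s : C) : nonpole s ->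
  let lam := (ln (k.+2%:R : R) - ln (k.+1%:R : R))%:C in
  gauss_seq k.+2 s = gauss_seq k.+1 s * (1 + ((expC (lam * s) - exp_poly 2 (lam * s))
    + ((lam - k.+2%:R^-1) * s + s ^+ 2 * (k.+2%:R + s)^-1 / k.+2%:R)
    - s * (k.+2%:R + s)^-1 * (expC (lam * s) - exp_poly 1 (lam * s)))).
Proof.
move=> sn lam.
have -> : 1 + ((expC (lam * s) - exp_poly 2 (lam * s))
    + ((lam - k.+2%:R^-1) * s + s ^+ 2 * (k.+2%:R + s)^-1 / k.+2%:R)
    - s * (k.+2%:R + s)^-1 * (expC (lam * s) - exp_poly 1 (lam * s))) =
   k.+2%:R / (k.+2%:R + s) * expC (lam * s).
  rewrite /exp_poly !big_nat_recl// !big_geq// expr0 expr1 fact0 divr1 addr0.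
  have h2 : (k.+2%:R : C) != 0 by rewrite pnatr_eq0.
  have h1 : k.+2%:R + s != 0 by rewrite addrC sn.
  rewrite (_ : 1`! = 1%N)// divr1; move: (k.+2%:R) h1 h2 => x h1 h2.
  by field; rewrite h1 h2.
rewrite /gauss_seq big_ord_recr/= [k.+2`!]factS natrM.
have -> : expC (s * (ln k.+2%:R : R)%:C) = expC (s * (ln k.+1%:R : R)%:C) * expC (lam * s).
  by rewrite -expCD; congr expC; rewrite /lam rmorphB; ring.
by rewrite invfM (addrC s k.+2%:R); ring.
Qed.

(** The products of the factors 1 + u stay bounded in jet norm because the jet
    norms of the u are summable, hence the increments of the Gauss sequence are
    summable too, and Gamma is their sum. *)
Lemma gauss_jet (s0 : C) : nonpole s0 ->
  exists2 rho : R, 0 < rho & exists2 M : R,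
    has_jet (fun h : C => Gamma (s0 + rho%:C * h)) M &
    forall h : C, rnorm h <= 1 -> gauss_seq ^~ (s0 + rho%:C * h) @ \oo --> Gamma (s0 + rho%:C * h).
Proof.
move=> sn; have [d d0 dk] := nonpole_dist sn.
pose rho := d / 2; have rho0 : 0 < rho by rewrite divr_gt0.
exists rho => //.
pose f (h : C) := s0 + rho%:C * h.
have linj : has_jet (fun h : C => rho%:C * h) rho.
  eexists; apply: jet_lin; last first.
  - by move=> h; rewrite rnormM rnorm_real gtr0_norm.
  - exact: ltW.
  - by move=> a u v; rewrite /GRing.scale /=; ring.
pose sig := rnorm s0 + rho.
have fj : has_jet f sig by apply: has_jetD linj; exact: has_jet_cst.
have sig0 : 0 <= sig := has_jet_ge0 fj.
have invj k : has_jet (fun h => (k%:R + f h)^-1) (rnorm (s0 + k%:R) - rho)^-1.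
  apply: has_jet_ext (@has_jet_inv _ _ (s0 + k%:R) _ _ linj _).
    by move=> h _; rewrite /f; congr (_ ^-1); ring.
  by apply: lt_le_trans (dk k); rewrite /rho; lra.
(* With D = |s0 + k| >= 2 rho one has k <= D + |s0| <= C0 (D - rho). *)
pose C0 := 2 + rnorm s0 / rho.
have C00 : 0 <= C0 by rewrite addr_ge0// divr_ge0 ?rnorm_ge0// ltW.
have invj' k : has_jet (fun h => (k.+1%:R + f h)^-1) (C0 / k.+1%:R).
  apply: has_jet_le (invj k.+1).
  set D := rnorm _; have D2 : 2 * rho <= D by rewrite /rho; have := dk k.+1; rewrite -/D; lra.
  have kD : k.+1%:R <= D + rnorm s0.
    have := ler_rnormD (s0 + k.+1%:R) (- s0); rewrite rnormN -/D.
    by rewrite addrAC subrr add0r rnorm_natr.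
  rewrite ler_pdivlMr ?ltr0Sn// mulrC ler_pdivrMr; last lra.
  apply: (le_trans kD); rewrite /C0 mulrDl lerD//; first lra.
  by rewrite -mulrA ler_peMr ?rnorm_ge0// mulrC ler_pdivlMr// mul1r; lra.
pose lam k := ln (k.+2%:R : R) - ln (k.+1%:R : R).
pose u k h := ((expC ((lam k)%:C * f h) - exp_poly 2 ((lam k)%:C * f h))
    + (((lam k)%:C - k.+2%:R^-1) * f h + f h ^+ 2 * (k.+2%:R + f h)^-1 / k.+2%:R)
    - f h * (k.+2%:R + f h)^-1 * (expC ((lam k)%:C * f h) - exp_poly 1 ((lam k)%:C * f h))).
(* Sum of the bounds of the three groups of summands, times (k + 2) ^ 2. *)
pose K := 4 * sig ^+ 2 * expR sig + 2 * sig + sig ^+ 2 * C0 + 2 * sig ^+ 2 * C0 * expR sig.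
have lamE k : [/\ 0 <= lam k, lam k <= 2 / k.+2%:R & `|lam k - k.+2%:R^-1| <= 2 / k.+2%:R ^+ 2].
  have k2 : (k.+2%:R : R) = k.+1%:R + 1 by rewrite -natr1.
  have k1 : 1 <= (k.+1%:R : R) by rewrite ler1n.
  have k10 : 0 < (k.+1%:R : R) by rewrite ltr0Sn.
  have k20 : 0 < (k.+2%:R : R) by rewrite ltr0Sn.
  have up : lam k <= k.+1%:R^-1.
    rewrite /lam -ln_div ?posrE//.
    have -> : k.+2%:R / k.+1%:R = 1 + k.+1%:R^-1 :> R.
      by rewrite k2 mulrDl divff ?mul1r ?gt_eqF.
    by apply: le_ln1Dx; rewrite (@lt_le_trans _ _ 0)// ?invr_ge0 ?ler0n// oppr_lt0 ltr01.
  have low : k.+2%:R^-1 <= lam k.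
    rewrite -lerN2 /lam opprB -ln_div ?posrE//.
    have -> : k.+1%:R / k.+2%:R = 1 + - k.+2%:R^-1 :> R.
      by rewrite -[X in _ = X + _](@divff _ (k.+2%:R : R)) ?gt_eqF// k2; ring.
    by apply: le_ln1Dx; rewrite ltrN2 invf_lt1// ltr1n.
  have ab : k.+1%:R^-1 <= 2 / k.+2%:R :> R.
    by rewrite ler_pdivlMr// mulrC ler_pdivrMr// k2; lra.
  split.
  - by apply: le_trans low; rewrite invr_ge0 ler0n.
  - exact: le_trans ab.
  - rewrite ger0_norm ?subr_ge0//; apply: (@le_trans _ _ (k.+1%:R^-1 - k.+2%:R^-1)).
      exact: lerB.
    have -> : k.+1%:R^-1 - k.+2%:R^-1 = k.+1%:R^-1 / k.+2%:R :> R.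
      by rewrite k2; field; rewrite gt_eqF//= -k2 gt_eqF.
    by rewrite expr2 invfM mulrA ler_wpM2r// invr_ge0 ler0n.
have uj k : has_jet (u k) (K / k.+2%:R ^+ 2).
  have [l0 l2 lx] := lamE k.
  set x := (k.+2%:R : R)^-1 in l2 lx; have x0 : 0 <= x by rewrite invr_ge0 ler0n.
  have lfj : has_jet (fun h => (lam k)%:C * f h) (lam k * sig).
    by have := has_jetZ (lam k)%:C fj; rewrite rnorm_real ger0_norm.
  have j1 := has_jet_exp_poly 2 lfj; have j2 := has_jet_exp_poly 1 lfj.
  have j3 := has_jetZ ((lam k)%:C - k.+2%:R^-1) fj.
  have j4 := has_jetZ k.+2%:R^-1 (has_jetM (has_jetX 2 fj) (invj' k.+1)).
  have j5 := has_jetM (has_jetM fj (invj' k.+1)) j2.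
  have := has_jetB (has_jetD j1 (has_jetD j3 j4)) j5.
  move=> /(@has_jet_le _ _ _ (K / k.+2%:R ^+ 2)) J.
  apply: has_jet_ext (J _) => [h _|]; first by rewrite /u; ring.
  have -> : rnorm ((lam k)%:C - (k.+2%:R)^-1) = `|lam k - x|.
    have -> : (k.+2%:R : C)^-1 = x%:C by rewrite /x fmorphV rmorph_nat.
    by rewrite -rmorphB rnorm_real.
  rewrite rnormV rnorm_natr -/x -exprVn -/x expr1.
  have E0 := expR_ge0 sig.
  have eE : expR (lam k * sig) <= expR sig.
    rewrite ler_expR ler_piMl// (le_trans l2)// /x ler_pdivrMr ?ltr0Sn// mul1r.
    by rewrite ler_nat.
  have ls : lam k * sig <= 2 * x * sig by rewrite ler_wpM2r.
  have ls0 : 0 <= lam k * sig by rewrite mulr_ge0.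
  have h1 : (lam k * sig) ^+ 2 * expR (lam k * sig) <= (2 * x * sig) ^+ 2 * expR sig.
    by rewrite ler_pM ?exprn_ge0 ?expR_ge0// lerXn2r// nnegrE mulr_ge0 ?mulr_ge0.
  have h3 : `|lam k - x| * sig <= 2 * x ^+ 2 * sig by rewrite ler_wpM2r// /x exprVn.
  have h5 : sig * (C0 * x) * (lam k * sig * expR (lam k * sig)) <=
            sig * (C0 * x) * (2 * x * sig * expR sig).
    by rewrite ler_wpM2l ?mulr_ge0// ler_pM ?expR_ge0.
  apply: (le_trans (lerD (lerD h1 (lerD h3 (lexx _))) h5)).
  by rewrite le_eqVlt; apply/orP; left; apply/eqP; rewrite /K; ring.
have K0 : 0 <= K.
  have := has_jet_ge0 (uj 0%N); rewrite pmulr_lge0// invr_gt0 exprn_gt0//.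
pose w k := K / k.+2%:R ^+ 2.
have w0 k : 0 <= w k by rewrite divr_ge0// exprn_ge0.
have sumw m : \sum_(0 <= k < m) w k <= K.
  suff H : \sum_(0 <= k < m) w k <= K * (1 - m.+1%:R^-1).
    by apply: (le_trans H); rewrite ler_piMr// gerBl invr_ge0.
  elim: m => [|m IH]; first by rewrite big_geq// invr1 subrr mulr0.
  rewrite big_nat_recr//=.
  have step : (m.+2%:R ^+ 2)^-1 <= m.+1%:R^-1 - m.+2%:R^-1 :> R.
    have k2 : (m.+2%:R : R) = m.+1%:R + 1 by rewrite -natr1.
    have k10 : 0 < (m.+1%:R : R) by rewrite ltr0Sn.
    have k20 : 0 < (m.+2%:R : R) by rewrite ltr0Sn.
    have -> : m.+1%:R^-1 - m.+2%:R^-1 = m.+1%:R^-1 / m.+2%:R :> R.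
      by rewrite k2; field; rewrite gt_eqF//= -k2 gt_eqF.
    by rewrite expr2 invfM ler_wpM2r ?invr_ge0 ?ler0n// lef_pV2 ?posrE// ler_nat.
  have := ler_wpM2l K0 step; rewrite -/(w m) => H.
  by apply: (le_trans (lerD IH H)); rewrite -mulrDr addrA subrK.
pose g k h := gauss_seq k.+1 (f h).
have np h : rnorm h <= 1 -> nonpole (f h).
  move=> h1 k; rewrite -rnorm_eq0 gt_eqF//.
  have := dk k; have := ler_rnormB (s0 + k%:R) (- (rho%:C * h)); rewrite rnormN opprK.
  rewrite rnormM rnorm_real gtr0_norm//.
  have -> : s0 + k%:R + rho%:C * h = f h + k%:R by rewrite /f; ring.
  have := ler_wpM2l (ltW rho0) h1; rewrite mulr1.
  have : rho < d by rewrite /rho; lra.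
  by set y := rnorm (f h + k%:R); lra.
have gS k h : rnorm h <= 1 -> g k.+1 h = g k h * (1 + u k h).
  by move=> h1; rewrite /g gauss_step//; exact: np.
have [B0 g0j] : exists B0, has_jet (g 0%N) B0.
  eexists; apply: has_jetM.
    by apply: has_jetZ; apply: has_jet_exp; apply: has_jetM fj (has_jet_cst _ _).
  apply: has_jet_ext (has_jet_prod (index_enum _) (P := xpredT) (fun (k : 'I_2) _ => invj k)).
  by move=> h _; rewrite prodfV; congr (_ ^-1); apply: eq_bigr => k _; rewrite addrC.
have B00 := has_jet_ge0 g0j.
(* The product of the 1 + w k is at most the exponential of their sum. *)
pose B := B0 * expR K.
have gj k : has_jet (g k) B.
  suff H : has_jet (g k) (B0 * expR (\sum_(0 <= j < k) w j)).
    by apply: has_jet_le H; rewrite ler_wpM2l// ler_expR.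
  elim: k => [|k IH]; first by rewrite big_geq// expR0 mulr1.
  rewrite big_nat_recr//= expRD mulrA.
  apply: has_jet_ext (fun h h1 => esym (gS k h h1)) _.
  apply: has_jet_le (has_jetM IH (has_jetD (has_jet_cst _ 1) (uj k))).
  rewrite rnorm1 ler_wpM2l ?mulr_ge0 ?expR_ge0//; exact: expR_ge1Dx.
pose dd k h := g k h * u k h.
have ddj k : has_jet (dd k) (B * w k) by apply: has_jetM.
have dds h : rnorm h <= 1 -> cvgn (series (fun k => dd k h)).
  move=> h1; apply: (@series_summable _ _ (fun k => B * w k) (B * K)).
    by move=> k; exact: has_jet_bound (ddj k).
  by move=> m; rewrite -mulr_sumr ler_wpM2l// (has_jet_ge0 (gj 0%N)).
have gE m h : rnorm h <= 1 -> g m h = g 0%N h + series (fun k => dd k h) m.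
  move=> h1; rewrite /series/=; elim: m => [|m IH]; first by rewrite big_geq// addr0.
  by rewrite big_nat_recr//= addrA -IH gS// mulrDr mulr1.
pose S h := g 0%N h + limn (series (fun k => dd k h)).
have gc h : rnorm h <= 1 -> gauss_seq ^~ (f h) @ \oo --> S h.
  move=> h1; rewrite -cvg_shiftS.
  rewrite (_ : [sequence _]_ _ = (fun m => g 0%N h + series (fun k => dd k h) m)).
    by apply: cvgD; [exact: cvg_cst|exact: dds].
  by apply/funext => m; rewrite -gE.
have GS h : rnorm h <= 1 -> Gamma (f h) = S h.
  by move=> h1; apply: cvg_lim; [exact: norm_hausdorff|exact: gc].
exists (B0 + B * K); last by move=> h h1; rewrite -/(f h) GS//; exact: gc.
apply: has_jet_ext (fun h h1 => esym (GS h h1)) _.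
apply: has_jetD => //.
apply: (has_jet_series ddj) => [m|h h1]; last exact: dds.
by rewrite -mulr_sumr ler_wpM2l// (has_jet_ge0 (gj 0%N)).
Qed.

Lemma gauss_cvg (s : C) : nonpole s -> gauss_seq ^~ s @ \oo --> Gamma s.
Proof.
by move=> /gauss_jet[rho _ [M _ /(_ 0)]]; rewrite rnorm0 mulr0 addr0; apply.
Qed.

Lemma Gamma_differentiable (s : C) : nonpole s -> differentiable (@Gamma R) s.
Proof.
move=> /gauss_jet[rho rho0 [M [L j] _]].
by have [] := jet_differentiable rho0 j.
Qed.

End GammaFunction.

(** * The functional equation of Gamma and residues at simple poles *)

Section GammaRecurrence.
Variable R : realType.
Local Notation C := R[i].

Lemma nonpole_addn (s : C) k : nonpole s -> nonpole (s + k%:R).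
Proof. by move=> sn j; rewrite -addrA -natrD sn. Qed.

Lemma nonpole1 : nonpole (1 : C).
Proof. by move=> k; rewrite nat1r pnatr_eq0. Qed.

Lemma cvg_ratio (c : C) : nonpole c ->
  (fun N : nat => N.+1%:R / (c + N.+1%:R)) @ \oo --> (1 : C).
Proof.
move=> cn.
have -> : (fun N : nat => N.+1%:R / (c + N.+1%:R)) = (fun N => (1 + c / N.+1%:R)^-1).
  apply/funext => N; have N0 : (N.+1%:R : C) != 0 by rewrite pnatr_eq0.
  have -> : 1 + c / N.+1%:R = (c + N.+1%:R) / N.+1%:R by rewrite mulrDl divff// addrC.
  by rewrite invf_div.
rewrite -[X in _ --> X]invr1; apply: cvgV; first exact: oner_neq0.
rewrite -[X in _ --> X]addr0; apply: cvgD; first exact: cvg_cst.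
rewrite -[X in _ --> X](mulr0 c); apply: cvgM; first exact: cvg_cst.
apply/cvg_rnormP; rewrite (_ : (fun _ => _) = @harmonic R); first exact: cvg_harmonic.
by apply/funext => N; rewrite subr0 rnormV rnorm_natr.
Qed.

Lemma expC_real (x : R) : expC x%:C = (expR x)%:C.
Proof. by rewrite /expC /= cos0 sin0 mulr1. Qed.

Lemma expC_ln (N : nat) : expC (ln (N.+1%:R : R))%:C = N.+1%:R.
Proof. by rewrite expC_real lnK ?posrE// rmorph_nat. Qed.

Lemma Gamma_rec (s : C) : nonpole s -> Gamma (s + 1) = s * Gamma s.
Proof.
move=> sn; have s1 := nonpole_addn 1 sn.
apply: cvg_lim; first exact: norm_hausdorff.
rewrite -cvg_shiftS.
rewrite (_ : [sequence _]_ _ = (fun N => s * gauss_seq N.+1 s * (N.+1%:R / (s + 1 + N.+1%:R)))).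
  rewrite -[s * Gamma s]mulr1; apply: cvgM; last exact: cvg_ratio.
  apply: cvgM; first exact: cvg_cst.
  by have := gauss_cvg sn; rewrite -cvg_shiftS.
apply/funext => N; rewrite /gauss_seq /= mulrDl expCD mul1r expC_ln.
rewrite [in LHS]big_ord_recr [in RHS]big_ord_recl /= addr0.
have -> : \prod_(i < N.+1) (s + 1 + i%:R) = \prod_(i < N.+1) (s + (bump 0 i)%:R).
  by apply: eq_bigr => i _; rewrite /bump /= natrD addrA.
have s0 : s != 0 by have := sn 0%N; rewrite addr0.
have h1 := s1 N.+1.
have h2 : \prod_(i < N.+1) (s + (bump 0 i)%:R) != 0 by apply/prodf_neq0 => i _; exact: sn.
by move: h1 h2; set a := \prod_(i < _) _; set b := _ + N.+1%:R => ? ?; field; apply/and3P.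
Qed.

Lemma Gamma_1 : Gamma (1 : C) = 1.
Proof.
apply: cvg_lim; first exact: norm_hausdorff.
rewrite -cvg_shiftS.
rewrite (_ : [sequence _]_ _ = (fun N => N.+1%:R / (1 + N.+1%:R))); first exact: cvg_ratio nonpole1.
apply/funext => N; rewrite /= mul1r expC_ln.
have -> : \prod_(k < N.+2) (1 + k%:R) = (N.+2)`!%:R :> C.
  elim: N.+2 => [|m IH]; first by rewrite big_ord0.
  by rewrite big_ord_recr/= IH factS mulnC natrM -natr1 [1 + _]addrC.
have f0 : (N.+1`!%:R : C) != 0 by rewrite pnatr_eq0 -lt0n fact_gt0.
have n0 : 1 + N.+1%:R != 0 :> C by rewrite nat1r pnatr_eq0.
rewrite [N.+2`!]factS natrM -nat1r; move: f0 n0.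
by set x := N.+1`!%:R; set y := N.+1%:R => ? ?; field; apply/andP.
Qed.

Lemma Gamma_shift (s : C) r : nonpole s ->
  Gamma s = Gamma (s + r%:R) / \prod_(k < r) (s + k%:R).
Proof.
move=> sn; elim: r => [|r IH]; first by rewrite big_ord0 addr0 divr1.
rewrite IH big_ord_recr/= -natr1 addrA Gamma_rec; last exact: nonpole_addn.
have := sn r; have : \prod_(i < r) (s + i%:R) != 0 by apply/prodf_neq0 => i _; exact: sn.
by move=> h1 h2; field; rewrite h1 h2.
Qed.

End GammaRecurrence.

Section Residue.
Variable R : realType.
Local Notation C := R[i].

Lemma ReB (a b : C) : complex.Re (a - b) = complex.Re a - complex.Re b.
Proof. exact: raddfB. Qed.

Lemma ImB (a b : C) : complex.Im (a - b) = complex.Im a - complex.Im b.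
Proof. exact: raddfB. Qed.

Lemma Rintegral_near_cst (F : R -> R) (T c eps : R) : 0 < T ->
  continuous F -> (forall x, 0 <= x -> x <= T -> `|F x - c| <= eps) ->
  `|Rintegral lebesgue_measure `[0, T] F - c * T| <= eps * T.
Proof.
move=> T0 Fc Fe.
have muT : fine (lebesgue_measure (`[0, T] : set R)) = T.
  by rewrite lebesgue_measure_itv/= lte_fin T0 sube0.
have intF : lebesgue_measure.-integrable `[0, T] (EFin \o F).
  apply: continuous_compact_integrable; first exact: segment_compact.
  exact: continuous_subspaceT.
have intc (d : R) : lebesgue_measure.-integrable `[0, T] (EFin \o (fun _ : R => d)).
  apply: continuous_compact_integrable; first exact: segment_compact.
  by apply: continuous_subspaceT => x; exact: cvg_cst.
have Rc (d : R) : Rintegral lebesgue_measure `[0, T] (fun _ : R => d) = d * T.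
  by rewrite Rintegral_cst// muT.
have up : Rintegral lebesgue_measure `[0, T] F <= (c + eps) * T.
  rewrite -Rc; apply: le_Rintegral => //= x; rewrite in_itv/= => /andP[x0 xT].
  by have := Fe x x0 xT; rewrite ler_norml => /andP[_]; lra.
have low : (c - eps) * T <= Rintegral lebesgue_measure `[0, T] F.
  rewrite -Rc; apply: le_Rintegral => //= x; rewrite in_itv/= => /andP[x0 xT].
  by have := Fe x x0 xT; rewrite ler_norml => /andP[+ _]; lra.
rewrite ler_norml lerBrDr lerBlDr -mulNr -!mulrDl.
by rewrite [eps + c]addrC up andbT [- eps + c]addrC.
Qed.

(** On a circle of radius e the integrand is G(w) times the imaginary unit, so
    that the integral tends to 2 pi i G(0) by continuity of G at 0.
    Continuity away from 0 makes the integrand integrable. *)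
Lemma residue_simple_pole (f G : C -> C) (a : C) (rho : R) : 0 < rho ->
  (forall w, 0 < rnorm w -> rnorm w < rho -> f (a + w) = G w / w) ->
  (forall w, rnorm w < rho -> {for w, continuous G}) ->
  residue f a = G 0.
Proof.
move=> rho0 fG Gc.
apply: cvg_lim; first exact: norm_hausdorff.
have pi2 : 0 < pi *+ 2 :> R by rewrite pmulrn_lgt0// pi_gt0.
have piC : (piI R *+ 2)^-1 * ((pi *+ 2)%:C * (G 0 * 'i)) = G 0.
  have E : (pi *+ 2)%:C * 'i = piI R *+ 2.
    rewrite /piI; move: (pi : R) => p; rewrite !mulr2n.
    by apply/eqP; rewrite eq_complex/= !mul0r !mulr0 mulr1 subrr !addr0 !eqxx.
  have N : piI R *+ 2 != 0.
    by rewrite -E eq_complex/= mul0r mulr0 subrr eqxx/= mulr1 mul0r addr0 gt_eqF.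
  by rewrite [(pi *+ 2)%:C * (_ * _)]mulrCA E mulrCA mulVf ?mulr1.
rewrite -piC; apply: cvgM; first exact: cvg_cst.
pose w (e phi : R) : C := e%:C * expC (0 +i* phi).
have rnormw e phi : 0 <= e -> rnorm (w e phi) = e.
  by move=> e0; rewrite rnormM rnorm_real ger0_norm// rnorm_expC/= expR0 mulr1.
have gE e phi : 0 < e -> e < rho ->
    f (a + w e phi) * (0 +i* 1) * w e phi = G (w e phi) * 'i.
  move=> e0 er; have e0' := ltW e0.
  rewrite fG ?rnormw//.
  have wn : w e phi != 0 by rewrite -rnorm_eq0 rnormw// gt_eqF.
  by rewrite mulrAC divfK// mulrC.
have wc e : continuous (w e).
  move=> phi; apply: cvgM; first exact: cvg_cst.
  apply/cvg_complexP; rewrite /expC /=; split.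
    under eq_cvg do rewrite mul0r subr0; rewrite mul0r subr0.
    by apply: cvgM; [exact: cvg_cst|exact: continuous_cos].
  under eq_cvg do rewrite mul0r addr0; rewrite mul0r addr0.
  by apply: cvgM; [exact: cvg_cst|exact: continuous_sin].
have Gwc e : 0 < e -> e < rho -> continuous (fun phi => G (w e phi) * 'i).
  move=> e0 er phi; apply: cvgM; last exact: cvg_cst.
  by apply: (@continuous_comp _ _ _ (w e) G); [exact: wc|apply: Gc; rewrite rnormw// ltW].
apply/cvg_rnormP/cvgrPdist_le => eps eps0.
have eps'0 : 0 < eps / (2 * (pi *+ 2)) by rewrite divr_gt0// mulr_gt0.
have G0c : G x @[x --> (0:C)] --> G 0 by apply: Gc; rewrite rnorm0.
have /(cvg_rnormP _ _ _).1/cvgrPdist_le/(_ _ eps'0) := G0c.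
rewrite -nbhs_nearE => /nbhs_normP[d /= d0 dG].
have dr : 0 < complex.Re d /\ d = (complex.Re d)%:C.
  by have H : d = (complex.Re d)%:C by [rewrite RRe_real// ger0_real// ltW]; rewrite -ltcR -H.
case: dr => dr0 dE.
near=> e.
have e0 : 0 < e by near: e; exact: nbhs_right_gt.
have er : e < rho by near: e; exact: nbhs_right_lt.
have ed : e < complex.Re d by near: e; exact: nbhs_right_lt.
have Gwe phi : rnorm (G (w e phi) * 'i - G 0 * 'i) <= eps / (2 * (pi *+ 2)).
  rewrite -mulrBl rnormM; have -> : rnorm ('i : C) = 1.
    by rewrite /rnorm normc_def/= expr0n/= add0r expr1n sqrtr1.
  rewrite mulr1; have := dG (w e phi).
  rewrite /ball_/= sub0r normrN rnormE rnormw; last exact: ltW.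
  by rewrite dE ltcR => /(_ ed); rewrite sub0r normrN ger0_norm ?rnorm_ge0.
rewrite sub0r normrN ger0_norm ?rnorm_ge0//.
have -> : circle_integral f a e =
  Rintegral lebesgue_measure `[0, pi *+ 2] (fun phi => complex.Re (G (w e phi) * 'i)) +i*
  Rintegral lebesgue_measure `[0, pi *+ 2] (fun phi => complex.Im (G (w e phi) * 'i)).
  by rewrite /circle_integral; congr (_ +i* _); apply: eq_Rintegral => phi _; rewrite -gE.
have cRe : continuous (fun phi => complex.Re (G (w e phi) * 'i)).
  by move=> phi; have /cvg_complexP[] := Gwc e e0 er phi.
have cIm : continuous (fun phi => complex.Im (G (w e phi) * 'i)).
  by move=> phi; have /cvg_complexP[] := Gwc e e0 er phi.
apply: (le_trans (rnorm_ReIm _)).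
rewrite ReB ImB Re_realM Im_realM [complex.Re (Complex _ _)]/= [complex.Im (Complex _ _)]/=.
have half (p : R) : 0 < p -> eps = eps / (2 * p) * p + eps / (2 * p) * p.
  by move=> p0; field; rewrite gt_eqF.
rewrite [leRHS](half _ pi2) ![(pi *+ 2) * _]mulrC.
apply: lerD; apply: Rintegral_near_cst => // phi _ _.
  by rewrite -ReB; apply: le_trans (Gwe phi); exact: rnorm_Re.
by rewrite -ImB; apply: le_trans (Gwe phi); exact: rnorm_Im.
Unshelve. all: by end_near. Qed.

End Residue.

(** * Entire power series *)

Section PowerSeries.
Variable R : realType.
Local Notation C := R[i].

(** Both clauses are kept since products and compositions are available for
    differentials, whereas directional derivatives enter the equation. *)
Definition cderiv (f : C -> C) (z d : C) :=
  differentiable f z /\ forall v : C, is_derive z v f (v * d).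

Lemma cderiv_diff (f : C -> C) (z d v : C) : cderiv f z d -> 'd f z v = v * d.
Proof. by move=> [df /(_ v) [_ <-]]; rewrite deriveE. Qed.

Lemma cderivP (f : C -> C) (z d : C) : differentiable f z -> (forall v, 'd f z v = v * d) -> cderiv f z d.
Proof.
move=> df dE; split=> // v; apply: DeriveDef; first exact: diff_derivable.
by rewrite deriveE.
Qed.

Lemma cderiv_comp (f g : C -> C) (z d e : C) : cderiv f z d -> cderiv g (f z) e ->
  cderiv (fun x => g (f x)) z (d * e).
Proof.
move=> fd ge; have [df _] := fd; have [dg _] := ge.
apply: cderivP => [|v]; first exact: (differentiable_comp df dg).
have -> : 'd (fun x => g (f x)) z v = 'd g (f z) ('d f z v).
  exact: (congr1 (fun u : C -> C => u v) (diff_comp df dg)).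
rewrite mulrA; apply: etrans (congr1 (fun u : C => 'd g (f z) u) (cderiv_diff v fd)) _.
exact: cderiv_diff.
Qed.

Lemma cderivM (f g : C -> C) (z d e : C) : cderiv f z d -> cderiv g z e ->
  cderiv (fun x => f x * g x) z (f z * e + g z * d).
Proof.
move=> fd ge; have [df _] := fd; have [dg _] := ge.
apply: cderivP => [|v]; first exact: (differentiableM df dg).
apply: etrans (congr1 (fun u : C -> C => u v) (diffM df dg)) _.
apply: etrans (congr2 (fun a b : C => f z * a + g z * b)
  (cderiv_diff v ge) (cderiv_diff v fd)) _.
by ring.
Qed.

Lemma cderiv_expC (c z : C) : cderiv (fun x => expC (c * x)) z (c * expC (c * z)).
Proof.
have [||||||df Df] := @quad_differentiable R C (fun x => expC (c * x)) z
  (fun v => v * (c * expC (c * z))) (rnorm c * rnorm (expC (c * z)))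
  (rnorm (expC (c * z)) * (expR (rnorm c) * (2 * rnorm c ^+ 2))) 1; last by split.
- by move=> a u v; rewrite /GRing.scale /=; ring.
- exact: ltr01.
- by rewrite mulr_ge0 ?rnorm_ge0.
- by rewrite !mulr_ge0 ?rnorm_ge0 ?expR_ge0 ?exprn_ge0 ?rnorm_ge0.
- by move=> h; rewrite !rnormM mulrC.
move=> h h1.
have -> : expC (c * (z + h)) - expC (c * z) - h * (c * expC (c * z)) =
  expC (c * z) * (expC (c * h) - exp_poly 2 (c * h)).
  rewrite mulrDr expCD /exp_poly !big_nat_recl// big_geq// expr0 expr1 fact0 divr1.
  by rewrite (_ : 1`! = 1%N)// divr1; ring.
rewrite rnormM -mulrA ler_wpM2l ?rnorm_ge0//.
have := @expC_exp_poly_bound R (c * h) 2 1 ler01; rewrite !mul1r expr1n mulr1.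
move=> /le_trans; apply; rewrite rnormM -mulrA ler_pM ?expR_ge0//.
- by rewrite divr_ge0// exprn_ge0// !mulr_ge0 ?rnorm_ge0.
- by rewrite ler_expR ler_piMr ?rnorm_ge0.
- by rewrite (_ : 2`! = 2%N)// le_eqVlt; apply/orP; left; apply/eqP; field.
Qed.

(** Coefficients that decay faster than every geometric sequence, so that the
    series in q = exp(tau) converges for all tau and can be handled
    coefficientwise. *)
Definition entire (x : nat -> C) :=
  forall rho : R, 0 <= rho -> exists B : R, forall r, rnorm (x r) * rho ^+ r <= B.

Definition psum (x : nat -> C) (q : C) : C := limn (series (fun r => x r * q ^+ r)).

Lemma sum_half_le (B : R) m : 0 <= B -> \sum_(0 <= k < m) B / 2 ^+ k <= 2 * B.
Proof.
move=> B0; suff -> : \sum_(0 <= k < m) B / 2 ^+ k = 2 * B * (1 - (2 ^+ m)^-1).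
  by rewrite ler_piMr ?mulr_ge0// gerBl invr_ge0 exprn_ge0.
elim: m => [|m IH]; first by rewrite big_geq// expr0 invr1 subrr mulr0.
by rewrite big_nat_recr//= IH exprS invfM; field; rewrite expf_neq0// pnatr_eq0.
Qed.

Lemma entire_bound x (rho : R) : entire x -> 0 <= rho ->
  exists2 B : R, 0 <= B & forall r, rnorm (x r) * rho ^+ r <= B / 2 ^+ r.
Proof.
move=> xe rho0; have [|B Bx] := xe (2 * rho); first by rewrite mulr_ge0.
exists B; first by apply: le_trans (Bx 0%N); rewrite mulr_ge0 ?rnorm_ge0.
by move=> r; rewrite ler_pdivlMr ?exprn_gt0// -mulrA -exprMn [rho * 2]mulrC.
Qed.

Lemma entire_cvg x q : entire x -> series (fun r => x r * q ^+ r) @ \oo --> psum x q.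
Proof.
move=> /(@entire_bound _ (rnorm q))/(_ (rnorm_ge0 _))[B B0 Bx].
apply: (@series_summable _ _ (fun r => B / 2 ^+ r) (2 * B)).
  by move=> r; rewrite rnormM rnormX.
by move=> m; exact: sum_half_le.
Qed.

Lemma psumP x q l : series (fun r => x r * q ^+ r) @ \oo --> l -> psum x q = l.
Proof. by apply: cvg_lim; exact: norm_hausdorff. Qed.

Lemma entire_le x (B D : R) : 0 <= B -> 0 <= D ->
  (forall r, rnorm (x r) <= B * (D ^+ r / r`!%:R)) -> entire x.
Proof.
move=> B0 D0 xB rho rho0; exists (B * expR (D * rho)) => r.
apply: (le_trans (ler_wpM2r (exprn_ge0 r rho0) (xB r))).
rewrite -mulrA ler_wpM2l// mulrAC -exprMn.
have Dr : 0 <= D * rho by rewrite mulr_ge0.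
apply: le_trans (sum_exp_le r.+1 Dr).
by rewrite big_nat_recr//= lerDr sumr_ge0// => i _; rewrite divr_ge0// exprn_ge0.
Qed.

Lemma entireZ c x : entire x -> entire (fun r => c * x r).
Proof.
move=> xe rho rho0; have [B Bx] := xe rho rho0; exists (rnorm c * B) => r.
by rewrite rnormM -mulrA ler_wpM2l ?rnorm_ge0.
Qed.

Lemma entireD x y : entire x -> entire y -> entire (fun r => x r + y r).
Proof.
move=> xe ye rho rho0; have [B Bx] := xe rho rho0; have [B' By] := ye rho rho0.
exists (B + B') => r.
apply: le_trans (lerD (Bx r) (By r)); rewrite -mulrDl ler_wpM2r ?exprn_ge0//.
exact: ler_rnormD.
Qed.

Lemma entire0 : entire (fun=> 0).
Proof. by move=> rho _; exists 0 => r; rewrite rnorm0 mul0r. Qed.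

Lemma entire_sum (I : Type) (s : seq I) (x : I -> nat -> C) :
  (forall i, entire (x i)) -> entire (fun r => \sum_(i <- s) x i r).
Proof.
move=> xe; elim: s => [|i s IH].
  by under [X in entire X]funext do rewrite big_nil; exact: entire0.
by under [X in entire X]funext do rewrite big_cons; exact: entireD.
Qed.

Lemma entire_tail x : entire x -> entire (fun r => x r.+1).
Proof.
move=> xe rho rho0; have [|B Bx] := xe (rho + 1); first by rewrite addr_ge0.
exists B => r; apply: le_trans (Bx r.+1); rewrite ler_wpM2l ?rnorm_ge0// exprS.
apply: (@le_trans _ _ ((rho + 1) ^+ r)).
  by rewrite lerXn2r ?nnegrE// ?lerDl// addr_ge0.
by rewrite ler_peMl ?exprn_ge0 ?addr_ge0// lerDr.
Qed.

Definition shift1 (x : nat -> C) (r : nat) : C := if r is r'.+1 then x r' else 0.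

Lemma entire_shift1 x : entire x -> entire (shift1 x).
Proof.
move=> xe rho rho0; have [B Bx] := xe rho rho0.
have B0 : 0 <= B by apply: le_trans (Bx 0%N); rewrite mulr_ge0 ?rnorm_ge0.
exists (B * rho) => -[|r] /=; first by rewrite rnorm0 mul0r mulr_ge0.
by rewrite exprSr mulrA ler_wpM2r.
Qed.

Lemma entire_deg x : entire x -> entire (fun r => r%:R * x r).
Proof.
move=> xe rho rho0; have [B B0 Bx] := entire_bound xe rho0.
exists B => r; rewrite rnormM rnorm_natr -mulrA.
apply: (le_trans (ler_wpM2l (ler0n _ r) (Bx r))).
rewrite mulrCA ler_piMr// ler_pdivrMr ?exprn_gt0// mul1r -natrX ler_nat.
by rewrite ltnW// ltn_expl.
Qed.

Lemma psumD x y q : entire x -> entire y ->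
  psum (fun r => x r + y r) q = psum x q + psum y q.
Proof.
move=> xe ye; apply: psumP.
rewrite (_ : series _ = (fun m => series (fun r => x r * q ^+ r) m + series (fun r => y r * q ^+ r) m)).
  by apply: cvgD; exact: entire_cvg.
apply/funext => m; rewrite /series/= -big_split/=.
by apply: eq_bigr => r _; rewrite mulrDl.
Qed.

Lemma psumZ c x q : entire x -> psum (fun r => c * x r) q = c * psum x q.
Proof.
move=> xe; apply: psumP.
rewrite (_ : series _ = (fun m => c * series (fun r => x r * q ^+ r) m)).
  by apply: cvgM; [exact: cvg_cst|exact: entire_cvg].
apply/funext => m; rewrite /series/= mulr_sumr.
by apply: eq_bigr => r _; rewrite mulrA.
Qed.

Lemma psum0 q : psum (fun=> 0) q = 0.
Proof. by have := psumZ 0 q entire0; under [X in psum X]funext do rewrite mul0r; rewrite mul0r. Qed.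

Lemma psum_sum (I : Type) (s : seq I) (x : I -> nat -> C) q :
  (forall i, entire (x i)) ->
  psum (fun r => \sum_(i <- s) x i r) q = \sum_(i <- s) psum (x i) q.
Proof.
move=> xe; elim: s => [|i s IH].
  by under [X in psum X]funext do rewrite big_nil; rewrite psum0 big_nil.
under [X in psum X]funext do rewrite big_cons.
by rewrite psumD ?IH ?big_cons//; exact: entire_sum.
Qed.

Lemma psum_recl x q : entire x -> psum x q = x 0%N + q * psum (fun r => x r.+1) q.
Proof.
move=> xe; apply: psumP; rewrite -cvg_shiftS.
rewrite (_ : [sequence _]_ _ = (fun m => x 0%N + q * series (fun r => x r.+1 * q ^+ r) m)).
  apply: cvgD; first exact: cvg_cst.
  by apply: cvgM; [exact: cvg_cst|exact/entire_cvg/entire_tail].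
apply/funext => m; rewrite /series/= big_nat_recl// expr0 mulr1; congr (_ + _).
by rewrite mulr_sumr; apply: eq_bigr => r _; rewrite exprS; ring.
Qed.

Lemma psum_shift1 x q : entire x -> psum (shift1 x) q = q * psum x q.
Proof. by move=> xe; rewrite psum_recl ?add0r//; exact: entire_shift1. Qed.

Lemma jet_expr (q : C) r :
  jet (fun h : C => (q + h) ^+ r) (fun h => r%:R * q ^+ r.-1 * h) ((rnorm q + 1) ^+ r).
Proof.
have idj : jet (fun h : C => q + h) (fun h => h) (rnorm q + 1).
  have l1 : jet (fun h : C => h) (fun h => h) 1.
    apply: jet_lin => [a u v||h]; [by []|exact: ler01|by rewrite mul1r].
  have := jetD (jet_cst _ q) l1.
  by have -> : (fun h : C => 0 + h) = (fun h => h) by apply/funext => h; rewrite add0r.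
elim: r => [|r IH].
  rewrite expr0 -rnorm1.
  have -> : (fun h : C => 0%:R * q ^+ 0.-1 * h) = (fun=> 0).
    by apply/funext => h; rewrite !mul0r.
  exact: jet_cst.
have := jetM idj IH; rewrite -exprS.
have -> : (fun h : C => (q + h) * (q + h) ^+ r) = (fun h => (q + h) ^+ r.+1).
  by apply/funext => h; rewrite exprS.
congr jet; apply/funext => h; rewrite !addr0 -pred_Sn.
case: r {IH} => [|r]; first by rewrite expr0; ring.
by rewrite -[r.+2%:R]natr1 exprS -pred_Sn; ring.
Qed.

Lemma psum_cderiv x q : entire x ->
  cderiv (psum x) q (psum (fun r => r.+1%:R * x r.+1) q).
Proof.
move=> xe.
have [|B B0 Bx] := @entire_bound x (rnorm q + 1) xe; first by rewrite addr_ge0 ?rnorm_ge0.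
pose g r (h : C) := x r * (q + h) ^+ r.
pose L r (h : C) := x r * (r%:R * q ^+ r.-1 * h).
have gj r : jet (g r) (L r) (B / 2 ^+ r).
  apply: jet_le (Bx r) _.
  have := jetM (jet_cst C (x r)) (jet_expr q r).
  by congr jet; apply/funext => h; rewrite /L mulr0 addr0.
have [j cL] := jet_series gj (fun m => sum_half_le m B0) (fun h _ => @entire_cvg x (q + h) xe).
have j' : jet (fun h : C => psum x (q + (1:R)%:C *: h)) (fun h => limn (series (fun r => L r h))) (2 * B).
  by apply: jet_ext j => h _; rewrite rmorph1 scale1r.
have [df Df] := jet_differentiable ltr01 j'.
split=> // v.
suff <- : (1:R)%:C^-1 * limn (series (fun r => L r v)) =
    v * psum (fun r => r.+1%:R * x r.+1) q by exact: Df.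
rewrite rmorph1 invr1 mul1r.
apply: cvg_lim; first exact: norm_hausdorff.
rewrite -cvg_shiftS.
have xe' : entire (fun r => r.+1%:R * x r.+1) := entire_tail (entire_deg xe).
rewrite (_ : [sequence _]_ _ = (fun m => v * series (fun r => r.+1%:R * x r.+1 * q ^+ r) m)).
  by apply: cvgM; [exact: cvg_cst|exact: entire_cvg].
apply/funext => m; rewrite /series/= big_nat_recl// {1}/L mul0r mul0r mulr0 add0r.
by rewrite mulr_sumr; apply: eq_bigr => r _; rewrite /L -pred_Sn; ring.
Qed.

(** As q d/dq is d/dtau, it multiplies the coefficient of q ^ r by r. *)
Lemma psum_exp_cderiv x tau : entire x ->
  cderiv (fun t => psum x (expC t)) tau (psum (fun r => r%:R * x r) (expC tau)).
Proof.
move=> xe; have ce : cderiv (@expC R) tau (expC tau).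
  have := cderiv_expC 1 tau; rewrite !mul1r.
  by congr cderiv; apply/funext => t; rewrite mul1r.
have := cderiv_comp ce (psum_cderiv (expC tau) xe); congr cderiv.
by rewrite [in RHS]psum_recl ?mul0r ?add0r//; exact: entire_deg.
Qed.

(** The values at small positive q already determine the coefficients: let q tend
    to 0, split off the constant term, divide by q, and repeat. *)
Lemma psum_eq0 x : entire x ->
  (forall t : R, psum x (expC t%:C) = 0) -> forall r, x r = 0.
Proof.
have key y : entire y -> (forall t : R, psum y (expC t%:C) = 0) -> y 0%N = 0.
  move=> ye y0.
  have y00 : psum y 0 = y 0%N by rewrite psum_recl// mul0r addr0.
  have [dy _] := psum_cderiv 0 ye.
  have cy := differentiable_continuous dy.
  have : (fun N : nat => psum y (N.+1%:R^-1)) @ \oo --> psum y 0.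
    apply: (@cvg_comp _ _ _ (fun N : nat => N.+1%:R^-1 : C) (psum y)); last exact: cy.
    apply/cvg_rnormP; rewrite (_ : (fun _ => _) = @harmonic R); first exact: cvg_harmonic.
    by apply/funext => N; rewrite subr0 rnormV rnorm_natr.
  have -> : (fun N : nat => psum y (N.+1%:R^-1)) = (fun=> 0).
    apply/funext => N; rewrite -(y0 (ln (N.+1%:R^-1))); congr psum.
    by rewrite expC_real lnK ?posrE// fmorphV rmorph_nat.
  move=> h; rewrite -y00; apply/esym; move: h.
  apply: cvg_unique; last exact: cvg_cst.
  exact: norm_hausdorff.
move=> xe x0 r; elim: r x xe x0 => [|r IH] x xe x0; first exact: key.
apply: (IH (fun r => x r.+1)); first exact: entire_tail.
move=> t; have := x0 t; rewrite psum_recl// key// add0r => /eqP.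
by rewrite mulf_eq0 (negPf (expC_neq0 _)) => /eqP.
Qed.

End PowerSeries.

(** * The basis of fixed points *)

Section FixedPointBasis.
Variables (R : realType) (n : nat).
Local Notation C := R[i].
Implicit Types z : 'rV[C]_n.

(** The matrix of the restriction map to the fixed points. It diagonalizes
    classical multiplication by x, with eigenvalues the z_I. *)
Definition restr_mx z : 'M[C]_n := (Vandermonde n z)^T.

Lemma restr_mxE z I a : restr_mx z I a = z 0 I ^+ a.
Proof. by rewrite !mxE. Qed.

Lemma Omega_inj z (I J : 'I_n) : Omega z -> I != J -> z 0 I - z 0 J != 0.
Proof. by move=> zO IJ; have := zO I J IJ 0; rewrite mulr0z. Qed.

Lemma restr_mx_unit z : Omega z -> restr_mx z \in unitmx.
Proof.
move=> zO; rewrite unitmxE det_tr det_Vandermonde unitfE.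
apply/prodf_neq0 => i _; apply/prodf_neq0 => j ij.
by apply: Omega_inj => //; rewrite -val_eqE /= gtn_eqF.
Qed.

Lemma prod_XsubC_esym (z : 'rV[C]_n) (x : C) :
  \prod_b (x - z 0 b) = \sum_(k < n.+1) (-1) ^+ k * x ^+ (n - k) * Defs.esym z k.
Proof.
under eq_bigr do rewrite addrC.
rewrite bigA_distr.
rewrite (partition_big (fun A : {set 'I_n} => inord #|A| : 'I_n.+1) xpredT)//=.
apply: eq_bigr => k _; rewrite /Defs.esym mulr_sumr.
have cA (A : {set 'I_n}) : (inord #|A| == k) = (#|A| == k :> nat).
  by rewrite -val_eqE /= inordK// ltnS -[X in (_ <= X)%N](card_ord n) max_card.
rewrite (eq_bigl _ _ cA); apply: eq_bigr => A /eqP Ak.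
rewrite big_if /= -Ak prodrN -[LHS]mulrA -[RHS]mulrA; congr (_ * _).
rewrite mulrC prodr_const; congr (_ ^+ _ * _).
have -> : #|(fun i => i \notin A)| = #|~: A| by apply: eq_card => i; rewrite !inE.
by have := cardsC A; rewrite card_ord => nA; rewrite -[X in (X - _)%N]nA addKn.
Qed.

Variable lst : 'I_n.
Hypothesis lstE : lst = n.-1 :> nat.

Lemma n_gt0 : (0 < n)%N. Proof. exact: leq_ltn_trans (ltn_ord lst). Qed.

(** The last column is where the relation in cohomology enters: x ^ n is expressed
    through lower powers by the vanishing of the product of the z_I - z_b. *)
Lemma restr_qmul z q I j :
  (restr_mx z *m qmul z q) I j = z 0 I * restr_mx z I j + q * (j == lst)%:R.
Proof.
rewrite mxE.
under eq_bigr do rewrite restr_mxE mxE.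
rewrite restr_mxE -exprS.
have [jn|jn] := ltnP j.+1 n.
  rewrite (bigD1 (Ordinal jn))//= eqxx mulr1 big1 ?addr0 => [|a aj].
    by rewrite -val_eqE/= lstE -(inj_eq succn_inj) prednK ?n_gt0// ltn_eqF ?mulr0 ?addr0.
  by rewrite [_ == _ :> nat](negPf aj) mulr0.
have jl : j = lst.
  apply/val_inj => /=; rewrite lstE; apply/eqP; rewrite eqn_leq.
  by rewrite -ltnS prednK ?n_gt0// ltn_ord /= -ltnS prednK ?n_gt0.
rewrite jl eqxx mulr1 lstE prednK ?n_gt0//.
under eq_bigr do rewrite mulrDr.
rewrite big_split /= addrC; congr (_ + _); last first.
  rewrite (bigD1 (Ordinal n_gt0))//= ?eqxx ?mulr1n expr0 mul1r big1 ?addr0// => a a0.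
  by rewrite (_ : (a == 0%N :> nat) = false) ?mulr0n ?mulr0//; apply: negbTE.
have : \prod_b (z 0 I - z 0 b) = 0 by rewrite (bigD1 I)//= subrr mul0r.
rewrite prod_XsubC_esym big_ord_recl /= expr0 mul1r subn0.
have -> : Defs.esym z 0 = 1.
  rewrite /Defs.esym (bigD1 (finset.set0 : {set 'I_n}))/= ?cards0// big_set0 big1 ?addr0// => A /andP[].
  by rewrite cards_eq0 => ->.
rewrite mulr1 => /eqP; rewrite addr_eq0 => /eqP ->.
rewrite -sumrN (reindex_inj rev_ord_inj) /=.
apply: eq_bigr => k _; rewrite /bump /= add1n.
have -> : (n - (n - k.+1) = k.+1)%N by rewrite subKn.
by rewrite -pred_Sn exprS; ring.
Qed.

(** The class with these restrictions is, up to the sign, the quotient of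
    p(x) - p(t) by x - t, where p is the product of the x - z_b; this is monic
    of degree n - 1 in x. *)
Lemma last_coord z (t : C) : Omega z ->
  (invmx (restr_mx z) *m \col_I \prod_(b | b != I) (z 0 b - t)) lst 0 = (-1) ^+ n.-1.
Proof.
move=> zO; set u := \col_I _.
pose p := \prod_(b < n) ('X - (z 0 b)%:P).
have sp : size p = n.+1 by rewrite /p size_prod_XsubC /index_enum -enumT size_enum_ord.
have rp : root (p - p.[t]%:P) t by rewrite /root hornerD hornerN hornerC subrr.
have [Q QE] := factor_theorem _ _ rp.
have szlt : (size (- p.[t]%:P) < size p)%N.
  by rewrite size_polyN sp ltnS (leq_trans (size_polyC_leq1 _))// n_gt0.
have Qm : Q \is monic.
  rewrite -(monicMr Q (monicXsubC t)) -QE monicE lead_coefDl// -monicE.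
  exact: monic_prod_XsubC.
have sQ : size Q = n.
  have := size_Mmonic (monic_neq0 Qm) (monicXsubC t); rewrite -QE (size_polyDl szlt) sp.
  by rewrite size_XsubC addn2 /= => -[].
have Qt I : (-1) ^+ n.-1 * Q.[z 0 I] = \prod_(b | b != I) (z 0 b - t).
  have QI : Q.[z 0 I] = \prod_(b | b != I) (t - z 0 b).
    have pE : p = \prod_(b | b != I) ('X - (z 0 b)%:P) * ('X - (z 0 I)%:P).
      by rewrite mulrC /p (bigD1 I).
    have pt y : p.[y] = \prod_(b | b != I) (y - z 0 b) * (y - z 0 I).
      rewrite pE hornerM horner_prod hornerXsubC; congr (_ * _).
      by apply: eq_bigr => b _; rewrite hornerXsubC.
    have [tI|tI] := eqVneq t (z 0 I).
      have : Q * ('X - t%:P) = \prod_(b | b != I) ('X - (z 0 b)%:P) * ('X - t%:P).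
        by rewrite -QE pt tI subrr mulr0 subr0 pE.
      move=> /(mulIf (negbT (polyXsubC_eq0 _))) ->.
      rewrite horner_prod -tI; apply: eq_bigr => b _; by rewrite hornerXsubC.
    have := congr1 (fun u => u.[z 0 I]) QE.
    rewrite hornerM hornerXsubC hornerD hornerN hornerC !pt subrr mulr0 sub0r.
    rewrite -mulrN opprB => /mulIf -> //.
    by rewrite subr_eq0 eq_sym.
  rewrite QI; have -> : (-1) ^+ n.-1 = \prod_(b | b != I) (-1 : C).
    rewrite prodr_const; congr (_ ^+ _).
    by rewrite cardC1 card_ord.
  by rewrite -big_split /=; apply: eq_bigr => b _; rewrite mulN1r opprB.
pose v : 'cV[C]_n := \col_a ((-1) ^+ n.-1 * Q`_a).
have uv : u = restr_mx z *m v.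
  apply/colP => I; rewrite !mxE -Qt (horner_coef_wide _ (eq_leq sQ)) mulr_sumr.
  by apply: eq_bigr => a _; rewrite !mxE; ring.
rewrite uv mulKmx ?restr_mx_unit// mxE lstE.
by have := monicP Qm; rewrite /lead_coef sQ => ->; rewrite mulr1.
Qed.

End FixedPointBasis.

(** * Limits and derivatives of matrices *)

Section MatrixLimits.
Variable R : realType.
Local Notation C := R[i].

Lemma cvg_sumr (K : numFieldType) (W : normedModType K) (I T : Type)
    (F : set_system T) (r : seq I) (f : I -> T -> W) (l : I -> W) : Filter F ->
  (forall i, f i @ F --> l i) -> \sum_(i <- r) f i x @[x --> F] --> \sum_(i <- r) l i.
Proof.
move=> FF fl; elim: r => [|i r IH].
  by under eq_cvg do rewrite big_nil; rewrite big_nil; exact: cvg_cst.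
by under eq_cvg do rewrite big_cons; rewrite big_cons; exact: cvgD.
Qed.

(** The norm of a matrix is at most the sum of the norms of its entries, each
    weighted by the norm of the matrix unit. *)
Lemma cvg_mxP (m k : nat) (T : Type) (F : set_system T) (A : T -> 'M[C]_(m, k))
    (L : 'M[C]_(m, k)) : Filter F ->
  A @ F --> L <-> forall i j, A x i j @[x --> F] --> L i j.
Proof.
move=> FF; split=> [AL i j|AL].
  by apply: (@cvg_comp _ _ _ A (fun M : 'M[C]_(m, k) => M i j) F (nbhs L)) => //;
    exact: coord_continuous.
apply/cvg_rnormP.
have bnd (M : 'M[C]_(m, k)) :
    rnorm M <= \sum_i \sum_j rnorm (M i j) * rnorm (delta_mx i j : 'M[C]_(m, k)).
  rewrite {1}(matrix_sum_delta M); apply: (le_trans (ler_rnorm_sum _ _)).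
  apply: ler_sum => i _; apply: (le_trans (ler_rnorm_sum _ _)).
  by apply: ler_sum => j _; rewrite rnormZ.
apply: (@squeeze_cvgr _ _ _ _ (cst 0)
  (fun x => \sum_i \sum_j rnorm (A x i j - L i j) * rnorm (delta_mx i j : 'M[C]_(m, k))) _ _ 0).
- near=> x; rewrite rnorm_ge0/=; apply: (le_trans (bnd _)).
  apply: ler_sum => i _; apply: ler_sum => j _.
  by rewrite !mxE.
- exact: cvg_cst.
have E0 : \sum_(i < m) \sum_(j < k) 0 * rnorm (delta_mx i j : 'M[C]_(m, k)) = 0.
  by rewrite big1 // => i _; rewrite big1// => j _; rewrite mul0r.
rewrite -[X in _ --> X]E0.
apply: cvg_sumr => i; apply: cvg_sumr => j.
apply: cvgM; last exact: cvg_cst.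
by apply/cvg_rnormP; exact: AL.
Unshelve. all: by end_near. Qed.

Lemma is_derive1P (W : normedModType C) (t : C) (f : C -> W) (d : W) :
  is_derive t (1 : C) f d <->
  (fun h : C => h^-1 *: ((f \o shift t) (h *: (1 : C)) - f t)) @ (0 : C)^' --> d.
Proof.
split=> [[df <-]|fd]; first exact: df.
apply: DeriveDef; first by apply/cvg_ex; exists d.
by apply: cvg_lim fd; exact: norm_hausdorff.
Qed.

Lemma is_derive_mxP (m k : nat) (t : C) (A : C -> 'M[C]_(m, k)) (D : 'M[C]_(m, k)) :
  is_derive t (1 : C) A D <-> forall i j, is_derive t (1 : C) (fun x => A x i j) (D i j).
Proof.
split=> [/is_derive1P/cvg_mxP AD i j|AD].
  apply/is_derive1P; have := AD i j.
  by under eq_cvg do rewrite !mxE.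
apply/is_derive1P/cvg_mxP => i j; have /is_derive1P := AD i j.
by under [X in _ -> X]eq_cvg do rewrite !mxE.
Qed.

Lemma cvg_mulmx (m n p r : nat) (T : Type) (F : set_system T) (A : 'M[C]_(m, n))
    (B : 'M[C]_(p, r)) (M : T -> 'M[C]_(n, p)) (L : 'M[C]_(n, p)) : Filter F ->
  M @ F --> L -> (fun x => A *m M x *m B) @ F --> A *m L *m B.
Proof.
move=> FF /cvg_mxP ML; apply/cvg_mxP => i j.
under eq_cvg do rewrite mxE; rewrite mxE.
apply: cvg_sumr => l; apply: cvgM; last exact: cvg_cst.
under eq_cvg do rewrite mxE; rewrite mxE.
by apply: cvg_sumr => l'; apply: cvgM; [exact: cvg_cst|exact: ML].
Qed.

Lemma is_derive_mulmx (m n p r : nat) (A : 'M[C]_(m, n)) (B : 'M[C]_(p, r))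
    (M : C -> 'M[C]_(n, p)) (D : 'M[C]_(n, p)) t :
  is_derive t (1 : C) M D -> is_derive t (1 : C) (fun x => A *m M x *m B) (A *m D *m B).
Proof.
move=> /is_derive1P/(@cvg_mulmx _ _ _ _ _ _ A B) H; apply/is_derive1P; move: H.
by under eq_cvg do rewrite -scalemxAr -scalemxAl mulmxBr mulmxBl.
Qed.

Lemma is_derive_unique (W : normedModType C) (t : C) (f : C -> W) d d' :
  is_derive t (1 : C) f d -> is_derive t (1 : C) f d' -> d = d'.
Proof. by move=> [_ <-] [_ <-]. Qed.

End MatrixLimits.

(** * Fundamental solutions of Frobenius type *)

Section Fundamental.
Variables (R : realType) (n : nat).
Local Notation C := R[i].
Variable lst : 'I_n.
Hypothesis lstE : lst = n.-1 :> nat.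
Variable z : 'rV[C]_n.
Hypothesis zO : Omega z.
Local Notation T := (restr_mx z).
Let Tu : T \in unitmx := restr_mx_unit zO.

Implicit Types X Y : nat -> 'M[C]_n.

Definition mx_entire X := forall I J, entire (fun r => X r I J).

Definition psum_mx X (tau : C) : 'M[C]_n := \matrix_(I, J) psum (fun r => X r I J) (expC tau).

(** Written in the basis of fixed points: a power series in q with matrix
    coefficients X, times the diagonal matrix of the q ^ z_J, then transported
    back to the basis of powers of x. *)
Definition Sol X (tau : C) : 'M[C]_n :=
  invmx T *m (psum_mx X tau *m diag_mx (\row_J expC (z 0 J * tau))) *m T.

(** The quantum differential equation on coefficients. In the basis of fixed
    points the quantum correction q adds the last coordinate of a class to each
    of its restrictions. *)
Definition frobenius_rec X := forall I J r,
  (z 0 J + r%:R - z 0 I) * X r I J =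
  shift1 (fun r => \sum_K invmx T lst K * X r K J) r.

Lemma psum_mx_diagE X tau I J :
  (psum_mx X tau *m diag_mx (\row_J expC (z 0 J * tau))) I J =
  psum (fun r => X r I J) (expC tau) * expC (z 0 J * tau).
Proof. by rewrite mul_mx_diag !mxE. Qed.

Lemma conj_qmul q (M : 'M[C]_n) I J :
  (T *m qmul z q *m (invmx T *m M)) I J =
  z 0 I * M I J + q * \sum_K invmx T lst K * M K J.
Proof.
rewrite mxE; under eq_bigr do rewrite (restr_qmul lstE) mulrDl.
rewrite big_split /=; congr (_ + _).
  under eq_bigr do rewrite -mulrA; rewrite -mulr_sumr; congr (_ * _).
  have := mulKVmx Tu M => /matrixP/(_ I J); rewrite mxE => <-.
  by [].
rewrite (bigD1 lst)//= eqxx mulr1 big1 ?addr0 => [|k /negPf ->]; last first.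
  by rewrite mulr0 mul0r.
by rewrite mxE.
Qed.

(** Up to the sign, the defect of the equation in the entry (I, J) is q ^ z_J times
    the power series with coefficients E I J, and a power series vanishes identically if and only if
    its coefficients do. *)
Lemma Sol_qDE X : mx_entire X -> solves_qDE z (Sol X) <-> frobenius_rec X.
Proof.
move=> Xe.
pose M tau := psum_mx X tau *m diag_mx (\row_J expC (z 0 J * tau)).
pose D tau : 'M[C]_n := \matrix_(I, J)
  (psum (fun r => X r I J) (expC tau) * (z 0 J * expC (z 0 J * tau)) +
   expC (z 0 J * tau) * psum (fun r => r%:R * X r I J) (expC tau)).
have MD tau : is_derive tau (1 : C) M (D tau).
  apply/is_derive_mxP => I J.
  have := cderivM (psum_exp_cderiv tau (Xe I J)) (cderiv_expC (z 0 J) tau).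
  move=> [_ /(_ 1)]; rewrite mul1r mxE.
  by congr is_derive; apply/funext => t; rewrite psum_mx_diagE.
have SD tau : is_derive tau (1 : C) (Sol X) (invmx T *m D tau *m T).
  exact: is_derive_mulmx.
pose E I J r := ((z 0 J - z 0 I) * X r I J + r%:R * X r I J)
   + -1 * shift1 (fun r => \sum_K invmx T lst K * X r K J) r.
have EE I J r : E I J r = (z 0 J + r%:R - z 0 I) * X r I J
   - shift1 (fun r => \sum_K invmx T lst K * X r K J) r by rewrite /E; ring.
have De J : entire (fun r => \sum_K invmx T lst K * X r K J).
  by apply: entire_sum => K; apply: entireZ; exact: Xe.
have Ze I J : entire (fun r => (z 0 J - z 0 I) * X r I J) by apply: entireZ; exact: Xe.
have Re I J : entire (fun r => r%:R * X r I J) by apply: entire_deg; exact: Xe.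
have De' J : entire (shift1 (fun r => \sum_K invmx T lst K * X r K J)).
  exact: entire_shift1.
have Ee I J : entire (E I J).
  by apply: entireD; [exact: entireD|exact: entireZ].
have psE I J q : psum (E I J) q = (z 0 J - z 0 I) * psum (fun r => X r I J) q
    + psum (fun r => r%:R * X r I J) q
    - q * \sum_K invmx T lst K * psum (fun r => X r K J) q.
  rewrite psumD; [|exact: entireD|by apply: entireZ].
  rewrite psumD// psumZ; last exact: Xe.
  rewrite psumZ// psum_shift1// psum_sum => [|K]; last by apply: entireZ; exact: Xe.
  rewrite mulN1r; congr (_ - _ * _); apply: eq_bigr => K _.
  by rewrite psumZ//; exact: Xe.
have eqE tau I J : (T *m qmul z (expC tau) *m (invmx T *m M tau)) I J =
    D tau I J - expC (z 0 J * tau) * psum (E I J) (expC tau).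
  rewrite conj_qmul psum_mx_diagE mxE psE.
  under eq_bigr do rewrite psum_mx_diagE mulrA.
  by rewrite -mulr_suml; ring.
have solE tau : (qmul z (expC tau) *m Sol X tau = invmx T *m D tau *m T) <->
    T *m qmul z (expC tau) *m (invmx T *m M tau) = D tau.
  have -> : Sol X tau = invmx T *m M tau *m T by [].
  move: (M tau) (D tau) (qmul z (expC tau)) => m d q; split=> [H|<-].
    have := congr1 (fun A => T *m A *m invmx T) H.
    by rewrite !mulmxA (mulmxV Tu) mul1mx !(mulmxK Tu).
  by rewrite !mulmxA (mulVmx Tu) mul1mx.
split=> [SE I J r|XR tau].
  have E0 : forall r, E I J r = 0.
    apply: psum_eq0 => // t.
    have /solE/matrixP/(_ I J) := is_derive_unique (SE t%:C) (SD t%:C).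
    rewrite eqE => /eqP; rewrite -subr_eq0 addrAC subrr sub0r oppr_eq0 mulf_eq0.
    by rewrite (negPf (expC_neq0 _)) => /eqP.
  by have /eqP := E0 r; rewrite EE subr_eq0 => /eqP.
suff -> : qmul z (expC tau) *m Sol X tau = invmx T *m D tau *m T by exact: SD.
apply/solE/matrixP => I J; rewrite eqE.
have -> : E I J = (fun=> 0) by apply/funext => r; rewrite EE XR subrr.
by rewrite psum0 mulr0 subr0.
Qed.

(** On Omega the factor z_J + r - z_I does not vanish for r > 0, so that the
    recursion determines all coefficients from the first. *)
Lemma frobenius_rec_inj X Y : frobenius_rec X -> frobenius_rec Y -> X 0%N = Y 0%N -> X = Y.
Proof.
move=> XR YR XY; apply/funext; elim=> [//|r IH].
apply/matrixP => I J.
have : (z 0 J + r.+1%:R - z 0 I) * X r.+1 I J = (z 0 J + r.+1%:R - z 0 I) * Y r.+1 I J.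
  by rewrite XR YR /= IH.
apply: mulfI; rewrite addrAC.
have [->|JI] := eqVneq I J; first by rewrite subrr add0r pnatr_eq0.
have := zO (i := J) (j := I); rewrite eq_sym => /(_ JI (- r.+1%:Z)).
by rewrite -subr_eq0 rmorphN opprK.
Qed.

Lemma expmx_qmul0 tau :
  expmx (tau *: qmul z 0) = invmx T *m diag_mx (\row_J expC (z 0 J * tau)) *m T.
Proof.
apply: cvg_lim; first exact: norm_hausdorff.
have TA k : T *m (tau *: qmul z 0) ^+ k = diag_mx (\row_J (z 0 J * tau) ^+ k) *m T.
  elim: k => [|k IH].
    rewrite expr0 mulmx1 mul_diag_mx; apply/matrixP => I J.
    by rewrite !mxE expr0 mul1r.
  rewrite exprSr -mulmxE mulmxA IH -scalemxAr; apply/matrixP => I J.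
  rewrite mxE -mulmxA !mul_diag_mx mxE (restr_qmul lstE) mul0r addr0 !mxE exprSr.
  by ring.
rewrite (_ : series _ = (fun m => invmx T *m
   diag_mx (\row_J series (fun k => (z 0 J * tau) ^+ k / k`!%:R) m) *m T)).
  apply: cvg_mulmx; apply/cvg_mxP => I J.
  have [->|IJ] := eqVneq I J; last first.
    under eq_cvg do rewrite mxE (negPf IJ) mulr0n.
    by rewrite mxE (negPf IJ) mulr0n; exact: cvg_cst.
  under eq_cvg do rewrite mxE eqxx mulr1n mxE.
  by rewrite mxE eqxx mulr1n mxE; exact: expC_series.
apply/funext => m; rewrite -[LHS](mulKmx Tu) -[RHS]mulmxA; congr (_ *m _).
rewrite /series/= mulmx_sumr; apply/matrixP => I J.
rewrite summxE mul_diag_mx mxE [X in X * _]mxE mulr_suml.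
by apply: eq_bigr => k _; rewrite -scalemxAr TA mul_diag_mx !mxE; ring.
Qed.

Lemma expCMn (tau : C) j : expC (tau *+ j) = expC tau ^+ j.
Proof. by elim: j => [|j IH]; rewrite ?mulr0n ?expC0 ?expr0// mulrS expCD IH exprS. Qed.

(** The factor q ^ A_1 is diagonal in the basis of fixed points, so that solutions
    of Frobenius type have the required form. *)
Lemma Sol_is_So X : mx_entire X -> X 0%N = 1%:M -> frobenius_rec X -> is_So z (Sol X).
Proof.
move=> Xe X0 XR; split; first exact/Sol_qDE.
exists (fun r => invmx T *m X r *m T); split; first by rewrite X0 mulmx1 (mulVmx Tu).
exists (fun tau => invmx T *m psum_mx X tau *m T) => tau; split; last first.
  by rewrite expmx_qmul0 /Sol !mulmxA (mulmxK Tu).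
rewrite (_ : series _ = (fun m => invmx T *m (series (fun r => expC tau ^+ r *: X r) m) *m T)).
  apply: cvg_mulmx; apply/cvg_mxP => I J; rewrite mxE.
  have := entire_cvg (q := expC tau) (Xe I J).
  rewrite (_ : series _ = (fun m => (series (fun r => expC tau ^+ r *: X r) m) I J))//.
  apply/funext => m; rewrite /series/= summxE; apply: eq_bigr => r _.
  by rewrite mxE mulrC.
apply/funext => m; rewrite /series/= mulmx_sumr mulmx_suml; apply: eq_bigr => r _.
by rewrite expCMn -scalemxAr -scalemxAl.
Qed.

(** The terms at q = rho + 1 are bounded. *)
Lemma entire_cvg_everywhere (x : nat -> C) :
  (forall tau, cvgn (series (fun r => x r * expC tau ^+ r))) -> entire x.
Proof.
move=> xc rho rho0.
have := xc (ln (rho + 1))%:C; rewrite expC_real lnK ?posrE ?ltr_wpDl// => xcr.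
have /cvg_rnormP/cvgrPdist_lt/(_ 1 ltr01) := cvg_series_cvg_0 xcr.
move=> [N _ NB].
have {}NB r : (N <= r)%N -> rnorm (x r) * (rho + 1) ^+ r <= 1.
  move=> /NB /=; rewrite subr0 sub0r normrN ger0_norm ?rnorm_ge0// rnormM rnormX rnorm_real.
  by rewrite ger0_norm ?addr_ge0// => /ltW.
exists (1 + \sum_(k < N) rnorm (x k) * rho ^+ k) => r.
have [rN|Nr] := ltnP r N.
  rewrite (bigD1 (Ordinal rN))//= addrCA lerDl addr_ge0//.
  by apply: sumr_ge0 => k _; rewrite mulr_ge0 ?rnorm_ge0 ?exprn_ge0.
rewrite (@le_trans _ _ 1)// ?lerDl.
  apply: le_trans (NB r Nr); rewrite ler_wpM2l ?rnorm_ge0// lerXn2r ?nnegrE ?addr_ge0//.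
  by rewrite lerDl.
by apply: sumr_ge0 => k _; rewrite mulr_ge0 ?rnorm_ge0 ?exprn_ge0.
Qed.

Lemma is_SoE S : is_So z S ->
  exists X, [/\ mx_entire X, X 0%N = 1%:M, frobenius_rec X & S = Sol X].
Proof.
move=> [SD [Phi [Phi0 [P PS]]]].
pose X r := T *m Phi r *m invmx T.
have Xc tau I J : series (fun r => X r I J * expC tau ^+ r) @ \oo --> (T *m P tau *m invmx T) I J.
  have [/(@cvg_mulmx _ _ _ _ _ _ _ T (invmx T))/cvg_mxP/(_ I J) + _] := PS tau.
  rewrite (_ : (fun m : nat => _) = series (fun r => X r I J * expC tau ^+ r))//.
  apply/funext => m; rewrite /series/= mulmx_sumr mulmx_suml summxE.
  by apply: eq_bigr => r _; rewrite -scalemxAr -scalemxAl mxE expCMn mulrC.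
have Xe : mx_entire X.
  by move=> I J; apply: entire_cvg_everywhere => tau; apply/cvg_ex; eexists; exact: Xc.
have SX : S = Sol X.
  apply/funext => tau; have [_ ->] := PS tau; rewrite expmx_qmul0 /Sol.
  have -> : psum_mx X tau = T *m P tau *m invmx T.
    by apply/matrixP => I J; rewrite mxE; apply: psumP; exact: Xc.
  by rewrite !mulmxA (mulVmx Tu) mul1mx.
exists X; split=> //; first by rewrite /X Phi0 mulmx1 (mulmxV Tu).
by apply/Sol_qDE => //; rewrite -SX.
Qed.

(** Uniqueness: any solution of the required form comes from coefficients that
    satisfy the recursion and start with the identity. *)
Lemma So_mxE X : mx_entire X -> X 0%N = 1%:M -> frobenius_rec X -> So_mx z = Sol X.
Proof.
move=> Xe X0 XR; rewrite /So_mx.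
have /is_SoE[Y [Ye Y0 YR ->]] : is_So z (get (is_So z)).
  by apply: (getPex (ex_intro _ (Sol X) _)); exact: Sol_is_So.
by congr Sol; apply: frobenius_rec_inj => //; rewrite X0.
Qed.

End Fundamental.

(** * Closure properties of differentiable functions *)

Section Holomorphy.
Variable R : realType.
Local Notation C := R[i].

Lemma differentiable_near_eq (V : normedModType C) (f g : V -> C) (x : V) :
  (\forall y \near x, f y = g y) -> differentiable f x -> differentiable g x.
Proof.
move=> fg df; have dfc := diff_continuous df.
have fgx : f x = g x by exact: (nbhs_singleton fg).
have gL : g \o shift x = cst (g x) + 'd f x +o_ 0 id.
  apply/eqaddoP => e e0; have /eqaddoP/(_ e e0) := diff_locally df.
  have : \forall h \near (0 : V), f (h + x) = g (h + x).
    by move: fg; rewrite (near_shift 0) subr0.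
  apply: filterS2 => h h1; rewrite !fctE /= h1 fgx; exact.
apply/diff_locallyP.
have -> : 'd g x = 'd f x :> (V -> C) by exact: diff_unique.
by split.
Qed.

Lemma rnorm_coord (m n : nat) (A : 'M[C]_(m, n)) i j : rnorm (A i j) <= rnorm A.
Proof.
rewrite -lecR -!rnormE [leRHS]/Num.norm /= mx_normE.
have -> : `|A i j| = (`|A i j|%:nng)%:num by [].
rewrite num_le; exact: (le_bigmax _ (fun p : 'I_m * 'I_n => `|A p.1 p.2|%:nng) (i, j)).
Qed.

Section Combinators.
Variable V : normedModType C.
Implicit Types (f g : V -> C).

Lemma differentiable_sumr (I : Type) (r : seq I) (P : pred I) (f : I -> V -> C) x :
  (forall i, P i -> differentiable (f i) x) ->
  differentiable (fun y => \sum_(i <- r | P i) f i y) x.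
Proof.
move=> fd; elim: r => [|i r IH].
  under [X in differentiable X _]funext do rewrite big_nil.
  exact: differentiable_cst.
have [Pi|Pi] := boolP (P i).
  under [X in differentiable X _]funext do rewrite big_cons Pi.
  exact: (differentiableD (fd i Pi) IH).
by under [X in differentiable X _]funext do rewrite big_cons (negPf Pi).
Qed.

Lemma differentiable_prodr (I : Type) (r : seq I) (P : pred I) (f : I -> V -> C) x :
  (forall i, P i -> differentiable (f i) x) ->
  differentiable (fun y => \prod_(i <- r | P i) f i y) x.
Proof.
move=> fd; elim: r => [|i r IH].
  under [X in differentiable X _]funext do rewrite big_nil.
  exact: differentiable_cst.
have [Pi|Pi] := boolP (P i).
  under [X in differentiable X _]funext do rewrite big_cons Pi.
  exact: (differentiableM (fd i Pi) IH).
by under [X in differentiable X _]funext do rewrite big_cons (negPf Pi).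
Qed.

Lemma differentiable_expC f x : differentiable f x -> differentiable (fun y => expC (f y)) x.
Proof.
move=> df; have [de _] := cderiv_expC 1 (f x).
have -> : (fun y => expC (f y)) = (fun w => expC (1 * w)) \o f.
  by apply/funext => y /=; rewrite mul1r.
exact: differentiable_comp.
Qed.

Definition mxdiff (m n : nat) (A : V -> 'M[C]_(m, n)) x :=
  forall i j, differentiable (fun y => A y i j) x.

Lemma mxdiff_mul (m n p : nat) (A : V -> 'M[C]_(m, n)) (B : V -> 'M[C]_(n, p)) x :
  mxdiff A x -> mxdiff B x -> mxdiff (fun y => A y *m B y) x.
Proof.
move=> Ad Bd i j.
under [X in differentiable X _]funext do rewrite mxE.
by apply: differentiable_sumr => k _; exact: (differentiableM (Ad i k) (Bd k j)).
Qed.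

Lemma differentiable_det (n : nat) (A : V -> 'M[C]_n) x :
  mxdiff A x -> differentiable (fun y => \det (A y)) x.
Proof.
move=> Ad; rewrite /determinant; apply: differentiable_sumr => s _.
apply: differentiableM; first exact: differentiable_cst.
by apply: differentiable_prodr => i _; exact: Ad.
Qed.

(** By the cofactor formula, valid only where the determinant is invertible, hence
    near x. *)
Lemma mxdiff_inv (n : nat) (A : V -> 'M[C]_n) x :
  mxdiff A x -> (\forall y \near x, A y \in unitmx) -> mxdiff (fun y => invmx (A y)) x.
Proof.
move=> Ad Au i j.
apply: (@differentiable_near_eq _ (fun y => (\det (A y))^-1 * cofactor (A y) j i)).
  by apply: filterS Au => y yu; rewrite /invmx yu !mxE.
apply: differentiableM.
  apply: differentiableV; first exact: differentiable_det.
  by have := nbhs_singleton Au; rewrite unitmxE unitfE.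
rewrite /cofactor; apply: differentiableM; first exact: differentiable_cst.
apply: differentiable_det => k l.
under [X in differentiable X _]funext do rewrite !mxE.
exact: Ad.
Qed.

End Combinators.
End Holomorphy.

(** * The hypergeometric coefficients *)

Section Coefficients.
Variables (R : realType) (n : nat).
Local Notation C := R[i].
Local Notation V := 'rV[C]_n.

(** Up to the factor B_one z J q ^ (z_J + r), the opposite of the residue of
    the master function at t = z_J + r. *)
Definition kappa (z : V) (J : 'I_n) (r : nat) : C :=
  (-1) ^+ (n.+1 * r) / r`!%:R
  * \prod_(a | a != J) \prod_(k < r.+1) (z 0 a - z 0 J - k%:R)^-1.

(** Coefficients of the solutions given by the residues; the products are the
    restrictions of the weight function W at t = z_J + r. *)
Definition mcoef (z : V) (r : nat) : 'M[C]_n :=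
  \matrix_(I, J) (kappa z J r * \prod_(b | b != I) (z 0 b - (z 0 J + r%:R))).

Lemma Omega_shift_neq0 (z : V) (a J : 'I_n) (k : nat) : Omega z -> a != J ->
  z 0 a - z 0 J - k%:R != 0.
Proof. by move=> zO aJ; rewrite subr_eq0; exact: (zO a J aJ k). Qed.

(** For r = 0 the weight at t = z_J restricts to zero at every fixed point other
    than pt_J, and kappa is the inverse of its restriction at pt_J. *)
Lemma mcoef0 (z : V) : Omega z -> mcoef z 0 = 1%:M.
Proof.
move=> zO; apply/matrixP => I J; rewrite !mxE /kappa muln0 expr0 fact0 divr1 mul1r addr0.
have [->|IJ] := eqVneq I J.
  rewrite -big_split /= big1 // => a aJ; rewrite big_ord1 subr0 mulVf//.
  exact: Omega_inj.
by rewrite [X in _ * X](bigD1 J)/= 1?eq_sym// subrr mul0r mulr0.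
Qed.

Lemma kappaS (z : V) J r : Omega z ->
  r.+1%:R * kappa z J r.+1 * \prod_(a | a != J) (z 0 a - z 0 J - r.+1%:R) =
  (-1) ^+ n.+1 * kappa z J r.
Proof.
move=> zO; rewrite /kappa mulnS exprD factS natrM.
under eq_bigr do rewrite big_ord_recr /=.
rewrite big_split /= -mulrA -[X in _ * X]mulrA -[X in _ * (_ * X)]mulrA -big_split /=.
rewrite [X in _ * (_ * (_ * X))]big1 => [|a aJ]; last first.
  by rewrite mulVf//; exact: Omega_shift_neq0.
have r1 : (r.+1%:R : C) != 0 by rewrite pnatr_eq0.
have r2 : (r`!%:R : C) != 0 by rewrite pnatr_eq0 -lt0n fact_gt0.
move: r1 r2; set x := (r.+1%:R : C); set y := (r`!%:R : C) => r1 r2.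
by field; apply/andP.
Qed.

(** The factor z_J + r - z_I completes the product over b != I to the full one, in
    which the factor b = J is - r; this cancels the r of the factorial in kappa.
    On the other side the last coordinate of the weight is (-1) ^ (n - 1). *)
Lemma mcoef_rec (lst : 'I_n) (z : V) : lst = n.-1 :> nat -> Omega z ->
  frobenius_rec lst z (mcoef z).
Proof.
move=> lstE zO I J [|r] /=.
  rewrite mcoef0// mxE; have [->|IJ] := eqVneq I J; last by rewrite mulr0.
  by rewrite addr0 subrr mul0r.
transitivity (kappa z J r * (-1) ^+ n.-1); last first.
  rewrite -(last_coord lstE (z 0 J + r%:R) zO) mxE mulr_sumr; apply: eq_bigr => K _.
  by rewrite !mxE; ring.
rewrite mxE.
have -> : (-1 : C) ^+ n.-1 = (-1) ^+ n.+1.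
  by rewrite -{2}(prednK (n_gt0 lst)) !exprS; ring.
rewrite [RHS]mulrC -kappaS//.
have E : (z 0 J + r.+1%:R - z 0 I) * \prod_(b | b != I) (z 0 b - (z 0 J + r.+1%:R)) =
   r.+1%:R * \prod_(a | a != J) (z 0 a - z 0 J - r.+1%:R).
  have -> : z 0 J + r.+1%:R - z 0 I = - (z 0 I - (z 0 J + r.+1%:R)) by ring.
  rewrite mulNr -(bigD1 I (P := xpredT) (F := fun b => z 0 b - (z 0 J + r.+1%:R)))//=.
  rewrite (bigD1 J)//= -mulNr; congr (_ * _); first by ring.
  by apply: eq_bigr => b _; ring.
by rewrite mulrCA E; ring.
Qed.

End Coefficients.

(** * Locally uniform bounds on Omega *)

Section OmegaJets.
Variables (R : realType) (n : nat).
Local Notation C := R[i].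
Local Notation V := 'rV[C]_n.

(** Instead of a minimum over a possibly empty type, the witness is the inverse of
    one plus the sum of the inverses. *)
Lemma finite_lower_bound (I : finType) (P : I -> R -> Prop) :
  (forall i d e, 0 < e -> e <= d -> P i d -> P i e) ->
  (forall i, exists2 d : R, 0 < d & P i d) -> exists2 d : R, 0 < d & forall i, P i d.
Proof.
move=> Pm H.
have /choice[d /all_and2[d0 dP]] : forall i, exists d : R, 0 < d /\ P i d.
  by move=> i; have [d d0 dP] := H i; exists d.
have S0 : 0 < 1 + \sum_i (d i)^-1.
  by rewrite ltr_wpDr// sumr_ge0// => i _; rewrite invr_ge0 ltW.
exists (1 + \sum_i (d i)^-1)^-1; first by rewrite invr_gt0.
move=> i; apply: Pm (dP i); first by rewrite invr_gt0.
rewrite -[leRHS]invrK lef_pV2 ?posrE ?invr_gt0//.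
rewrite (bigD1 i)//= addrCA lerDl addr_ge0// sumr_ge0// => j _.
by rewrite invr_ge0 ltW.
Qed.

(** The differences z_a - z_J keep a positive distance to the integers since only
    finitely many integers are at distance less than 1. *)
Lemma Omega_dist (z : V) : Omega z ->
  exists2 d : R, 0 < d & forall (a J : 'I_n), a != J -> forall m : int,
    d <= rnorm (z 0 a - z 0 J - m%:~R).
Proof.
move=> zO.
have [||d d0 dP] := @finite_lower_bound ('I_n * 'I_n)%type
  (fun p d => p.1 != p.2 -> forall m : int, d <= rnorm (z 0 p.1 - z 0 p.2 - m%:~R)).
- by move=> p d e e0 ed dP p12 m; apply: le_trans ed (dP p12 m).
- move=> [a J] /=; have [->|aJ] := eqVneq a J; first by exists 1.
  have np (b c : 'I_n) : b != c -> nonpole (z 0 b - z 0 c).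
    move=> bc k; have := zO b c bc (- k%:Z); rewrite -subr_eq0.
    by rewrite rmorphN opprK.
  have [d d0 dk] := nonpole_dist (np _ _ aJ).
  have [|e e0 ek] := nonpole_dist (np J a _); first by rewrite eq_sym.
  exists (Num.min d e); first by rewrite lt_min d0.
  move=> _ [k|k]; rewrite ge_min.
    have -> : z 0 a - z 0 J - (Posz k)%:~R = - (z 0 J - z 0 a + k%:R) by rewrite -pmulrn; ring.
    by rewrite rnormN ek orbT.
  have -> : z 0 a - z 0 J - (Negz k)%:~R = z 0 a - z 0 J + k.+1%:R.
    by rewrite -[(Negz k)%:~R]/(- (k.+1%:R)) opprK.
  by rewrite dk.
by exists d => // a J; exact: (dP (a, J)).
Qed.

(** In a ball where all z_a - z_J stay away from the integers, each of the
    (n - 1) (r + 1) inverses has a jet of bounded size and each of the n - 1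
    factors of the weight grows at most like 2 ^ r; the factorial wins, so
    that the bounds are summable over r even after multiplication by q ^ r. *)
Lemma mcoef_jet (z : V) : Omega z -> exists2 rho : R, 0 < rho &
  (forall h : V, rnorm h <= 1 -> Omega (z + rho%:C *: h)) /\
  exists B D : R, [/\ 0 <= B, 0 <= D & forall I J r,
    has_jet (fun h : V => mcoef (z + rho%:C *: h) r I J) (B * (D ^+ r / r`!%:R))].
Proof.
move=> zO; have [d d0 dP] := Omega_dist zO.
pose rho := d / 4; have rho0 : 0 < rho by rewrite divr_gt0.
exists rho => //.
have coordE (h : V) a J : (z + rho%:C *: h) 0 a - (z + rho%:C *: h) 0 J =
    (z 0 a - z 0 J) + rho%:C * (h 0 a - h 0 J).
  by rewrite !mxE; ring.
have linj a J : has_jet (fun h : V => rho%:C * (h 0 a - h 0 J)) (2 * rho).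
  eexists; apply: jet_lin.
  - by move=> x u v; rewrite !mxE; ring.
  - by rewrite mulr_ge0// ltW.
  - move=> h; rewrite rnormM rnorm_real gtr0_norm//.
    have -> : 2 * rho * rnorm h = rho * (rnorm h + rnorm h) by ring.
    rewrite (ler_wpM2l (ltW rho0))//; apply: (le_trans (ler_rnormD _ _)); rewrite rnormN.
    by apply: lerD; exact: rnorm_coord.
split.
  move=> h h1 a J aJ m; rewrite coordE -subr_eq0 -rnorm_eq0 gt_eqF//.
  have -> : z 0 a - z 0 J + rho%:C * (h 0 a - h 0 J) - m%:~R =
     (z 0 a - z 0 J - m%:~R) - (- (rho%:C * (h 0 a - h 0 J))) by ring.
  apply: lt_le_trans (ler_rnormB _ _); rewrite subr_gt0 rnormN.
  apply: le_lt_trans (has_jet_bound h1 (linj a J)) _.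
  by apply: lt_le_trans (dP a J aJ m); rewrite /rho; lra.
pose D0 := (d / 2)^-1.
have D00 : 0 <= D0 by rewrite invr_ge0 divr_ge0// ltW.
have invj a J k : a != J -> has_jet (fun h : V =>
    ((z + rho%:C *: h) 0 a - (z + rho%:C *: h) 0 J - k%:R)^-1) D0.
  move=> aJ; have dk : d <= rnorm (z 0 a - z 0 J - k%:R) by exact: (dP a J aJ k).
  have rd : 2 * rho <= d / 2 by rewrite /rho; lra.
  have lt2 : 2 * rho < rnorm (z 0 a - z 0 J - k%:R).
    by apply: lt_le_trans dk; rewrite /rho; lra.
  apply: (@has_jet_le _ _ (rnorm (z 0 a - z 0 J - k%:R) - 2 * rho)^-1).
    rewrite lef_pV2 ?posrE ?subr_gt0 ?divr_gt0//.
    by rewrite /rho; have := dk; set x := rnorm _; lra.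
  apply: has_jet_ext (has_jet_inv (linj a J) lt2) => h _.
  by rewrite coordE; congr (_ ^-1); ring.
pose K := 1 + 2 * rho + \sum_a \sum_b rnorm (z 0 a - z 0 b).
have S0 : 0 <= \sum_a \sum_b rnorm (z 0 a - z 0 b).
  by apply: sumr_ge0 => a _; apply: sumr_ge0 => b _; exact: rnorm_ge0.
have K1 : 1 <= K by rewrite /K -addrA lerDl addr_ge0// mulr_ge0// ltW.
have facj b J r : has_jet (fun h : V => (z + rho%:C *: h) 0 b - ((z + rho%:C *: h) 0 J + r%:R))
    (K * 2 ^+ r).
  have := has_jetD (has_jetD (linj b J) (has_jet_cst _ (z 0 b - z 0 J))) (has_jet_cst _ (- r%:R)).
  move=> /(@has_jet_le _ _ _ (K * 2 ^+ r)) H.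
  apply: has_jet_ext (H _) => [h _|]; first by rewrite !mxE; ring.
  rewrite rnormN rnorm_natr.
  have h1 : rnorm (z 0 b - z 0 J) <= \sum_a \sum_b rnorm (z 0 a - z 0 b).
    rewrite (bigD1 b)//= (bigD1 J)//= -addrA lerDl addr_ge0//.
      by apply: sumr_ge0 => c _; exact: rnorm_ge0.
    by apply: sumr_ge0 => a _; apply: sumr_ge0 => c _; exact: rnorm_ge0.
  have h2 : 1 + r%:R <= 2 ^+ r :> R.
    by rewrite nat1r -natrX ler_nat ltn_expl.
  apply: (@le_trans _ _ (K * (1 + r%:R))); last by rewrite ler_wpM2l// (le_trans ler01).
  rewrite mulrDr mulr1 lerD//; first by rewrite /K; move: h1; set x := rnorm _; lra.
  by rewrite ler_peMl.
exists ((D0 * K) ^+ n.-1), ((D0 * 2) ^+ n.-1); split.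
- by rewrite exprn_ge0// mulr_ge0// (le_trans ler01).
- by rewrite exprn_ge0// mulr_ge0.
move=> I J r.
have cI (L : 'I_n) : #|(fun b => b != L)| = n.-1 by rewrite cardC1 card_ord.
have j1 := has_jet_prod (index_enum _) (fun a aJ =>
  has_jet_prod (index_enum 'I_r.+1) (P := xpredT) (fun k _ => invj a J (nat_of_ord k) aJ)).
have j2 := has_jet_prod (index_enum _) (P := fun b => b != I) (fun b _ => facj b J r).
have := has_jetM (has_jetZ ((-1) ^+ (n.+1 * r) / r`!%:R) j1) j2.
move=> /(@has_jet_le _ _ _ ((D0 * K) ^+ n.-1 * (((D0 * 2) ^+ n.-1) ^+ r / r`!%:R))) H.
apply: has_jet_ext (H _) => [h _|]; first by rewrite [mcoef _ _ _ _]mxE.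
rewrite rnormM rnormX rnormN rnorm1 expr1n mul1r rnormV rnorm_natr.
rewrite !prodr_const card_ord !cI.
rewrite le_eqVlt; apply/orP; left; apply/eqP.
rewrite !exprMn -!exprM.
have -> : D0 ^+ (r.+1 * n.-1) = D0 ^+ n.-1 * D0 ^+ (n.-1 * r).
  by rewrite mulSn exprD [(r * _)%N]mulnC.
by rewrite [(r * _)%N]mulnC; ring.
Qed.

Lemma Omega_nbhs (z : V) : Omega z -> \forall y \near z, Omega y.
Proof.
move=> /mcoef_jet[rho rho0 [H _]].
have r0 : (0 : C) < rho%:C by rewrite ltcR.
near=> y.
have yz : `|z - y| <= rho%:C by near: y; exact: cvgr_dist_le.
have rn : rho%:C != 0 :> C by rewrite gt_eqF.
have -> : y = z + rho%:C *: (rho%:C^-1 *: (y - z)).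
  by rewrite scalerA divff// scale1r addrC subrK.
apply: H; rewrite rnormZ rnormV rnorm_real gtr0_norm// mulrC ler_pdivrMr// mul1r.
by move: yz; rewrite rnormE lecR rnormB.
Unshelve. all: by end_near. Qed.

Lemma mcoef_entire (z : V) : Omega z -> mx_entire (mcoef z).
Proof.
move=> /mcoef_jet[rho rho0 [_ [B [D [B0 D0 H]]]]] I J.
apply: (@entire_le _ _ B D) => // r.
have := has_jet_bound _ (H I J r); move=> /(_ 0); rewrite scaler0 addr0 rnorm0; exact.
Qed.

Lemma psum_mcoef_differentiable (z : V) (tau : C) I J : Omega z ->
  differentiable (fun y => psum (fun r => mcoef y r I J) (expC tau)) z.
Proof.
move=> zO; have [rho rho0 [HO [B [D [B0 D0 H]]]]] := mcoef_jet zO.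
have [L j] : has_jet (fun h => psum (fun r => mcoef (z + rho%:C *: h) r I J) (expC tau))
    (B * expR (D * rnorm (expC tau))).
  apply: (@has_jet_series _ _ (fun r h => mcoef (z + rho%:C *: h) r I J * expC tau ^+ r)
    (fun r => B * (D ^+ r / r`!%:R) * rnorm (expC tau) ^+ r)).
  - by move=> r; rewrite -rnormX; exact: has_jetM (H I J r) (has_jet_cst _ _).
  - move=> m; have q0 : 0 <= D * rnorm (expC tau) by rewrite mulr_ge0 ?rnorm_ge0.
    apply: le_trans (ler_wpM2l B0 (sum_exp_le m q0)); rewrite mulr_sumr.
    by apply: ler_sum => r _; rewrite exprMn -mulrA [_ / _ * _]mulrAC.
  - by move=> h h1; apply: entire_cvg; apply: mcoef_entire; exact: HO.
by have [] := @jet_differentiable R V (fun y => psum (fun r => mcoef y r I J) (expC tau))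
  z L rho _ rho0 j.
Qed.

End OmegaJets.

(** * The residues of the master function *)

Section ResidueSeries.
Variables (R : realType) (n : nat).
Local Notation C := R[i].
Local Notation V := 'rV[C]_n.

Lemma quotient_roots_prod (z : V) (I : 'I_n) (f : C -> C) :
  \prod_(y <- [seq z 0 a | a <- enum 'I_n & a != I]) f y = \prod_(a | a != I) f (z 0 a).
Proof. by rewrite big_map big_filter big_enum_cond. Qed.

Lemma weightE (t : C) (z : V) a :
  weight t z a 0 = \sum_I invmx (restr_mx z) a I * \prod_(b | b != I) (z 0 b - t).
Proof.
rewrite /weight /coh_class mxE; apply: eq_bigr => I _.
by rewrite [X in _ * X]mxE quotient_roots_prod.
Qed.

(** The restriction at pt_J of the class B(1). *)
Definition B_one (z : V) (J : 'I_n) : C :=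
  \prod_(a | a != J) Gamma (1 + z 0 a - z 0 J)
  * expC (piI R * (\sum_i z 0 i - z 0 J *+ n)).

Lemma restr_B (P : laurent R n) (z : V) : Omega z ->
  restr_mx z *m B_laurent P z = \col_J (B_one z J * Ch_laurent P z (z 0 J)).
Proof.
move=> zO; rewrite /B_laurent /coh_class mulKVmx ?restr_mx_unit//.
by apply/colP => J; rewrite !mxE (quotient_roots_prod z J (fun y => Gamma (1 + y - z 0 J))).
Qed.

Lemma expC_piI : expC (- piI R) = -1.
Proof.
rewrite /expC /piI /= oppr0 expR0 mul1r cosN sinN cospi sinpi oppr0.
by rewrite -[RHS]/(-1 -i* 0) oppr0.
Qed.

Lemma int_sub_neq0 (m : int) (w : C) : 0 < rnorm w -> rnorm w < 1 -> m%:~R - w != 0.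
Proof.
move=> w0 w1; rewrite subr_eq0; apply/eqP => mw; move: w0 w1; rewrite -mw.
case: m {mw} => k; last first.
  rewrite -[(Negz k)%:~R]/(- (k.+1%:R)) rnormN rnorm_natr => _.
  by rewrite ltrn1.
by rewrite -pmulrn rnorm_natr ltr0n ltrn1 => /prednK <-.
Qed.

Lemma Omega_sub_neq0 (z : V) (d : R) (w : C) (a J : 'I_n) (m : int) :
  (forall (a J : 'I_n), a != J -> forall m : int, d <= rnorm (z 0 a - z 0 J - m%:~R)) ->
  a != J -> rnorm w < d -> z 0 a - z 0 J - m%:~R - w != 0.
Proof.
move=> zd aJ wd; rewrite subr_eq0; apply/eqP => E.
by have := zd a J aJ m; rewrite E leNgt wd.
Qed.

Lemma differentiable_idC (w : C) : differentiable (fun w : C => w) w.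
Proof. exact: (@ex_diff _ _ _ _ _ _ _ (is_diff_id w)). Qed.

(** Only the factor Gamma (z_J - t) is singular at t = z_J + r. Shifting its
    argument by r + 1 exhibits the simple pole and leaves Gamma near 1; the other
    Gamma factors are shifted to Gamma (1 + z_b - z_J), which produces kappa,
    and the exponentials produce q ^ (z_J + r) and the signs. *)
Lemma residue_master (z : V) (tau : C) (J a : 'I_n) (r : nat) : Omega z ->
  residue (fun t => master t tau z * weight t z a 0) (z 0 J + r%:R) =
  - (B_one z J * expC (z 0 J * tau) *
     (expC tau ^+ r * \sum_I invmx (restr_mx z) a I * mcoef z r I J)).
Proof.
move=> zO; have [d d0 zd] := Omega_dist zO.
pose wt (t : C) := \sum_I invmx (restr_mx z) a I * \prod_(b | b != I) (z 0 b - t).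
(* The integrand at z_J + r + w, multiplied by w. *)
pose G (w : C) := expC (piI R * \sum_i z 0 i)
  * expC ((z 0 J + r%:R + w) * (tau - piI R *+ n))
  * (\prod_(b | b != J) Gamma (z 0 b - (z 0 J + r%:R + w)))
  * (- (Gamma (1 - w) / \prod_(k < r) (- w - r%:R + k%:R)))
  * wt (z 0 J + r%:R + w).
have r0 : 0 < Num.min 1 d by rewrite lt_min ltr01.
have np1 (w : C) : rnorm w < 1 -> nonpole (1 - w).
  move=> w1 k; rewrite addrAC nat1r -rnorm_eq0 gt_eqF//.
  apply: lt_le_trans (ler_rnormB _ _); rewrite subr_gt0 rnorm_natr.
  by apply: (lt_le_trans w1); rewrite ler1n.
have np2 (w : C) b : rnorm w < d -> b != J -> nonpole (z 0 b - (z 0 J + r%:R + w)).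
  move=> wd bJ k.
  have -> : z 0 b - (z 0 J + r%:R + w) + k%:R = z 0 b - z 0 J - (r%:Z - k%:Z)%:~R - w.
    by rewrite intrB -!pmulrn; ring.
  exact: (Omega_sub_neq0 _ zd bJ wd).
have pn (w : C) : rnorm w < 1 -> \prod_(k < r) (- w - r%:R + k%:R) != 0.
  move=> w1; apply/prodf_neq0 => k _.
  have -> : - w - r%:R + k%:R = - ((r - k)%:R - (- w)) by rewrite natrB ?(ltnW (ltn_ord k))//; ring.
  rewrite oppr_eq0 -rnorm_eq0 gt_eqF//; apply: lt_le_trans (ler_rnormB _ _).
  by rewrite rnormN rnorm_natr subr_gt0 (lt_le_trans w1)// ler1n subn_gt0.
rewrite (@residue_simple_pole _ _ G _ _ r0); last 2 first.
- move=> w w0; rewrite lt_min => /andP[w1 wd].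
  rewrite /master weightE /G -/(wt _).
  rewrite [\prod_(b < n) _](bigD1 J)//=.
  have -> : z 0 J - (z 0 J + r%:R + w) = - w - r%:R by ring.
  rewrite (@Gamma_shift _ (- w - r%:R) r.+1); last first.
    move=> k; have := int_sub_neq0 (k%:Z - r%:Z) w0 w1.
    by rewrite intrB -!pmulrn; congr (_ != _); ring.
  rewrite big_ord_recr /=.
  have -> : - w - r%:R + r.+1%:R = 1 - w by rewrite -natr1; ring.
  have -> : - w - r%:R + r%:R = - w by ring.
  have wn : w != 0 by rewrite -rnorm_eq0 gt_eqF.
  have := pn w w1; set p := \prod_(k < r) _ => p0.
  rewrite invfM invrN; ring.
- move=> w; rewrite lt_min => /andP[w1 wd].
  apply: differentiable_continuous.
  have lin (c : C) : differentiable (fun w : C => c + w) w.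
    exact: (differentiableD (differentiable_cst _ _) (differentiable_idC w)).
  have linN (c : C) : differentiable (fun w : C => c - w) w.
    exact: (differentiableB (differentiable_cst _ _) (differentiable_idC w)).
  have dG (s : C -> C) : nonpole (s w) -> differentiable s w ->
      differentiable (fun w => Gamma (s w)) w.
    by move=> sn ds; exact: (differentiable_comp ds (Gamma_differentiable sn)).
  rewrite /G; apply: differentiableM; last first.
    rewrite /wt; apply: differentiable_sumr => I _.
    apply: differentiableM; first exact: differentiable_cst.
    apply: differentiable_prodr => b _.
    exact: (differentiableB (differentiable_cst _ _) (lin _)).
  apply: differentiableM; last first.
    apply: differentiableN; apply: differentiableM.
      by apply: dG; [exact: np1|exact: linN].
    apply: differentiableV; last exact: pn.
    apply: differentiable_prodr => k _.
    apply: (differentiableD _ (differentiable_cst _ _)).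
    apply: (differentiableD _ (differentiable_cst _ _)).
    exact: (differentiableN (differentiable_idC w)).
  apply: differentiableM; last first.
    apply: differentiable_prodr => b bJ; apply: dG; first exact: np2.
    exact: (differentiableB (differentiable_cst _ _) (lin _)).
  apply: differentiableM; first exact: differentiable_cst.
  apply: differentiable_expC; apply: differentiableM; last exact: differentiable_cst.
  exact: lin.
rewrite /G !addr0 !subr0 Gamma_1 /wt.
have E1 : \prod_(b | b != J) Gamma (z 0 b - (z 0 J + r%:R)) =
    \prod_(b | b != J) Gamma (1 + z 0 b - z 0 J) *
    \prod_(b | b != J) \prod_(k < r.+1) (z 0 b - z 0 J - k%:R)^-1.
  rewrite -big_split /=; apply: eq_bigr => b bJ.
  have := np2 0 b; rewrite rnorm0 addr0 => /(_ d0 bJ) np.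
  rewrite (Gamma_shift r.+1 np); congr (Gamma _ * _).
    by rewrite -natr1; ring.
  rewrite prodfV; congr (_ ^-1); rewrite (reindex_inj rev_ord_inj) /=.
  apply: eq_bigr => k _; rewrite subSS natrB; last by rewrite -ltnS.
  by ring.
have E2 : \prod_(k < r) (- 0 - r%:R + k%:R) = (-1) ^+ r * r`!%:R :> C.
  rewrite oppr0 add0r.
  rewrite (reindex_inj rev_ord_inj) /=.
  rewrite (eq_bigr (fun k : 'I_r => - (k.+1%:R : C))); last first.
    by move=> k _; rewrite natrB//; ring.
  rewrite prodrN card_ord; congr (_ * _).
  by rewrite -natr_prod fact_prod big_add1 /= big_mkord.
have E3 : expC (piI R * \sum_i z 0 i) * expC ((z 0 J + r%:R) * (tau - piI R *+ n)) =
   expC (piI R * (\sum_i z 0 i - z 0 J *+ n)) * expC (z 0 J * tau) * expC tau ^+ r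
   * (-1) ^+ (n * r).
  rewrite -expC_piI -!expCMn -!expCD; congr expC.
  move: (piI R) (\sum_i z 0 i) (z 0 J) => p s x.
  rewrite -[p *+ n]mulr_natr -[x *+ n]mulr_natr -[tau *+ r]mulr_natr.
  rewrite -[(- p) *+ _]mulr_natr natrM; move: (n%:R : C) (r%:R : C) => n' r'.
  by ring.
rewrite E1 E2 E3.
have E4 : ((-1) ^+ r * r`!%:R)^-1 = (-1) ^+ r / r`!%:R :> C.
  by rewrite invfM -exprVn invrN invr1.
rewrite E4 mul1r mulrN mulNr; congr (- _).
have -> : \sum_I invmx (restr_mx z) a I * mcoef z r I J = kappa z J r *
   \sum_I invmx (restr_mx z) a I * \prod_(b | b != I) (z 0 b - (z 0 J + r%:R)).
  by rewrite mulr_sumr; apply: eq_bigr => I _; rewrite mxE; ring.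
rewrite /kappa /B_one mulSn exprD; ring.
Qed.

End ResidueSeries.

(** * The maps theta, S^o and B *)

Section Main.
Variables (R : realType) (n : nat).
Local Notation C := R[i].
Local Notation V := 'rV[C]_n.
Variable lst : 'I_n.
Hypothesis lstE : lst = n.-1 :> nat.

Lemma So_mx_mcoef (z : V) : Omega z -> So_mx z = Sol z (mcoef z).
Proof.
move=> zO; apply: (So_mxE lstE zO); first exact: mcoef_entire.
  exact: mcoef0.
exact: mcoef_rec.
Qed.

Lemma differentiable_coordC (z : V) i : differentiable (fun y : V => y 0 i) z.
Proof. exact: differentiable_coord. Qed.

Lemma mxdiff_restr (z : V) : mxdiff (@restr_mx R n) z.
Proof.
move=> I a; under [X in differentiable X _]funext do rewrite restr_mxE.
have -> : (fun y : V => y 0 I ^+ a) = (fun y => \prod_(i < a) y 0 I).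
  by apply/funext => y; rewrite prodr_const card_ord.
by apply: differentiable_prodr => _ _; exact: differentiable_coordC.
Qed.

Lemma mxdiff_restr_inv (z : V) : Omega z -> mxdiff (fun y => invmx (restr_mx y)) z.
Proof.
move=> zO; apply: mxdiff_inv; first exact: mxdiff_restr.
by apply: filterS (Omega_nbhs zO) => y; exact: restr_mx_unit.
Qed.

Lemma mxdiff_Sol (z : V) tau : Omega z -> mxdiff (fun y => Sol y (mcoef y) tau) z.
Proof.
move=> zO; apply: mxdiff_mul; last exact: mxdiff_restr.
apply: mxdiff_mul; first exact: mxdiff_restr_inv.
move=> I J; under [X in differentiable X _]funext do rewrite psum_mx_diagE.
apply: differentiableM; first exact: psum_mcoef_differentiable.
apply: differentiable_expC; apply: differentiableM; last exact: differentiable_cst.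
exact: differentiable_coordC.
Qed.

Lemma So_sol_space (alpha : V -> 'cV[C]_n) : H_Omega alpha -> sol_space (So alpha).
Proof.
move=> aH; split=> [z zO tau|tau a z zO].
  have SD : solves_qDE z (So_mx z).
    rewrite So_mx_mcoef//; apply/(Sol_qDE lstE zO); first exact: mcoef_entire.
    exact: mcoef_rec.
  have := is_derive_mulmx 1%:M (alpha z) (SD tau); rewrite mul1mx -mulmxA.
  by under [X in is_derive _ _ X]funext do rewrite mul1mx.
apply: (@differentiable_near_eq _ _ (fun y => (Sol y (mcoef y) tau *m alpha y) a 0)).
  by apply: filterS (Omega_nbhs zO) => y yO; rewrite /So So_mx_mcoef.
apply: mxdiff_mul; first exact: mxdiff_Sol.
by move=> i j; rewrite (ord1 j); exact: aH.
Qed.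

Lemma H_Omega_B_laurent (P : laurent R n) : H_Omega (B_laurent P).
Proof.
move=> a z zO; apply: mxdiff_mul; first exact: mxdiff_restr_inv.
move=> I j; under [X in differentiable X _]funext do rewrite mxE.
have coordD (b c : 'I_n) : differentiable (fun y : V => 1 + y 0 b - y 0 c) z.
  apply: differentiableB; last exact: differentiable_coordC.
  by apply: differentiableD; [exact: differentiable_cst|exact: differentiable_coordC].
apply: differentiableM; first apply: differentiableM.
- under [X in differentiable X _]funext => y do
    rewrite (quotient_roots_prod y I (fun w => Gamma (1 + w - y 0 I))).
  apply: differentiable_prodr => b bI.
  apply: (differentiable_comp (coordD b I)); apply: Gamma_differentiable => k.
  have := zO b I bI (Negz k); rewrite -subr_eq0 -[(Negz k)%:~R]/(- (k.+1%:R)).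
  by congr (_ != _); rewrite opprK -natr1; ring.
- apply: differentiable_expC; apply: differentiableM; first exact: differentiable_cst.
  apply: differentiableB.
    by apply: differentiable_sumr => i _; exact: differentiable_coordC.
  under [X in differentiable X _]funext do rewrite -mulr_natr.
  by apply: differentiableM; [exact: differentiable_coordC|exact: differentiable_cst].
- rewrite /Ch_laurent /lext; apply: differentiable_sumr => k _.
  apply: differentiableM; first exact: differentiable_cst.
  apply: differentiableM.
    apply: differentiable_expC; apply: differentiableM; first exact: differentiable_cst.
    exact: differentiable_coordC.
  apply: differentiable_expC; apply: differentiableM; first exact: differentiable_cst.
  apply: differentiable_sumr => i _; apply: differentiableM; first exact: differentiable_cst.
  exact: differentiable_coordC.
Qed.

(** Psi_J is S^o applied to B_one z J times the class of the fixed point pt_J: this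
    is where Gamma classes appear. *)
Lemma Psi_resE (J : 'I_n) tau (z : V) : Omega z ->
  Psi_res J tau z = B_one z J *: (Sol z (mcoef z) tau *m (invmx (restr_mx z) *m delta_mx J 0)).
Proof.
move=> zO; apply/colP => a; rewrite /Psi_res mxE.
have me := mcoef_entire zO.
have ye : entire (fun r => \sum_I invmx (restr_mx z) a I * mcoef z r I J).
  by apply: entire_sum => I; apply: entireZ; exact: me.
have -> : limn (series (fun r => residue (fun t => master t tau z * weight t z a 0)
    (z 0 J + r%:R))) = - (B_one z J * expC (z 0 J * tau)) *
    psum (fun r => \sum_I invmx (restr_mx z) a I * mcoef z r I J) (expC tau).
  apply: cvg_lim; first exact: norm_hausdorff.
  rewrite (_ : series _ = (fun m => - (B_one z J * expC (z 0 J * tau)) *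
    series (fun r => (\sum_I invmx (restr_mx z) a I * mcoef z r I J) * expC tau ^+ r) m)).
    by apply: cvgM; [exact: cvg_cst|exact: entire_cvg].
  apply/funext => m; rewrite /series/= mulr_sumr; apply: eq_bigr => r _.
  by rewrite residue_master//; ring.
rewrite mulNr opprK psum_sum => [|I]; last by apply: entireZ; exact: me.
rewrite mxE -mulrA; congr (_ * _).
rewrite /Sol -!mulmxA (mulmxA (restr_mx z)) (mulmxV (restr_mx_unit zO)) mul1mx.
rewrite mxE mulr_sumr; apply: eq_bigr => I _.
rewrite psumZ; last exact: me.
rewrite mulrCA; congr (_ * _).
rewrite mulmxA mxE (bigD1 J)//= big1 ?addr0 => [|K KJ].
  by rewrite psum_mx_diagE !mxE !eqxx mulr1 mulrC.
by rewrite [delta_mx _ _ _ _]mxE (negPf KJ) mulr0.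
Qed.

(** The classes of the fixed points form a basis in which B has coordinates
    B_one z J Ch(z_J). *)
Lemma theta_laurent_So (P : laurent R n) tau (z : V) : Omega z ->
  theta_laurent P tau z = So (B_laurent P) tau z.
Proof.
move=> zO; rewrite theta_laurentE /So So_mx_mcoef//.
have -> : B_laurent P z = \sum_J (Ch_laurent P z (z 0 J) * B_one z J) *:
    (invmx (restr_mx z) *m delta_mx J 0).
  rewrite -[LHS](mulKmx (restr_mx_unit zO)) restr_B//.
  under eq_bigr do rewrite scalemxAr; rewrite -mulmx_sumr; congr (_ *m _).
  apply/colP => J; rewrite mxE summxE (bigD1 J)//= big1 ?addr0 => [|K KJ].
    by rewrite !mxE !eqxx mulr1 mulrC.
  by rewrite !mxE eq_sym (negPf KJ) mulr0.
rewrite mulmx_sumr; apply: eq_bigr => J _.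
by rewrite Psi_resE// scalerA -scalemxAr.
Qed.

(** As q tends to 0 the power series tends to the identity, so that its determinant
    is nonzero for some q. *)
Lemma Sol_unit (z : V) X : Omega z -> mx_entire X -> X 0%N = 1%:M ->
  exists tau, Sol z X tau \in unitmx.
Proof.
move=> zO Xe X0.
pose A (q : C) : 'M[C]_n := \matrix_(I, J) psum (fun r => X r I J) q.
have Ad : differentiable (fun q => \det (A q)) 0.
  apply: differentiable_det => I J; under [X in differentiable X _]funext do rewrite mxE.
  by have [] := psum_cderiv 0 (Xe I J).
have A0 : \det (A 0) = 1.
  rewrite (_ : A 0 = 1%:M) ?det1//; apply/matrixP => I J.
  by rewrite mxE psum_recl ?mul0r ?addr0 ?X0.
have Ac := differentiable_continuous Ad.
have q0 : (fun N : nat => N.+1%:R^-1 : C) @ \oo --> (0 : C).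
  apply/cvg_rnormP; rewrite (_ : (fun _ => _) = @harmonic R); first exact: cvg_harmonic.
  by apply/funext => N; rewrite subr0 rnormV rnorm_natr.
have cvgA : (fun N : nat => \det (A (N.+1%:R^-1))) @ \oo --> \det (A 0).
  exact: (@cvg_comp _ _ _ (fun N : nat => N.+1%:R^-1 : C) (fun q => \det (A q)) _ _ _ q0 Ac).
have /cvg_rnormP/cvgrPdist_lt/(_ 1 ltr01)/filter_ex[N] := cvgA.
rewrite sub0r normrN ger0_norm ?rnorm_ge0// => NA.
exists (ln (N.+1%:R^-1 : R))%:C.
rewrite /Sol !unitmx_mul unitmx_inv restr_mx_unit// !andbT /=.
apply/andP; split.
  rewrite unitmxE unitfE.
  have -> : psum_mx X (ln (N.+1%:R^-1 : R))%:C = A (N.+1%:R^-1).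
    apply/matrixP => I J; rewrite !mxE; congr psum.
    by rewrite expC_real lnK ?posrE// fmorphV rmorph_nat.
  by apply/eqP => D0; move: NA; rewrite A0 D0 sub0r rnormN rnorm1 ltxx.
rewrite unitmxE det_diag unitfE; apply/prodf_neq0 => J _.
by rewrite mxE expC_neq0.
Qed.

End Main.

Theorem theorem8p2 (R : realType) (n : nat) (hn : (1 < n)%N) :
  (forall alpha : 'rV[R[i]]_n -> 'cV[R[i]]_n,
     H_Omega alpha -> sol_space (So alpha)) /\
  (forall F : K0 R n,
     [/\ H_Omega (B F),
         sol_space (theta F),
         (forall (tau : R[i]) (z : 'rV[R[i]]_n), Omega z ->
            theta F tau z = So (B F) tau z)
       & forall h : 'I_n -> 'rV[R[i]]_n -> R[i],
           (forall (tau : R[i]) (z : 'rV[R[i]]_n), Omega z ->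
              theta F tau z = \sum_j h j z *: Psi_top j tau z) ->
           forall z : 'rV[R[i]]_n, Omega z ->
             B F z = \sum_j h j z *: x_class R j]).
Proof.
have n0 : (n.-1 < n)%N by rewrite prednK// ltnW.
pose lst := Ordinal n0; have lstE : lst = n.-1 :> nat by [].
split=> [alpha|F]; first exact: (So_sol_space lstE).
have BH : H_Omega (B F) := @H_Omega_B_laurent R n (repr F).
have thE tau (z : 'rV[R[i]]_n) : Omega z -> theta F tau z = So (B F) tau z.
  exact: (theta_laurent_So lstE).
have [SD SH] := So_sol_space lstE BH.
split=> //.
- split=> [z zO|tau a z zO].
    have -> : (theta F)^~ z = (So (B F))^~ z by apply/funext => t; exact: thE.
    exact: SD.
  apply: differentiable_near_eq (SH tau a z zO).
  by apply: filterS (Omega_nbhs zO) => y yO; rewrite thE.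
move=> h hE z zO.
have [tau Su] := Sol_unit zO (mcoef_entire zO) (mcoef0 zO).
rewrite -[LHS](mulKmx Su) -[RHS](mulKmx Su); congr (_ *m _).
rewrite -(So_mx_mcoef lstE zO) -[LHS]/(So (B F) tau z) -thE// hE//.
by rewrite mulmx_sumr; apply: eq_bigr => j _; rewrite -scalemxAr.
Qed.
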